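(* For $z\in\mathbb{C}$ let $(\mathcal{T}_z,X_z)$ be the free rigid $\mathbb{C}$-linear $\otimes$-category on one object $X_z$ with Euler characteristic $z$. Then: (1) $X_z$ is not Schur-finite for any $z\in\mathbb{C}$. (2) $X_z$ is of integral type if and only if $z\in\mathbb{Z}$.
   Context: A $\otimes$-category is an additive, pseudo-abelian (idempotent complete) symmetric monoidal category $\mathcal{A}$ with biadditive $\otimes$, unit object $\mathbf{1}$ and symmetry $\tau$. $\mathcal{A}(X,Y)$ denotes morphisms, and $\mathcal{A}(X)=\mathcal{A}(X,X)$. It is $R$-linear if $\mathcal{A}(\mathbf{1})$ is an $R$-algebra. A $\otimes$-functor is a strong symmetric monoidal functor. $\mathcal{A}$ is rigid if every object $X$ has a dual $X^\vee$, with evaluation $\varepsilon_X\colon X^\vee\otimes X\to\mathbf{1}$ and coevaluation $\eta_X\colon\mathbf{1}\to X\otimes X^\vee$ satisfying the triangle identities. The Euler characteristic of $X$ is $\chi(X)=\varepsilon_X\circ\tau_{X,X^\vee}\circ\eta_X\in\mathcal{A}(\mathbf{1})$. Free category: let $R$ be a commutative ring with identity and $t\in R$. A free rigid $R$-linear $\otimes$-category on one object with Euler characteristic $t$ is a pair $(\mathcal{T}_t,X_t)$ such that (i) $\mathcal{T}_t$ is a rigid $R$-linear $\otimes$-category; (ii) $X_t$ is an object of $\mathcal{T}_t$ with $\chi(X_t)=t$; (iii) for any object $B$ with $\chi(B)=t$ in any rigid $R$-linear $\otimes$-category $\mathcal{B}$ there is, up to $\otimes$-isomorphism, a unique $R$-linear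 $\otimes$-functor $F\colon\mathcal{T}_t\to\mathcal{B}$ with $F(X_t)=B$. Such a pair exists and is unique up to $\otimes$-equivalence, and $\mathcal{T}_t(\mathbf{1})=R$. Schur-finiteness: let $\mathcal{A}$ be a $\otimes$-category with $\mathbb{Q}\subseteq\mathcal{A}(\mathbf{1})$. For a partition $\lambda$ of $n=|\lambda|$, let $V_\lambda$ be the corresponding irreducible representation of the symmetric group $\Sigma_n$ over $\mathbb{Q}$, with character $\chi_\lambda$. For an object $X$, $\Sigma_n$ acts on $X^{\otimes n}$ through the symmetry (write $\sigma_{X,\dots,X}$ for the action of $\sigma$), and one has the idempotent $\mathsf{d}^X_\lambda=\frac{\dim V_\lambda}{n!}\sum_{\sigma\in\Sigma_n}\chi_\lambda(\sigma)\,\sigma_{X,\dots,X}\in\mathcal{A}(X^{\otimes n})$. Set $S_\lambda(X)=\mathsf{d}^X_\lambda(X^{\otimes n})$, the image of this idempotent. The object $X$ is Schur-finite if $S_\lambda(X)=0$ for some partition $\lambda$. Integral type: let $\mathcal{A}$ be a rigid $\mathbb{C}$-linear $\otimes$-category with $\mathcal{A}(\mathbf{1})=\mathbb{C}$. An object $X$ is of integral type if (i) $\mathcal{A}(X)$ is a finite dimensional semisimple $\mathbb{C}$-algebra, and (ii) $\chi(X_i)\in\mathbb{Z}$ for each direct summand $X_i$ of $X$ such that $\mathcal{A}(X_i)$ is a simple $\mathbb{C}$-algebra. *)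

(* Defs.v *)
From HB Require Import structures.
From mathcomp Require Import all_boot all_order all_algebra.
From mathcomp Require Import all_fingroup.
From mathcomp Require Import mxrepresentation.

Set Implicit Arguments.
Unset Strict Implicit.
Unset Printing Implicit Defensive.

Import GRing.Theory.
Local Open Scope ring_scope.

Declare Scope tcat_scope.
Delimit Scope tcat_scope with tcat.
Local Open Scope tcat_scope.

Record preadditive := Preadditive {
  ob :> Type;
  hom : ob -> ob -> zmodType;
  idm : forall X, hom X X;
  comp : forall X Y Z, hom Y Z -> hom X Y -> hom X Z;
  compA : forall X Y Z W (h : hom Z W) (g : hom Y Z) (f : hom X Y),
    comp h (comp g f) = comp (comp h g) f;
  comp1m : forall X Y (f : hom X Y), comp (idm Y) f = f;
  compm1 : forall X Y (f : hom X Y), comp f (idm X) = f;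
  compDl : forall X Y Z (g h : hom Y Z) (f : hom X Y),
    comp (g + h) f = comp g f + comp h f;
  compDr : forall X Y Z (h : hom Y Z) (f g : hom X Y),
    comp h (f + g) = comp h f + comp h g }.

Arguments hom {p} X Y.
Arguments idm {p} X.
Arguments comp {p X Y Z} g f : rename.

Notation "g ∘ f" := (comp g f) (at level 40, left associativity) : tcat_scope.

Definition is_iso (A : preadditive) (X Y : A) (f : hom X Y) : Prop :=
  exists g : hom Y X, g ∘ f = idm X /\ f ∘ g = idm Y.

Definition is_zero_object (A : preadditive) (Z : A) : Prop :=
  forall Y : A, (forall f : hom Z Y, f = 0) /\ (forall f : hom Y Z, f = 0).

Definition is_biproduct (A : preadditive) (X Y S : A) : Prop :=
  exists (i1 : hom X S) (i2 : hom Y S) (p1 : hom S X) (p2 : hom S Y),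
    [/\ p1 ∘ i1 = idm X, p2 ∘ i2 = idm Y, p2 ∘ i1 = 0, p1 ∘ i2 = 0
      & i1 ∘ p1 + i2 ∘ p2 = idm S].

Definition is_direct_summand (A : preadditive) (Y X : A) : Prop :=
  exists Y' : A, is_biproduct Y Y' X.

Definition is_image (A : preadditive) (X : A) (e : hom X X) (S : A) : Prop :=
  exists (p : hom X S) (i : hom S X), p ∘ i = idm S /\ i ∘ p = e.

Definition additive_category (A : preadditive) : Prop :=
  (exists Z : A, is_zero_object Z) /\
  (forall X Y : A, exists S : A, is_biproduct X Y S).

Definition pseudo_abelian (A : preadditive) : Prop :=
  forall (X : A) (e : hom X X), e ∘ e = e -> exists S : A, is_image e S.

(* The ring A(X), with multiplication f * g = f ∘ g; it may be the zero ring. *)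
Definition endo (A : preadditive) (X : A) : Type := hom X X.

Section EndoRing.
Variables (A : preadditive) (X : A).
HB.instance Definition _ := GRing.Zmodule.on (endo X).
HB.instance Definition _ := GRing.Zmodule_isPzRing.Build (endo X)
  (@compA A X X X X) (@comp1m A X X) (@compm1 A X X)
  (fun f g h => @compDl A X X X f g h) (fun f g h => @compDr A X X X f g h).
End EndoRing.

Record tensor_category := TensorCategory {
  tc_cat :> preadditive;
  tc_additive : additive_category tc_cat;
  tc_pseudo_abelian : pseudo_abelian tc_cat;
  tens : tc_cat -> tc_cat -> tc_cat;
  tensm : forall X X' Y Y' : tc_cat,
    hom X X' -> hom Y Y' -> hom (tens X Y) (tens X' Y');
  tensm1 : forall X Y, tensm (idm X) (idm Y) = idm (tens X Y);
  tensmM : forall X X' X'' Y Y' Y'' (f' : hom X' X'') (f : hom X X')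
      (g' : hom Y' Y'') (g : hom Y Y'),
    tensm (f' ∘ f) (g' ∘ g) = tensm f' g' ∘ tensm f g;
  tensmDl : forall X X' Y Y' (f f' : hom X X') (g : hom Y Y'),
    tensm (f + f') g = tensm f g + tensm f' g;
  tensmDr : forall X X' Y Y' (f : hom X X') (g g' : hom Y Y'),
    tensm f (g + g') = tensm f g + tensm f g';
  tunit : tc_cat;
  assoc : forall X Y Z, hom (tens (tens X Y) Z) (tens X (tens Y Z));
  assocV : forall X Y Z, hom (tens X (tens Y Z)) (tens (tens X Y) Z);
  assocK : forall X Y Z, assocV X Y Z ∘ assoc X Y Z = idm _;
  assocVK : forall X Y Z, assoc X Y Z ∘ assocV X Y Z = idm _;
  assoc_nat : forall X X' Y Y' Z Z' (f : hom X X') (g : hom Y Y') (h : hom Z Z'),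
    assoc X' Y' Z' ∘ tensm (tensm f g) h
      = tensm f (tensm g h) ∘ assoc X Y Z;
  lunit : forall X, hom (tens tunit X) X;
  lunitV : forall X, hom X (tens tunit X);
  lunitK : forall X, lunitV X ∘ lunit X = idm _;
  lunitVK : forall X, lunit X ∘ lunitV X = idm _;
  lunit_nat : forall X Y (f : hom X Y),
    lunit Y ∘ tensm (idm tunit) f = f ∘ lunit X;
  runit : forall X, hom (tens X tunit) X;
  runitV : forall X, hom X (tens X tunit);
  runitK : forall X, runitV X ∘ runit X = idm _;
  runitVK : forall X, runit X ∘ runitV X = idm _;
  runit_nat : forall X Y (f : hom X Y),
    runit Y ∘ tensm f (idm tunit) = f ∘ runit X;
  symm : forall X Y, hom (tens X Y) (tens Y X);
  symm_nat : forall X X' Y Y' (f : hom X X') (g : hom Y Y'),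
    symm X' Y' ∘ tensm f g = tensm g f ∘ symm X Y;
  symmK : forall X Y, symm Y X ∘ symm X Y = idm _;
  tens_pentagon : forall X Y Z W,
    assoc X Y (tens Z W) ∘ assoc (tens X Y) Z W
      = tensm (idm X) (assoc Y Z W) ∘ assoc X (tens Y Z) W
          ∘ tensm (assoc X Y Z) (idm W);
  tens_triangle : forall X Y,
    tensm (idm X) (lunit Y) ∘ assoc X tunit Y = tensm (runit X) (idm Y);
  tens_hexagon : forall X Y Z,
    assoc Y Z X ∘ symm X (tens Y Z) ∘ assoc X Y Z
      = tensm (idm Y) (symm X Z) ∘ assoc Y X Z ∘ tensm (symm X Y) (idm Z) }.

Arguments tens {t} X Y.
Arguments tensm {t X X' Y Y'} f g : rename.
Arguments tunit {t}.
Arguments assoc {t} X Y Z.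
Arguments assocV {t} X Y Z.
Arguments lunit {t} X.
Arguments lunitV {t} X.
Arguments runit {t} X.
Arguments runitV {t} X.
Arguments symm {t} X Y.

Notation "X ⊗ Y" := (tens X Y) (at level 38, left associativity) : tcat_scope.
Notation "f ⊠ g" := (tensm f g) (at level 38, left associativity) : tcat_scope.
Notation "𝟏" := tunit : tcat_scope.

Record rigidity (A : tensor_category) := Rigidity {
  rdual : A -> A;
  rev : forall X, hom (rdual X ⊗ X) 𝟏;
  rcoev : forall X, hom 𝟏 (X ⊗ rdual X);
  rigid_zigzag : forall X,
    runit X ∘ (idm X ⊠ rev X) ∘ assoc X (rdual X) X
      ∘ (rcoev X ⊠ idm X) ∘ lunitV X = idm X;
  rigid_zagzig : forall X,
    lunit (rdual X) ∘ (rev X ⊠ idm (rdual X)) ∘ assocV (rdual X) X (rdual X)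
      ∘ (idm (rdual X) ⊠ rcoev X) ∘ runitV (rdual X) = idm (rdual X) }.

Record linear_tensor_category (R : comPzRingType) := LinearTensorCategory {
  lt_cat :> tensor_category;
  lt_alg : {rmorphism R -> endo (𝟏 : lt_cat)} }.

Section LinearHom.
Variables (R : comPzRingType) (A : linear_tensor_category R).

(* The R-module structure on A(X, Y) induced by R -> A(𝟏), via 𝟏 ⊗ X ≅ X. *)
Definition scalm (X Y : A) (r : R) (f : hom X Y) : hom X Y :=
  lunit Y ∘ ((lt_alg A r : hom 𝟏 𝟏) ⊠ f) ∘ lunitV X.

Definition lhom (X Y : A) : Type := hom X Y.

Lemma scalm_idE (X Y : A) r (f : hom X Y) : scalm r f = scalm r (idm Y) ∘ f.
Proof.
have natV : lunitV Y ∘ f = (idm 𝟏 ⊠ f) ∘ lunitV X.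
  rewrite -[f in LHS]compm1 -(lunitVK X) !compA -(compA _ f) -lunit_nat.
  by rewrite compA lunitK comp1m.
by rewrite /scalm -[RHS]compA natV [RHS]compA -[in RHS](compA (lunit Y)) -tensmM compm1 comp1m.
Qed.

Lemma scalmA (X Y : A) r s (f : hom X Y) :
  scalm r (scalm s f) = scalm (r * s) f.
Proof.
rewrite scalm_idE (scalm_idE s) (scalm_idE (r * s)) compA; congr (_ ∘ f).
rewrite /scalm rmorphM -[in RHS](comp1m (idm Y)) tensmM !compA.
by rewrite -(compA _ (lunitV Y) (lunit Y)) lunitK compm1.
Qed.

Lemma scalm1 (X Y : A) (f : hom X Y) : scalm 1 f = f.
Proof.
rewrite /scalm rmorph1 (_ : (1 : endo 𝟏) = idm 𝟏) // lunit_nat -compA.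
by rewrite lunitVK compm1.
Qed.

Lemma scalmDr (X Y : A) r (f g : hom X Y) :
  scalm r (f + g) = scalm r f + scalm r g.
Proof. by rewrite /scalm tensmDr compDr compDl. Qed.

Lemma scalmDl (X Y : A) (f : hom X Y) r s :
  scalm (r + s) f = scalm r f + scalm s f.
Proof. by rewrite /scalm rmorphD tensmDl compDr compDl. Qed.

HB.instance Definition _ (X Y : A) := GRing.Zmodule.on (lhom X Y).
HB.instance Definition _ (X Y : A) := GRing.Zmodule_isLmodule.Build R (lhom X Y)
  (@scalmA X Y) (@scalm1 X Y) (@scalmDr X Y) (@scalmDl X Y).
End LinearHom.

Record rigid_linear_category (R : comPzRingType) := RigidLinearCategory {
  rl_cat :> linear_tensor_category R;
  rl_rigid : rigidity rl_cat }.

Definition dual (R : comPzRingType) (A : rigid_linear_category R) (X : A) : A :=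
  rdual (rl_rigid A) X.
Definition ev (R : comPzRingType) (A : rigid_linear_category R) (X : A) :
  hom (dual X ⊗ X) 𝟏 := rev (rl_rigid A) X.
Definition coev (R : comPzRingType) (A : rigid_linear_category R) (X : A) :
  hom 𝟏 (X ⊗ dual X) := rcoev (rl_rigid A) X.

Definition euler_char (R : comPzRingType) (A : rigid_linear_category R) (X : A) :
  endo (𝟏 : A) := ev X ∘ symm X (dual X) ∘ coev X.

Record linear_tensor_functor (R : comPzRingType)
    (A B : linear_tensor_category R) := LinearTensorFunctor {
  fob :> A -> B;
  fhom : forall X Y : A, hom X Y -> hom (fob X) (fob Y);
  fhom1 : forall X, fhom (idm X) = idm (fob X);
  fhomM : forall X Y Z (g : hom Y Z) (f : hom X Y),
    fhom (g ∘ f) = fhom g ∘ fhom f;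
  fhomD : forall X Y (f g : hom X Y), fhom (f + g) = fhom f + fhom g;
  fhomZ : forall X Y (r : R) (f : hom X Y),
    fhom (scalm r f) = scalm r (fhom f);
  funit : hom 𝟏 (fob 𝟏);
  ftens : forall X Y, hom (fob X ⊗ fob Y) (fob (X ⊗ Y));
  funit_iso : is_iso funit;
  ftens_iso : forall X Y, is_iso (ftens X Y);
  ftens_nat : forall X X' Y Y' (f : hom X X') (g : hom Y Y'),
    ftens X' Y' ∘ (fhom f ⊠ fhom g) = fhom (f ⊠ g) ∘ ftens X Y;
  ftens_assoc : forall X Y Z,
    fhom (assoc X Y Z) ∘ ftens (X ⊗ Y) Z ∘ (ftens X Y ⊠ idm (fob Z))
      = ftens X (Y ⊗ Z) ∘ (idm (fob X) ⊠ ftens Y Z)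
          ∘ assoc (fob X) (fob Y) (fob Z);
  ftens_lunit : forall X,
    fhom (lunit X) ∘ ftens 𝟏 X ∘ (funit ⊠ idm (fob X)) = lunit (fob X);
  ftens_runit : forall X,
    fhom (runit X) ∘ ftens X 𝟏 ∘ (idm (fob X) ⊠ funit) = runit (fob X);
  ftens_symm : forall X Y,
    fhom (symm X Y) ∘ ftens X Y = ftens Y X ∘ symm (fob X) (fob Y) }.

Arguments fhom {R A B} F {X Y} f : rename.
Arguments funit {R A B} F : rename.
Arguments ftens {R A B} F X Y : rename.

Definition tensor_isomorphic (R : comPzRingType)
    (A B : linear_tensor_category R) (F G : linear_tensor_functor A B) : Prop :=
  exists u : forall X : A, hom (F X) (G X),
    [/\ forall X, is_iso (u X),
        forall X Y (f : hom X Y), u Y ∘ fhom F f = fhom G f ∘ u X,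
        u 𝟏 ∘ funit F = funit G
      & forall X Y, u (X ⊗ Y) ∘ ftens F X Y = ftens G X Y ∘ (u X ⊠ u Y)].

Definition is_free_on (R : comPzRingType) (t : R)
    (T : rigid_linear_category R) (X : T) : Prop :=
  euler_char X = lt_alg T t /\
  forall (B : rigid_linear_category R) (Y : B), euler_char Y = lt_alg B t ->
    (exists F : linear_tensor_functor T B, F X = Y) /\
    (forall F G : linear_tensor_functor T B,
       F X = Y -> G X = Y -> tensor_isomorphic F G).

Definition is_partition (la : seq nat) : bool := sorted geq la && (0%N \notin la).

Section SymmetricGroupCharacter.
Variable la : seq nat.
Local Notation n := (sumn la).
Local Notation G := [set: 'S_n]%G.

(* The cells of the diagram of la are numbered 0, ..., n-1 row by row, so that
   cell i lies in row reshape_index la i and column reshape_offset la i. *)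
Definition row_group : {set 'S_n} :=
  [set s : 'S_n | [forall i, reshape_index la (s i) == reshape_index la i]].
Definition col_group : {set 'S_n} :=
  [set s : 'S_n | [forall i, reshape_offset la (s i) == reshape_offset la i]].

(* The Young symmetrizer \sum_(p, q) sgn(q) p q, as a vector of the regular
   representation of the symmetric group over rat. *)
Definition young_symmetrizer : 'rV[rat]_#|G| :=
  \sum_(p in row_group) \sum_(q in col_group)
    (-1) ^+ (q : bool) *: delta_mx 0 (gring_index G (p * q)%g).

(* V_la is the ideal of the group algebra generated by the Young symmetrizer. *)
Definition specht_mx : 'M[rat]_#|G| :=
  cyclic_mx (regular_repr rat G) young_symmetrizer.
Definition specht_repr : mx_representation rat G (\rank specht_mx) :=
  submod_repr (cyclic_mx_module (regular_repr rat G) young_symmetrizer).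

Definition specht_dim : nat := \rank specht_mx.
Definition specht_char (s : 'S_n) : rat := \tr (specht_repr s).
End SymmetricGroupCharacter.

Lemma unlift_perm_inj n (s : 'S_n.+1) :
  injective (fun k : 'I_n => odflt k (unlift (s ord0) (s (lift ord0 k)))).
Proof.
have lts k : s ord0 != s (lift ord0 k) by rewrite (inj_eq perm_inj) neq_lift.
move=> k l /=; case: (unlift_some (lts k)) => a ea ->.
case: (unlift_some (lts l)) => b eb -> /= ab; apply: (@lift_inj _ ord0).
by apply: (@perm_inj _ s); rewrite ea eb ab.
Qed.

(* The permutation s' such that s = lift_perm ord0 (s ord0) s'. *)
Definition unlift_perm n (s : 'S_n.+1) : 'S_n := perm (unlift_perm_inj (s := s)).

Lemma unlift_permK n (s : 'S_n.+1) : lift_perm ord0 (s ord0) (unlift_perm s) = s.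
Proof.
apply/permP => i; case: (unliftP ord0 i) => [k ->|->]; last by rewrite lift_perm_id.
rewrite lift_perm_lift permE.
have lts : s ord0 != s (lift ord0 k) by rewrite (inj_eq perm_inj) neq_lift.
by case: (unlift_some lts) => a -> ->.
Qed.

Section TensorPower.
Variables (A : tensor_category) (X : A).

Fixpoint tpow (n : nat) : A := if n is m.+1 then X ⊗ tpow m else 𝟏.

Definition swap12 (Y : A) : hom (X ⊗ (X ⊗ Y)) (X ⊗ (X ⊗ Y)) :=
  assoc X X Y ∘ (symm X X ⊠ idm Y) ∘ assocV X X Y.

(* Moves the first factor to position j, shifting the factors in positions
   1, ..., j one place to the left. *)
Fixpoint move_first (n j : nat) : hom (tpow n.+1) (tpow n.+1) :=
  match n, j with
  | m.+1, j'.+1 => (idm X ⊠ move_first m j') ∘ swap12 (tpow m)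
  | _, _ => idm _
  end.

(* The action of s on the tensor power, moving the factor in position i to
   position s i. *)
Fixpoint perm_act (n : nat) : 'S_n -> hom (tpow n) (tpow n) :=
  match n with
  | 0 => fun _ => idm _
  | m.+1 => fun s => move_first m (s ord0) ∘ (idm X ⊠ perm_act (unlift_perm s))
  end.
End TensorPower.

Definition schur_idem (K : numFieldType) (A : linear_tensor_category K)
    (la : seq nat) (X : A) : hom (tpow X (sumn la)) (tpow X (sumn la)) :=
  scalm (ratr ((specht_dim la)%:R / ((sumn la)`!)%:R) : K)
    (\sum_(s : 'S_(sumn la)) scalm (ratr (specht_char s) : K) (perm_act X s)).

Definition schur_finite (K : numFieldType) (A : linear_tensor_category K)
    (X : A) : Prop :=
  exists la : seq nat, is_partition la /\
    exists S : A, is_image (schur_idem la X) S /\ is_zero_object S.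

Definition finite_dimensional (K : fieldType) (V : lmodType K) : Prop :=
  exists (n : nat) (b : 'I_n -> V),
    forall v : V, exists c : 'I_n -> K, v = \sum_(i < n) c i *: b i.

Definition left_ideal (E : pzRingType) (I : E -> Prop) : Prop :=
  [/\ I 0, forall x y, I x -> I y -> I (x + y) & forall a x, I x -> I (a * x)].

Definition two_sided_ideal (E : pzRingType) (I : E -> Prop) : Prop :=
  left_ideal I /\ forall a x, I x -> I (x * a).

(* Semisimple as a left module over itself: every submodule is a direct
   summand. *)
Definition semisimple_ring (E : pzRingType) : Prop :=
  forall I : E -> Prop, left_ideal I ->
    exists J : E -> Prop, [/\ left_ideal J,
      forall x, I x -> J x -> x = 0
      & forall a, exists x y, [/\ I x, J y & a = x + y]].

Definition simple_ring (E : pzRingType) : Prop :=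
  (1 : E) <> 0 /\
  forall I : E -> Prop, two_sided_ideal I ->
    (forall x, I x -> x = 0) \/ (forall x, I x).

Definition integral_type (K : fieldType) (A : rigid_linear_category K) (X : A) :
    Prop :=
  [/\ finite_dimensional (lhom X X), semisimple_ring (endo X)
    & forall Y : A, is_direct_summand Y X -> simple_ring (endo Y) ->
        exists m : int, euler_char Y = m%:~R].

(* Main.v *)
(** Upper bound: [X] has only scalar endomorphisms. Let [C] be the category of
    objects of [T] presented as retracts of sums of tensor words in [X] and its
    dual, with the morphisms that are combinations of diagrams (composites of
    symmetries, evaluations and coevaluations). It is rigid, and a reduction of
    diagrams to normal form shows that [X] has only scalar endomorphisms in it.
    By freeness there is a functor [T -> C] preserving [X], and its composite
    with the forgetful functor [C -> T] is isomorphic to the identity; so every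
    endomorphism of [X] in [T] is scalar too. Hence [X] is of integral type iff
    its Euler characteristic, a scalar, is an integer.

    Lower bound: by freeness it is enough to find one object [N] of Euler
    characteristic [z] with nonzero Schur idempotents. The representation
    category of the group of finitary permutations of the natural numbers
    interpolated at [z] contains one: morphisms are invariant kernels between
    sets such as [nat ^ n], composed by means of the finitely additive measure on
    [nat] that gives mass 1 to points and mass [z] to [nat] itself. Permutations
    of [N ^ n] are linearly independent there, as the points of [nat ^ n] with
    distinct coordinates have trivial stabilizer. *)
Require Import Defs.
From HB Require Import structures.
From mathcomp Require Import all_boot all_order all_algebra all_fingroup.
From mathcomp Require Import mxrepresentation boolp functions.
From mathcomp Require Import reals complex.
Import Defs.

Set Implicit Arguments.
Unset Strict Implicit.
Unset Printing Implicit Defensive.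

Import GRing.Theory Num.Theory.
Local Open Scope ring_scope.
Local Open Scope tcat_scope.

(** * Tensor categories *)

(** Freeness describes functors out of [T] and says nothing directly about its morphisms: neither
    spanning nor independence of diagrams is given, nor injectivity of [lt_alg T]. Freeness tests
    additive, pseudo-abelian, rigid categories, which forces the category built inside [T] to
    contain sums, images and duals, and the model to be completed by splitting idempotents. It also
    asks for [F X = Y] as an equality of objects, so each object of the subcategory keeps its
    carrier in [T] and forgetting is strict. Diagrams are never handled as combinatorial objects. A
    morphism counts as diagrammatic when it preserves, in every context, the span of permuted
    products of coevaluations; the one reduction step is the contraction of such a tensor.
    Representations of general linear supergroups would not do as a model: their objects are
    Schur-finite of integral Euler characteristic. Interpolating permutation representations works
    uniformly in [z] and makes every set its own dual. *)

Section Preadditive.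
Variable A : preadditive.
Implicit Types X Y Z W : A.

Lemma comp0m X Y Z (f : hom X Y) : (0 : hom Y Z) ∘ f = 0.
Proof. by apply: (@addrI _ (0 ∘ f)); rewrite -compDl !addr0. Qed.

Lemma compm0 X Y Z (f : hom Y Z) : f ∘ (0 : hom X Y) = 0.
Proof. by apply: (@addrI _ (f ∘ 0)); rewrite -compDr !addr0. Qed.

Lemma compNm X Y Z (g : hom Y Z) (f : hom X Y) : (- g) ∘ f = - (g ∘ f).
Proof. by apply: (@addrI _ (g ∘ f)); rewrite -compDl !subrr comp0m. Qed.

Lemma compmN X Y Z (g : hom Y Z) (f : hom X Y) : g ∘ (- f) = - (g ∘ f).
Proof. by apply: (@addrI _ (g ∘ f)); rewrite -compDr !subrr compm0. Qed.

Lemma comp_suml (I : finType) (P : pred I) X Y Z (g : I -> hom Y Z) (f : hom X Y) :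
  (\sum_(i | P i) g i) ∘ f = \sum_(i | P i) (g i ∘ f).
Proof. by apply: (big_morph (fun g => g ∘ f)) => [g' g''|]; rewrite ?compDl ?comp0m. Qed.

Lemma comp_sumr (I : finType) (P : pred I) X Y Z (g : hom Y Z) (f : I -> hom X Y) :
  g ∘ (\sum_(i | P i) f i) = \sum_(i | P i) (g ∘ f i).
Proof. by apply: (big_morph (fun f => g ∘ f)) => [g' g''|]; rewrite ?compDr ?compm0. Qed.

Lemma post2 X Y Z W (b : hom Y Z) (a : hom X Y) r :
  b ∘ a = r -> forall h : hom Z W, h ∘ b ∘ a = h ∘ r.
Proof. by move=> <- h; rewrite !compA. Qed.

Lemma post3 X Y Z U W (c : hom Z U) (b : hom Y Z) (a : hom X Y) r :
  c ∘ b ∘ a = r -> forall h : hom U W, h ∘ c ∘ b ∘ a = h ∘ r.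
Proof. by move=> <- h; rewrite !compA. Qed.

Lemma post4 X Y Z U V W (d : hom U V) (c : hom Z U) (b : hom Y Z) (a : hom X Y) r :
  d ∘ c ∘ b ∘ a = r -> forall h : hom V W, h ∘ d ∘ c ∘ b ∘ a = h ∘ r.
Proof. by move=> <- h; rewrite !compA. Qed.

Lemma cancel_post X Y Z (k : hom Z Y) (h : hom Y Z) (f g : hom X Y) :
  k ∘ h = idm Y -> h ∘ f = h ∘ g -> f = g.
Proof. by move=> e /(congr1 (comp k)); rewrite !compA e !comp1m. Qed.

Lemma cancel_pre X Y Z (k : hom Y Z) (h : hom Z Y) (f g : hom Y X) :
  h ∘ k = idm Y -> f ∘ h = g ∘ h -> f = g.
Proof. by move=> e /(congr1 (fun f => f ∘ k)); rewrite -!compA e !compm1. Qed.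
End Preadditive.

(* Rewrites a subword of a left-nested composite. *)
Tactic Notation "crw" uconstr(H) := rewrite ?compA;
  first [ rewrite H | rewrite (post2 H) | rewrite (post3 H) | rewrite (post4 H) ];
  rewrite ?compA ?compm1 ?comp1m.

(** * Consequences of the coherence axioms *)

Section Monoidal.
Variable A : tensor_category.
Implicit Types P Q R X Y Z W : A.

Lemma tensm0 X X' Y Y' (f : hom X X') : f ⊠ (0 : hom Y Y') = 0.
Proof. by apply: (@addrI _ (f ⊠ 0)); rewrite -tensmDr !addr0. Qed.

Lemma tens0m X X' Y Y' (f : hom X X') : (0 : hom Y Y') ⊠ f = 0.
Proof. by apply: (@addrI _ (0 ⊠ f)); rewrite -tensmDl !addr0. Qed.

Lemma tens_suml (I : finType) (D : pred I) X X' Y Y' (f : I -> hom X X') (g : hom Y Y') :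
  (\sum_(i | D i) f i) ⊠ g = \sum_(i | D i) (f i ⊠ g).
Proof. by apply: (big_morph (fun f => f ⊠ g)) => [? ?|]; rewrite ?tensmDl ?tens0m. Qed.

Lemma tens_sumr (I : finType) (D : pred I) X X' Y Y' (f : hom X X') (g : I -> hom Y Y') :
  f ⊠ (\sum_(i | D i) g i) = \sum_(i | D i) (f ⊠ g i).
Proof. by apply: (big_morph (fun g => f ⊠ g)) => [? ?|]; rewrite ?tensmDr ?tensm0. Qed.

Lemma tens_lr X X' Y Y' (f : hom X X') (g : hom Y Y') :
  (f ⊠ idm Y') ∘ (idm X ⊠ g) = f ⊠ g.
Proof. by rewrite -tensmM compm1 comp1m. Qed.

Lemma tens_rl X X' Y Y' (f : hom X X') (g : hom Y Y') :
  (idm X' ⊠ g) ∘ (f ⊠ idm Y) = f ⊠ g.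
Proof. by rewrite -tensmM compm1 comp1m. Qed.

Lemma tens_swap X X' Y Y' (f : hom X X') (g : hom Y Y') :
  (idm X' ⊠ g) ∘ (f ⊠ idm Y) = (f ⊠ idm Y') ∘ (idm X ⊠ g).
Proof. by rewrite tens_lr tens_rl. Qed.

Lemma tens1M P X Y Z (g : hom Y Z) (f : hom X Y) :
  idm P ⊠ (g ∘ f) = (idm P ⊠ g) ∘ (idm P ⊠ f).
Proof. by rewrite -tensmM compm1. Qed.

Lemma tensM1 P X Y Z (g : hom Y Z) (f : hom X Y) :
  (g ∘ f) ⊠ idm P = (g ⊠ idm P) ∘ (f ⊠ idm P).
Proof. by rewrite -tensmM compm1. Qed.

Lemma tens1K P X Y (g : hom Y X) (f : hom X Y) :
  g ∘ f = idm X -> (idm P ⊠ g) ∘ (idm P ⊠ f) = idm (P ⊗ X).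
Proof. by move=> e; rewrite -tens1M e tensm1. Qed.

Lemma tensK1 P X Y (g : hom Y X) (f : hom X Y) :
  g ∘ f = idm X -> (g ⊠ idm P) ∘ (f ⊠ idm P) = idm (X ⊗ P).
Proof. by move=> e; rewrite -tensM1 e tensm1. Qed.

Lemma assocV_nat X X' Y Y' Z Z' (f : hom X X') (g : hom Y Y') (h : hom Z Z') :
  assocV X' Y' Z' ∘ (f ⊠ (g ⊠ h)) = (f ⊠ g ⊠ h) ∘ assocV X Y Z.
Proof.
apply: (cancel_pre (assocVK X Y Z)); apply: (cancel_post (assocK X' Y' Z')).
by rewrite !compA assocVK comp1m -(compA _ (assocV X Y Z)) assocK compm1 assoc_nat.
Qed.

Lemma lunitV_nat X Y (f : hom X Y) :
  lunitV Y ∘ f = (idm 𝟏 ⊠ f) ∘ lunitV X.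
Proof.
apply: (cancel_post (lunitK Y)).
by rewrite !compA lunitVK comp1m lunit_nat -compA lunitVK compm1.
Qed.

Lemma runitV_nat X Y (f : hom X Y) :
  runitV Y ∘ f = (f ⊠ idm 𝟏) ∘ runitV X.
Proof.
apply: (cancel_post (runitK Y)).
by rewrite !compA runitVK comp1m runit_nat -compA runitVK compm1.
Qed.

Lemma tens1_inj X Y (f g : hom X Y) : idm (𝟏 : A) ⊠ f = idm 𝟏 ⊠ g -> f = g.
Proof.
move=> e; apply: (cancel_pre (lunitVK X)).
by rewrite -!lunit_nat e.
Qed.

Lemma tensI1_inj X Y (f g : hom X Y) : f ⊠ idm (𝟏 : A) = g ⊠ idm 𝟏 -> f = g.
Proof.
move=> e; apply: (cancel_pre (runitVK X)).
by rewrite -!runit_nat e.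
Qed.

(** Kelly's argument: tensoring with [𝟏] is faithful, and after it the claim follows from the
    pentagon on [𝟏, 𝟏, X, Y] and two triangles. *)
Lemma lunit_tens X Y : lunit (X ⊗ Y) ∘ assoc 𝟏 X Y = lunit X ⊠ idm Y.
Proof.
apply: tens1_inj; rewrite tens1M.
have K : (assoc 𝟏 𝟏 X ⊠ idm Y) ∘ (assocV 𝟏 𝟏 X ⊠ idm Y) = idm _.
  by rewrite -tensM1 assocVK tensm1.
apply: (cancel_pre (assocVK _ _ _)); apply: (cancel_pre K).
rewrite -assoc_nat.
crw (esym (tensM1 _ _ _)).
rewrite tens_triangle.
crw (esym (tens_pentagon _ _ _ _)).
crw (tens_triangle _ _).
by rewrite -(tensm1 X Y) assoc_nat.
Qed.

Lemma lunit_unit : lunit 𝟏 = runit 𝟏 :> hom (𝟏 ⊗ 𝟏 : A) 𝟏.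
Proof.
apply: tensI1_inj; rewrite -lunit_tens -tens_triangle; congr (_ ∘ _).
by apply: (cancel_post (lunitK _)); rewrite lunit_nat.
Qed.

Lemma lunitV_unit : lunitV 𝟏 = runitV 𝟏 :> hom (𝟏 : A) (𝟏 ⊗ 𝟏).
Proof.
by apply: (cancel_post (lunitK _)); rewrite lunitVK lunit_unit runitVK.
Qed.

(** The hexagon with both last objects equal to [𝟏], read after tensoring with [𝟏] on the right,
    which is faithful. *)
Lemma lunit_symm X : lunit X ∘ symm X 𝟏 = runit X.
Proof.
apply: tensI1_inj; apply: (cancel_post (symmK X 𝟏)).
rewrite tensM1 -lunit_tens.
crw (esym (lunit_nat _)).
crw (esym (tens_hexagon _ _ _)).
crw (lunit_tens _ _).
crw (esym (symm_nat _ _)).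
by crw (tens_triangle _ _).
Qed.

Lemma runit_symm X : runit X ∘ symm 𝟏 X = lunit X.
Proof. by rewrite -lunit_symm -compA symmK compm1. Qed.

Lemma symm_lunitV X : symm 𝟏 X ∘ lunitV X = runitV X.
Proof.
apply: (cancel_post (runitK X)).
by rewrite compA runit_symm lunitVK runitVK.
Qed.

Lemma symm_runitV X : symm X 𝟏 ∘ runitV X = lunitV X.
Proof. by rewrite -symm_lunitV compA symmK comp1m. Qed.

Lemma assoc_lunitV X Y : assoc 𝟏 X Y ∘ (lunitV X ⊠ idm Y) = lunitV (X ⊗ Y).
Proof.
apply: (cancel_post (lunitK _)).
by rewrite compA lunit_tens -tensM1 !lunitVK tensm1.
Qed.

Lemma assoc_runitV X Y :
  assoc X 𝟏 Y ∘ (runitV X ⊠ idm Y) = idm X ⊠ lunitV Y.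
Proof.
have K : (idm X ⊠ lunitV Y) ∘ (idm X ⊠ lunit Y) = idm _.
  by rewrite -tens1M lunitK tensm1.
apply: (cancel_post K).
by rewrite compA tens_triangle -tensM1 -tens1M runitVK lunitVK !tensm1.
Qed.

(* The symmetry of the first two factors of a right-nested tensor product; in
   this form the associators disappear from the coherence relations. It is
   locked, since the unifier would otherwise reassociate composites inside it. *)
Definition sw P Q Z : hom (P ⊗ (Q ⊗ Z)) (Q ⊗ (P ⊗ Z)) :=
  locked (assoc Q P Z ∘ (symm P Q ⊠ idm Z) ∘ assocV P Q Z).

Lemma swE P Q Z : sw P Q Z = assoc Q P Z ∘ (symm P Q ⊠ idm Z) ∘ assocV P Q Z.
Proof. by rewrite /sw -lock. Qed.

Lemma sw_nat P P' Q Q' Z Z' (f : hom P P') (g : hom Q Q') (h : hom Z Z') :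
  sw P' Q' Z' ∘ (f ⊠ (g ⊠ h)) = (g ⊠ (f ⊠ h)) ∘ sw P Q Z.
Proof.
rewrite !swE; crw (assocV_nat _ _ _); crw (esym (assoc_nat _ _ _)).
by crw (esym (tensmM _ _ _ _)); crw (esym (tensmM _ _ _ _)); rewrite symm_nat.
Qed.

Lemma swK P Q Z : sw Q P Z ∘ sw P Q Z = idm _.
Proof.
rewrite !swE; crw (assocK _ _ _); crw (esym (tensM1 _ _ _)); rewrite symmK tensm1.
by rewrite compm1 assocVK.
Qed.

Lemma pentagonV X Y Z W :
  (idm X ⊠ assocV Y Z W) ∘ assoc X Y (Z ⊗ W) =
  assoc X (Y ⊗ Z) W ∘ (assoc X Y Z ⊠ idm W) ∘ assocV (X ⊗ Y) Z W.
Proof.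
apply: (cancel_pre (assocVK _ _ _)).
crw (tens_pentagon _ _ _ _); crw (assocK _ _ _).
by crw (esym (tens1M _ _ _)); rewrite assocK tensm1 comp1m.
Qed.

Lemma sw_tensr P Q R Z :
  (idm Q ⊠ sw P R Z) ∘ sw P Q (R ⊗ Z) =
  assoc Q R (P ⊗ Z) ∘ sw P (Q ⊗ R) Z ∘ (idm P ⊠ assocV Q R Z).
Proof.
(* On the left-nested tensor product ((P Q) R) Z this is the hexagon. *)
apply: (cancel_pre (assocVK P Q (R ⊗ Z))); apply: (cancel_pre (assocVK (P ⊗ Q) R Z)).
crw (pentagonV _ _ _ _).
rewrite !swE; crw (assocK _ _ _); crw (assocK _ _ _); crw (assocK _ _ _).
rewrite !tens1M; crw (pentagonV _ _ _ _).
rewrite -(tensm1 R Z); crw (assocV_nat _ _ _); crw (assocK _ _ _).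
crw (esym (assoc_nat _ _ _)); crw (tens_pentagon _ _ _ _).
by rewrite -!(compA ((idm Q ⊠ assoc R P Z) ∘ _)) -!tensM1 tens_hexagon.
Qed.

Lemma sw_unit P Z : sw P 𝟏 Z ∘ (idm P ⊠ lunitV Z) = lunitV (P ⊗ Z).
Proof.
rewrite swE -assoc_runitV; crw (assocK _ _ _).
by crw (esym (tensM1 _ _ _)); rewrite symm_runitV assoc_lunitV.
Qed.

Lemma sw_unitl P Z : sw 𝟏 P Z ∘ lunitV (P ⊗ Z) = idm P ⊠ lunitV Z.
Proof. by rewrite -sw_unit compA swK comp1m. Qed.

(** [sw_tensr] with all maps inverted, as [sw] is inverse to itself with its first two objects
    exchanged. *)
Lemma sw_tensl P Q R Z :
  sw P R (Q ⊗ Z) ∘ (idm P ⊠ sw Q R Z) =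
  (idm R ⊠ assoc P Q Z) ∘ sw (P ⊗ Q) R Z ∘ assocV P Q (R ⊗ Z).
Proof.
have K : (idm P ⊠ sw Q R Z) ∘ (idm P ⊠ sw R Q Z) = idm _.
  by rewrite -tens1M swK tensm1.
apply: (cancel_post (swK R P (Q ⊗ Z))); apply: (cancel_post K).
crw (swK _ _ _); rewrite -tens1M swK tensm1 sw_tensr.
crw (tens1K _ (assocK _ _ _)).
by crw (swK _ _ _); rewrite assocVK.
Qed.

(** The Yang-Baxter relation: moving [P] past [Q ⊗ R] is natural in [Q ⊗ R], hence commutes with the
    symmetry of [Q] and [R]. *)
Lemma sw_braid P Q R Z :
  (idm R ⊠ sw P Q Z) ∘ sw P R (Q ⊗ Z) ∘ (idm P ⊠ sw Q R Z) =
  sw Q R (P ⊗ Z) ∘ (idm Q ⊠ sw P R Z) ∘ sw P Q (R ⊗ Z).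
Proof.
rewrite sw_tensr; crw (sw_tensr _ _ _ _).
rewrite ![sw Q R _]swE !tens1M.
crw (tens1K _ (assocK _ _ _)); crw (assocK _ _ _).
crw (sw_nat (idm P) (symm Q R) (idm Z)).
by rewrite -(tensm1 P Z).
Qed.

(** * Insertion and contraction in right-nested products *)

Section Insert.
Variables (U : A) (c : hom 𝟏 U).
Definition ins Z : hom Z (U ⊗ Z) := locked ((c ⊠ idm Z) ∘ lunitV Z).

Lemma insE Z : ins Z = (c ⊠ idm Z) ∘ lunitV Z.
Proof. by rewrite /ins -lock. Qed.

Lemma ins_nat Z Z' (f : hom Z Z') : ins Z' ∘ f = (idm U ⊠ f) ∘ ins Z.
Proof. by rewrite !insE -compA lunitV_nat !compA tens_lr tens_rl. Qed.

Lemma sw_ins P Z : sw P U Z ∘ (idm P ⊠ ins Z) = ins (P ⊗ Z).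
Proof. by rewrite !insE tens1M; crw (sw_nat _ _ _); rewrite tensm1; crw (sw_unit _ _). Qed.
End Insert.

Section Delete.
Variables (U : A) (c : hom U 𝟏).
Definition del Z : hom (U ⊗ Z) Z := locked (lunit Z ∘ (c ⊠ idm Z)).

Lemma delE Z : del Z = lunit Z ∘ (c ⊠ idm Z).
Proof. by rewrite /del -lock. Qed.

Lemma del_nat Z Z' (f : hom Z Z') : f ∘ del Z = del Z' ∘ (idm U ⊠ f).
Proof. by rewrite !delE compA -lunit_nat -!compA tens_lr tens_rl. Qed.

Lemma sw_del P Z : (idm P ⊠ del Z) ∘ sw U P Z = del (P ⊗ Z).
Proof.
have K : lunitV (P ⊗ Z) ∘ lunit (P ⊗ Z) = idm _ by apply: lunitK.
apply: (cancel_pre (swK U P Z)); crw (swK _ _ _).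
rewrite !delE tens1M -(tensm1 P Z); crw (esym (sw_nat _ _ _)).
have -> : lunit (P ⊗ Z) ∘ sw P 𝟏 Z = idm P ⊠ lunit Z; last by [].
have K' : (idm P ⊠ lunitV Z) ∘ (idm P ⊠ lunit Z) = idm _.
  by rewrite -tens1M lunitK tensm1.
apply: (cancel_pre K'); crw (sw_unit _ _).
by rewrite lunitVK -tens1M lunitVK tensm1.
Qed.
End Delete.

Lemma pentagonV' X Y Z W :
  assocV X Y (Z ⊗ W) ∘ (idm X ⊠ assoc Y Z W) =
  assoc (X ⊗ Y) Z W ∘ (assocV X Y Z ⊠ idm W) ∘ assocV X (Y ⊗ Z) W.
Proof.
apply: (cancel_post (assocK X Y (Z ⊗ W))).
crw (assocVK _ _ _); crw (tens_pentagon _ _ _ _).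
by crw (tensK1 _ (assocVK _ _ _)); crw (assocVK _ _ _).
Qed.

Lemma assocV_lunitV X Y : assocV X 𝟏 Y ∘ (idm X ⊠ lunitV Y) = runitV X ⊠ idm Y.
Proof. by rewrite -assoc_runitV compA assocK comp1m. Qed.

Section Cup.
Variables (P P' : A) (n : hom 𝟏 (P ⊗ P')).

Definition cup Z : hom Z (P ⊗ (P' ⊗ Z)) := locked (assoc P P' Z ∘ ins n Z).

Lemma cupE Z : cup Z = assoc P P' Z ∘ ins n Z.
Proof. by rewrite /cup -lock. Qed.

Lemma cup_nat Z Z' (f : hom Z Z') : cup Z' ∘ f = (idm P ⊠ (idm P' ⊠ f)) ∘ cup Z.
Proof. by rewrite !cupE -compA ins_nat !compA -assoc_nat tensm1. Qed.

(** Both legs cross [Q] together as the single object [P ⊗ P'] ([sw_tensr]), and what is inserted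
    from [𝟏] crosses freely ([sw_ins]). *)
Lemma sw_cup Q Z :
  (idm P ⊠ sw Q P' Z) ∘ sw Q P (P' ⊗ Z) ∘ (idm Q ⊠ cup Z) = cup (Q ⊗ Z).
Proof.
rewrite sw_tensr !cupE tens1M.
by crw (tens1K _ (assocK _ _ _)); rewrite -compA sw_ins.
Qed.

Lemma cup_tens Z W :
  assoc P (P' ⊗ Z) W ∘ (cup Z ⊠ idm W) = (idm P ⊠ assocV P' Z W) ∘ cup (Z ⊗ W).
Proof.
rewrite !cupE !insE tensM1 tensM1; crw (pentagonV _ _ _ _).
rewrite -[idm (Z ⊗ W)]tensm1; crw (assocV_nat _ _ _).
by rewrite -assoc_lunitV; crw (assocK _ _ _).
Qed.
End Cup.

Section Cap.
Variables (P' P : A) (e : hom (P' ⊗ P) 𝟏).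

Definition cap Z : hom (P' ⊗ (P ⊗ Z)) Z := locked (del e Z ∘ assocV P' P Z).

Lemma capE Z : cap Z = del e Z ∘ assocV P' P Z.
Proof. by rewrite /cap -lock. Qed.

Lemma cap_nat Z Z' (f : hom Z Z') : f ∘ cap Z = cap Z' ∘ (idm P' ⊠ (idm P ⊠ f)).
Proof. by rewrite !capE compA del_nat -!compA assocV_nat tensm1. Qed.

Lemma sw_cap Q Z :
  (idm Q ⊠ cap Z) ∘ sw P' Q (P ⊗ Z) ∘ (idm P' ⊠ sw P Q Z) = cap (Q ⊗ Z).
Proof.
rewrite -compA sw_tensl !capE tens1M.
by crw (tens1K _ (assocK _ _ _)); rewrite sw_del.
Qed.

Lemma cap_tens Z W :
  cap Z ⊠ idm W = cap (Z ⊗ W) ∘ (idm P' ⊠ assoc P Z W) ∘ assoc P' (P ⊗ Z) W.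
Proof.
rewrite !capE !delE !tensM1; crw (pentagonV' _ _ _ _); crw (assocK _ _ _).
rewrite -[idm (Z ⊗ W)]tensm1; crw (esym (assoc_nat _ _ _)).
by crw (lunit_tens _ _).
Qed.
End Cap.

Lemma cup_tensl P P' P1 P1' (n : hom 𝟏 (P ⊗ P')) (f : hom P P1) (g : hom P' P1') Z :
  cup ((f ⊠ g) ∘ n) Z = (f ⊠ (g ⊠ idm Z)) ∘ cup n Z.
Proof. by rewrite !cupE !insE tensM1; crw (assoc_nat _ _ _). Qed.

Lemma cap_tensr P P' P1 P1' (e : hom (P' ⊗ P) 𝟏) (f : hom P1 P) (g : hom P1' P') Z :
  cap (e ∘ (g ⊠ f)) Z = cap e Z ∘ (g ⊠ (f ⊠ idm Z)).
Proof. by rewrite !capE !delE tensM1; crw (assocV_nat _ _ _). Qed.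

(** Together with [cup_inj], transfers identities proved in right-nested form back to the bare
    evaluation or coevaluation. *)
Lemma cap_inj P P' (e e' : hom (P' ⊗ P) 𝟏) : cap e 𝟏 = cap e' 𝟏 -> e = e'.
Proof.
rewrite !capE !delE => /(cancel_pre (assocK _ _ _)) /(cancel_post (lunitK _)).
exact: tensI1_inj.
Qed.

Lemma cup_inj P P' (n n' : hom 𝟏 (P ⊗ P')) : cup n 𝟏 = cup n' 𝟏 -> n = n'.
Proof.
rewrite !cupE !insE => /(cancel_post (assocK _ _ _)) /(cancel_pre (lunitK _)).
exact: tensI1_inj.
Qed.

(** * Dual pairs, transposes and traces *)

Section Mates.
Variables (P Q S : A).

(** The composite that bends [P] into [S]: for a duality it is one side of a triangle identity, and
    with a morphism inserted it is a transpose. *)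
Definition mate (e : hom (P ⊗ Q) 𝟏) (n : hom 𝟏 (Q ⊗ S)) : hom P S :=
  lunit S ∘ (e ⊠ idm S) ∘ assocV P Q S ∘ (idm P ⊠ n) ∘ runitV P.

Definition mater (n : hom 𝟏 (P ⊗ Q)) (e : hom (Q ⊗ S) 𝟏) : hom S P :=
  runit P ∘ (idm P ⊠ e) ∘ assoc P Q S ∘ (n ⊠ idm S) ∘ lunitV S.

Lemma cup_cap n e Z : (idm P ⊠ cap e Z) ∘ cup n (S ⊗ Z) = mater n e ⊠ idm Z.
Proof.
rewrite /mater !cupE !capE !insE !delE !tens1M !tensM1.
crw (pentagonV _ _ _ _).
rewrite -(tensm1 S Z); crw (assocV_nat _ _ _).
rewrite -assoc_lunitV; crw (assocK _ _ _).
by crw (esym (assoc_nat _ _ _)); crw (tens_triangle _ _).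
Qed.

Lemma cap_cup e n Z : cap e (S ⊗ Z) ∘ (idm P ⊠ cup n Z) = mate e n ⊠ idm Z.
Proof.
rewrite /mate !cupE !capE !insE !delE !tens1M !tensM1.
crw (pentagonV' _ _ _ _).
rewrite -(tensm1 S Z); crw (assocV_nat _ _ _).
crw (assocV_lunitV _ _).
by crw (esym (assoc_nat _ _ _)); crw (lunit_tens _ _).
Qed.
End Mates.

(** Duality is a property of explicit maps here, since words get duals assembled by hand besides
    those chosen by a rigid category. *)
Record dual_pair P P' (e : hom (P' ⊗ P) 𝟏) (n : hom 𝟏 (P ⊗ P')) : Prop := DualPair {
  zigzag : mater n e = idm P;
  zagzig : mate e n = idm P' }.

Section DualPairs.
Variables (P P' : A) (e : hom (P' ⊗ P) 𝟏) (n : hom 𝟏 (P ⊗ P')).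
Hypothesis d : dual_pair e n.

Lemma zigzagE Z : (idm P ⊠ cap e Z) ∘ cup n (P ⊗ Z) = idm _.
Proof. by rewrite cup_cap (zigzag d) tensm1. Qed.

Lemma zagzigE Z : cap e (P' ⊗ Z) ∘ (idm P' ⊠ cup n Z) = idm _.
Proof. by rewrite cap_cup (zagzig d) tensm1. Qed.
End DualPairs.

Lemma dual_pairI P P' (e : hom (P' ⊗ P) 𝟏) (n : hom 𝟏 (P ⊗ P')) :
  (idm P ⊠ cap e 𝟏) ∘ cup n (P ⊗ 𝟏) = idm _ ->
  cap e (P' ⊗ 𝟏) ∘ (idm P' ⊠ cup n 𝟏) = idm _ -> dual_pair e n.
Proof.
by rewrite cup_cap cap_cup -!tensm1 => /tensI1_inj ? /tensI1_inj.
Qed.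

Lemma dual_pair_unit : @dual_pair 𝟏 𝟏 (lunit 𝟏) (lunitV 𝟏).
Proof.
split; rewrite /mater /mate.
  crw (tens_triangle _ _); rewrite -lunit_unit.
  by crw (tensK1 _ (lunitVK _)); rewrite lunitVK.
crw (assocV_lunitV _ _); rewrite -lunitV_unit.
by crw (tensK1 _ (lunitVK _)); rewrite lunitVK.
Qed.

Lemma cap_symm P P' (e : hom (P' ⊗ P) 𝟏) Z : cap (e ∘ symm P P') Z = cap e Z ∘ sw P P' Z.
Proof. by rewrite !capE !delE tensM1 swE; crw (assocK _ _ _). Qed.

Lemma cup_symm P P' (n : hom 𝟏 (P ⊗ P')) Z : cup (symm P P' ∘ n) Z = sw P P' Z ∘ cup n Z.
Proof. by rewrite !cupE !insE tensM1 swE; crw (assocK _ _ _). Qed.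

(** The symmetries cancel after the braid relation, leaving the other triangle identity of the given
    pair. *)
Lemma dual_pair_symm P P' (e : hom (P' ⊗ P) 𝟏) (n : hom 𝟏 (P ⊗ P')) :
  dual_pair e n -> dual_pair (e ∘ symm P P') (symm P P' ∘ n).
Proof.
move=> d; apply: dual_pairI; rewrite cap_symm cup_symm tens1M.
  rewrite -(sw_cup n P'); crw (sw_braid _ _ _ _).
  by crw (swK _ _ _); crw (sw_cap _ _ _); rewrite zagzigE.
rewrite -(sw_cap e P); crw (sw_braid _ _ _ _).
by crw (swK _ _ _); crw (sw_cup _ _ _); rewrite zigzagE.
Qed.

Section DualTensor.
Variables (P P' Q Q' : A) (e : hom (P' ⊗ P) 𝟏) (n : hom 𝟏 (P ⊗ P')).
Variables (e' : hom (Q' ⊗ Q) 𝟏) (n' : hom 𝟏 (Q ⊗ Q')).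

(** Nested contraction, the inner pair first; hence the reversed order [Q' ⊗ P'] in the dual. *)
Definition ev_tens : hom ((Q' ⊗ P') ⊗ (P ⊗ Q)) 𝟏 :=
  e' ∘ (idm Q' ⊠ cap e Q) ∘ assoc Q' P' (P ⊗ Q).
Definition coev_tens : hom 𝟏 ((P ⊗ Q) ⊗ (Q' ⊗ P')) :=
  assocV P Q (Q' ⊗ P') ∘ (idm P ⊠ cup n' P') ∘ n.

Lemma cap_ev_tens Z : cap ev_tens Z =
  cap e' Z ∘ (idm Q' ⊠ cap e (Q ⊗ Z)) ∘ (idm Q' ⊠ (idm P' ⊠ assoc P Q Z))
    ∘ assoc Q' P' (P ⊗ Q ⊗ Z).
Proof.
crw (esym (tens1M _ _ _)).
have -> : cap e (Q ⊗ Z) ∘ (idm P' ⊠ assoc P Q Z) =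
    (cap e Q ⊠ idm Z) ∘ assocV P' (P ⊗ Q) Z.
  by rewrite cap_tens; crw (assocVK _ _ _).
rewrite tens1M !(capE ev_tens) (capE e') !delE /ev_tens !tensM1.
crw (assocV_nat _ _ _).
crw (pentagonV _ _ _ _).
by crw (assocK _ _ _).
Qed.

Lemma cup_coev_tens Z : cup coev_tens Z =
  assocV P Q (Q' ⊗ P' ⊗ Z) ∘ (idm P ⊠ (idm Q ⊠ assocV Q' P' Z))
    ∘ (idm P ⊠ cup n' (P' ⊗ Z)) ∘ cup n Z.
Proof.
crw (esym (tens1M _ _ _)); rewrite -cup_tens tens1M.
apply: (cancel_post (assocK P Q (Q' ⊗ P' ⊗ Z))).
crw (assocVK _ _ _).
rewrite !(cupE coev_tens) (cupE n) !insE /coev_tens !tensM1.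
crw (tens_pentagon _ _ _ _); crw (tensK1 _ (assocVK _ _ _)).
by crw (assoc_nat _ _ _).
Qed.

Hypotheses (d : dual_pair e n) (d' : dual_pair e' n').

Lemma dual_pair_tens : dual_pair ev_tens coev_tens.
Proof.
apply: dual_pairI; rewrite cap_ev_tens cup_coev_tens.
  rewrite -(tensm1 P Q); crw (esym (assocV_nat _ _ _)).
  crw (esym (tens1M P _ _)); crw (esym (tens1M P _ _)).
  crw (esym (tens1M Q _ _)); crw (assocVK _ _ _).
  rewrite -(compA (cap e' 𝟏)) -tens1M.
  rewrite (tens1M Q (cap e' 𝟏)).
  crw (esym (cup_nat n' _)); crw (zigzagE d' _).
  rewrite !tens1M; crw (esym (cup_nat n _)); crw (zigzagE d _).
  by rewrite assocK.
rewrite -(tensm1 Q' P'); crw (assoc_nat _ _ _).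
rewrite -!(compA (cap e' _)) -!tens1M.
crw (esym (tens1M P' _ _)); crw (assocVK _ _ _).
rewrite -(tens1M P); crw (tens1M P' _ _).
crw (esym (cap_nat e _)); crw (zagzigE d _).
rewrite tens1M; crw (esym (cap_nat e' _)); crw (zagzigE d' _).
by rewrite assocK.
Qed.
End DualTensor.

Section Transpose.
Variables (P P' Q Q' : A) (e : hom (P' ⊗ P) 𝟏) (n : hom 𝟏 (P ⊗ P')).
Variables (e' : hom (Q' ⊗ Q) 𝟏) (n' : hom 𝟏 (Q ⊗ Q')).
Hypotheses (d : dual_pair e n) (d' : dual_pair e' n').

Definition transp (f : hom P Q) : hom Q' P' := mate e' ((f ⊠ idm P') ∘ n).

Lemma ev_transp (f : hom P Q) : e ∘ (transp f ⊠ idm P) = e' ∘ (idm Q' ⊠ f).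
Proof.
apply: cap_inj; rewrite !cap_tensr tensm1 -cap_cup.
crw (cap_nat e' _); crw (esym (tens1M Q' _ _)).
rewrite cup_tensl tensm1; crw (tens_swap _ _).
by crw (zigzagE d _).
Qed.

Lemma transp_coev (f : hom P Q) : (idm Q ⊠ transp f) ∘ n' = (f ⊠ idm P') ∘ n.
Proof.
apply: cup_inj; rewrite !cup_tensl -cap_cup.
rewrite cup_tensl !tens1M; crw (esym (cup_nat n' _)); crw (esym (cup_nat n' _)).
by crw (zigzagE d' _); rewrite tensm1.
Qed.

(** [f] slides around the loop as its transpose. Taken with inverse isomorphisms, this makes the
    Euler characteristic invariant under isomorphism. *)
Lemma trace_cyclic (f : hom P Q) (g : hom Q P) :
  e ∘ symm P P' ∘ ((g ∘ f) ⊠ idm P') ∘ n = e' ∘ symm Q Q' ∘ ((f ∘ g) ⊠ idm Q') ∘ n'.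
Proof.
rewrite !tensM1; crw (esym (transp_coev _)); crw (esym (tens_swap _ _)).
by crw (symm_nat _ _); rewrite ev_transp; crw (esym (symm_nat _ _)).
Qed.
End Transpose.

Lemma transp_unique P P' Q (e : hom (P' ⊗ P) 𝟏) (n : hom 𝟏 (P ⊗ P')) (f g : hom Q P') :
  dual_pair e n -> e ∘ (f ⊠ idm P) = e ∘ (g ⊠ idm P) -> f = g.
Proof.
move=> d E; have aux h : mate (e ∘ (h ⊠ idm P)) n = h.
  apply: tensI1_inj; rewrite -cap_cup cap_tensr tensm1.
  by crw (esym (tens_swap h (cup n _))); crw (zagzigE d _).
by rewrite -(aux _ f) E aux.
Qed.

Section TransposeFunctor.
Variables (P P' Q Q' R R' : A) (e : hom (P' ⊗ P) 𝟏) (n : hom 𝟏 (P ⊗ P')).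
Variables (e' : hom (Q' ⊗ Q) 𝟏) (n' : hom 𝟏 (Q ⊗ Q')).
Variable e'' : hom (R' ⊗ R) 𝟏.
Hypotheses (d : dual_pair e n) (d' : dual_pair e' n').

Lemma transp1 : transp n e (idm P) = idm P'.
Proof.
by apply: (transp_unique d); rewrite (ev_transp _ d).
Qed.

Lemma transpM (g : hom Q R) (f : hom P Q) :
  transp n e'' (g ∘ f) = transp n e' f ∘ transp n' e'' g.
Proof.
apply: (transp_unique d); rewrite (ev_transp _ d) tensM1.
crw (ev_transp _ d _); crw (tens_swap _ _).
by rewrite (ev_transp _ d') -compA -tens1M.
Qed.

Lemma transp_sum (I : finType) (D : pred I) (f : I -> hom P Q) :
  transp n e' (\sum_(i | D i) f i) = \sum_(i | D i) transp n e' (f i).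
Proof.
by rewrite /transp /mate tens_suml comp_suml tens_sumr comp_sumr comp_suml.
Qed.
End TransposeFunctor.
End Monoidal.

Section Scalars.
Variables (K : comPzRingType) (A : linear_tensor_category K).

Lemma scalm_unit r : scalm r (idm (𝟏 : A)) = lt_alg A r.
Proof.
by rewrite /scalm lunit_unit runit_nat -lunit_unit; crw (lunitVK _).
Qed.

Lemma scalm_compl (X Y Z : A) r (g : hom Y Z) (f : hom X Y) :
  scalm r g ∘ f = scalm r (g ∘ f).
Proof. by rewrite scalm_idE -compA -scalm_idE. Qed.

Lemma scalm_compr (X Y Z : A) r (g : hom Y Z) (f : hom X Y) :
  g ∘ scalm r f = scalm r (g ∘ f).
Proof.
by rewrite /scalm; crw (esym (lunit_nat _)); crw (esym (tensmM _ _ _ _)).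
Qed.

Lemma scalm_tensl (X X' Y Y' : A) r (f : hom X X') (g : hom Y Y') :
  scalm r f ⊠ g = scalm r (f ⊠ g).
Proof.
rewrite /scalm -[g in LHS]comp1m -[g in LHS]compm1 compA !tensmM.
rewrite -lunit_tens -assoc_lunitV; crw (assoc_nat _ _ _); by [].
Qed.

Lemma scalm_tensr (X X' Y Y' : A) r (f : hom X X') (g : hom Y Y') :
  f ⊠ scalm r g = scalm r (f ⊠ g).
Proof.
apply: (cancel_post (symmK _ _)); rewrite symm_nat scalm_tensl.
by rewrite scalm_compl scalm_compr symm_nat.
Qed.

Lemma scalm0 (X Y : A) r : scalm r (0 : hom X Y) = 0.
Proof. by rewrite /scalm tensm0 compm0 comp0m. Qed.

Lemma scal0m (X Y : A) (f : hom X Y) : scalm 0 f = 0.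
Proof. exact: (@scale0r K (lhom X Y) f). Qed.
End Scalars.

(** * Diagrammatic morphisms *)

Section Words.
Variables (K : comPzRingType) (A : linear_tensor_category K).
Variables (X X' : A) (ev : hom (X' ⊗ X) 𝟏) (coev : hom 𝟏 (X ⊗ X')).

Definition letter (b : bool) : A := if b then X else X'.

Fixpoint word (l : seq bool) : A := if l is b :: l' then letter b ⊗ word l' else 𝟏.

Local Notation lsw b c l := (sw (letter b) (letter c) (word l)).
Local Notation lcup l := (cup coev (word l) : hom (word l) (word (true :: false :: l))).
Local Notation lcap l := (cap ev (word l) : hom (word (false :: true :: l)) (word l)).

(* Morphisms given by a permutation of the letters: the last two constructors
   are the two double cosets of the stabilizer of the first letter. *)
Inductive permuting : forall l l', hom (word l) (word l') -> Prop :=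
| permuting_nil : @permuting [::] [::] (idm 𝟏)
| permuting_cons b l l' a : @permuting l l' a ->
    @permuting (b :: l) (b :: l') (idm (letter b) ⊠ a)
| permuting_sw b c l m l' x y : @permuting l (c :: m) x -> @permuting (b :: m) l' y ->
    @permuting (b :: l) (c :: l')
      ((idm (letter c) ⊠ y) ∘ lsw b c m ∘ (idm (letter b) ⊠ x)).

(** A cast that reduces to [idm] once the proof is [erefl]; proofs of equality in [bool] are
    unique. *)
Definition eq_letter b c (e : b = c) : hom (letter b) (letter c) :=
  match e with erefl => idm (letter b) end.

Lemma permuting_inv l l' q : @permuting l l' q ->
  match l, l' return hom (word l) (word l') -> Prop with
  | [::], [::] => fun q => q = idm 𝟏
  | b :: l, c :: l' => fun q =>
      (exists (e : b = c) a, @permuting l l' a /\ q = eq_letter e ⊠ a) \/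
      (exists m x y, [/\ @permuting l (c :: m) x, @permuting (b :: m) l' y &
         q = (idm (letter c) ⊠ y) ∘ lsw b c m ∘ (idm (letter b) ⊠ x)])
  | _, _ => fun _ => False
  end q.
Proof.
move=> pq; case: l l' q / pq => [|b l l' a pa|b c l m l' x y px py] //; first by left; exists erefl, a.
by right; exists m, x, y.
Qed.

Lemma permuting_size l l' q : @permuting l l' q -> size l = size l'.
Proof. by elim=> //= [? ? ? ? _ ->|? ? ? ? ? ? ? _ -> _ [->]]. Qed.

Lemma permuting_id l : permuting (idm (word l)).
Proof.
by elim: l => [|b l IH]; [constructor | rewrite -[idm _]tensm1; constructor].
Qed.

Lemma permuting_lsw b c l : @permuting (b :: c :: l) (c :: b :: l) (lsw b c l).
Proof.
have := permuting_sw (permuting_id (c :: l)) (permuting_id (b :: l)).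
by rewrite !tensm1 compm1 comp1m.
Qed.

(** Induction on the length. When both factors swap first letters, the composite in the middle acts
    on a shorter word and is inverted in turn: if it fixes its first letter the two swaps cancel,
    otherwise the braid relation reorders three swaps. *)
Lemma permuting_comp l l' l'' q q' :
  @permuting l l' q -> @permuting l' l'' q' -> permuting (q' ∘ q).
Proof.
have [n] := ubnP (size l); elim: n l l' l'' q q' => // n IH [|b l] [|c l'] [|d l''] q q' /=;
  rewrite ?ltnS => ln pq pq'; have := permuting_inv pq; have := permuting_inv pq';
  rewrite //=.
  by move=> -> ->; rewrite comp1m; constructor.
have comp2 k k' k'' f g : (size k <= size l)%N ->
    @permuting k k' f -> @permuting k' k'' g -> permuting (g ∘ f).
  by move=> lk; apply: IH; apply: leq_ltn_trans lk ln.
case=> [[e' [a' [pa' ->]]]|[m' [x' [y' [px' py' ->]]]]];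
  case=> [[e [a [pa ->]]]|[m [x [y [px py ->]]]]].
- subst c d; rewrite -tensmM compm1; constructor; exact: comp2 pa pa'.
- subst d; rewrite /=; crw (esym (tens1M _ a' y)); constructor => //.
  by apply: comp2 py pa'; rewrite (permuting_size px).
- subst c; rewrite /=; crw (esym (tens1M _ x' a)); constructor => //; exact: comp2 pa px'.
have lm : (size (b :: m) <= size l)%N by rewrite (permuting_size px).
crw (esym (tens1M _ x' y)); have := permuting_inv (comp2 _ _ _ _ _ lm py px').
case=> [[e [a [pa Ea]]]|[p [u [v [pu pv Ev]]]]].
  subst d; rewrite Ea /=; crw (sw_nat _ _ _); crw (swK _ _ _).
  crw (esym (tens1M _ _ _)); crw (esym (tens1M _ _ _)).
  rewrite -compA; constructor.
  apply: (comp2 _ _ _ _ _ _ _ py') => //.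
  by apply: (comp2 _ _ _ _ _ _ px) => //; constructor.
rewrite Ev !tens1M; crw (sw_nat _ _ _).
crw (esym (sw_nat (idm (letter b)) (idm (letter c)) u)); crw (esym (sw_braid _ _ _ (word p))).
do 2![crw (esym (tens1M (letter b) _ _))]; do 2![crw (esym (tens1M (letter d) _ _))].
have -> : sw (letter b) (letter d) (letter c ⊗ word p) = lsw b d (c :: p) by [].
apply: (@permuting_sw b d l (c :: p) l'').
  rewrite -compA; apply: (comp2 _ _ _ _ _ _ _ (permuting_lsw c d p)) => //.
  by apply: (comp2 _ _ _ _ _ _ px) => //; constructor.
have lp : (size (b :: c :: p) <= size l)%N.
  by rewrite (permuting_size px) /= (permuting_size pu).
rewrite -compA; apply: (comp2 _ _ _ _ _ _ _ py') => //.
by apply: (comp2 _ _ _ _ _ _ (permuting_lsw b c p)) => //; constructor.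
Qed.

(* The linear span of the products of coevaluations with permuted letters. *)
Inductive spanned : forall l, hom 𝟏 (word l) -> Prop :=
| spanned_nil : @spanned [::] (idm 𝟏)
| spanned_cup l l' v q : @spanned l v -> @permuting (true :: false :: l) l' q ->
    @spanned l' (q ∘ lcup l ∘ v)
| spanned_zero l : @spanned l 0
| spanned_add l v w : @spanned l v -> @spanned l w -> @spanned l (v + w)
| spanned_scal r l v : @spanned l v -> @spanned l (scalm r v).

Lemma spanned_permuting l l' v q : @spanned l v -> @permuting l l' q -> spanned (q ∘ v).
Proof.
move=> sv; elim: l v / sv l' q => [|l l' v q sv IH pq|l|l v w _ IHv _ IHw|r l v _ IH] l'' q' pq'.
- case: l'' q' pq' => [|c l''] q' /permuting_inv //= ->.
  by rewrite comp1m; constructor.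
- by rewrite !compA; apply: spanned_cup => //; apply: permuting_comp pq'.
- by rewrite compm0; apply: spanned_zero.
- by rewrite compDr; apply: spanned_add; [apply: IHv | apply: IHw].
- by rewrite scalm_compr; apply: spanned_scal; apply: IH.
Qed.

(** * Contraction of spanned tensors *)

Variable z : K.
Hypothesis d : dual_pair ev coev.
Hypothesis dim_z : ev ∘ symm X X' ∘ coev = lt_alg A z.

Lemma loop Z : cap ev Z ∘ sw X X' Z ∘ cup coev Z = scalm z (idm Z).
Proof.
rewrite capE cupE delE insE swE /scalm -dim_z; crw (assocK _ _ _); crw (assocK _ _ _).
by rewrite !tensM1 !compA.
Qed.

Lemma cap_swap_cup Z : cap ev (X' ⊗ Z) ∘ sw X X' (X' ⊗ Z) ∘ (idm X ⊠ sw X' X' Z) ∘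
  cup coev (X' ⊗ Z) = idm _.
Proof.
rewrite -(sw_cup coev X' Z); crw (tens1K _ (swK _ _ _)); crw (swK _ _ _).
exact: zagzigE.
Qed.

Lemma swap_cup Z : (idm X ⊠ sw X' X' Z) ∘ cup coev (X' ⊗ Z) =
  sw X' X (X' ⊗ Z) ∘ (idm X' ⊠ cup coev Z).
Proof. by rewrite -(sw_cup coev X' Z); crw (tens1K _ (swK _ _ _)). Qed.

Lemma cap_swap Q Z : cap ev (Q ⊗ Z) ∘ (idm X' ⊠ sw Q X Z) =
  (idm Q ⊠ cap ev Z) ∘ sw X' Q (X ⊗ Z).
Proof. by rewrite -(sw_cap ev Q Z); crw (tens1K _ (swK _ _ _)). Qed.

(** The evaluation and the coevaluation meet disjoint pairs of letters, so they commute; this is the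
    sliding case of the contraction. *)
Lemma cap_cup_swap Z : (idm X ⊠ (cap ev (X' ⊗ Z) ∘ (idm X' ⊠ sw X' X Z))) ∘
  sw X' X (X' ⊗ (X ⊗ Z)) ∘ (idm X' ⊠ cup coev (X ⊗ Z)) = cup coev Z ∘ cap ev Z.
Proof.
rewrite cap_swap tens1M -compA -swap_cup; crw (tens1K _ (swK _ _ _)).
by rewrite cup_nat.
Qed.

(* A contraction meets the last coevaluation in one of four ways, according to
   the double cosets of the permutation between them: the two form a loop, they
   cancel by a zigzag identity (in two ways), or the contraction slides past the
   coevaluation, and one concludes by induction. *)
Lemma spanned_lcap l k v q : @spanned l v -> @permuting l (false :: true :: k) q ->
  spanned (lcap k ∘ q ∘ v).
Proof.
move=> sv; elim: l v / sv k q => [|l l' v q0 sv IH pq0|l|l v w _ IHv _ IHw|r l v _ IH] k q pq.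
- by have := permuting_inv pq.
- have pQ := permuting_comp pq0 pq.
  rewrite !compA -(compA _ q) -(compA _ (q ∘ q0)) compA.
  case: (permuting_inv pQ) => [[e _]|[m [b [a [pb pa ->]]]]]; first by [].
  (* Here [b] fixes its first letter when the [X'] of the coevaluation is the one contracted, and
     [a] when its [X] is. *)
  case: (permuting_inv pb) => [[e [b' [pb' ->]]]|[mb [b2 [b1 [pb2 pb1 ->]]]]];
    case: (permuting_inv pa) => [[e' [a' [pa' ->]]]|[ma [a2 [a1 [pa2 pa1 ->]]]]];
    rewrite ?(eq_irrelevance e erefl) ?(eq_irrelevance e' erefl) /= ?tens1M.
  + crw (esym (cap_nat ev a')); crw (esym (cup_nat coev b')).
    rewrite -(compA a') -(compA a') loop scalm_compr compm1 !scalm_compl; apply: spanned_scal.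
    by rewrite -compA; apply: spanned_permuting pa'; apply: spanned_permuting pb'.
  + crw (esym (cap_nat ev a1)); rewrite -(compA a1) cap_swap.
    crw (esym (sw_nat (idm X) (idm X') a2)); crw (swK _ _ _).
    crw (esym (cup_nat coev b')); crw (esym (cup_nat coev a2)); crw (zigzagE d _).
    rewrite -!compA; apply: spanned_permuting pa1; apply: spanned_permuting pa2.
    exact: spanned_permuting pb'.
  + crw (esym (cap_nat ev a')); crw (sw_nat (idm X) (idm X') b1).
    crw (esym (cap_nat ev b1)); crw (esym (cup_nat coev b2)).
    rewrite -3!(compA (a' ∘ b1)) (cap_swap_cup (word mb)) compm1.
    rewrite -!compA; apply: spanned_permuting pa'; apply: spanned_permuting pb1.
    exact: spanned_permuting pb2.
  + crw (esym (cap_nat ev a1)); rewrite -(compA a1) cap_swap.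
    crw (esym (sw_nat (idm X) (idm X') a2)); crw (swK _ _ _).
    crw (esym (cup_nat coev b2)); rewrite -(compA _ _ (cup coev _)) swap_cup.
    crw (esym (tens1M X (idm X' ⊠ a2) (idm X' ⊠ b1))); rewrite -(tens1M X' a2 b1).
    (* [a2 ∘ b1] leads from a word starting with [X'] to one starting with [X], so it cannot fix the
       first letter. *)
    case: (permuting_inv (permuting_comp pb1 pa2)) => [[e2 _]|[p [u [w [pu pw ->]]]]] //.
    rewrite /= !tens1M.
    crw (esym (tens1M X (cap ev (word ma)) _)); rewrite -(cap_nat ev w) tens1M.
    crw (esym (sw_nat (idm X') (idm X) (idm X' ⊠ u))).
    crw (esym (tens1M X' (idm X ⊠ (idm X' ⊠ u)) (cup coev (word mb)))).
    rewrite -(cup_nat coev u) tens1M.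
    crw (esym (tens1M X (cap ev _) _)).
    have -> : a1 ∘ (idm X ⊠ w) ∘ (idm X ⊠ (lcap (false :: p) ∘ (idm X' ⊠ lsw false true p)))
      ∘ sw X' X (word (false :: true :: p)) ∘ (idm X' ⊠ cup coev (word (true :: p)))
      ∘ (idm X' ⊠ u) ∘ b2 ∘ v
      = (a1 ∘ (idm X ⊠ w)) ∘ lcup p ∘ (lcap p ∘ ((idm X' ⊠ u) ∘ b2) ∘ v).
      by rewrite -2!(compA (a1 ∘ _)) cap_cup_swap !compA.
    apply: spanned_cup.
      apply: IH; apply: permuting_comp pb2 _; exact: (permuting_cons false pu).
    apply: permuting_comp pa1; exact: (permuting_cons true pw).
- by rewrite compm0; apply: spanned_zero.
- by rewrite compDr; apply: spanned_add; [apply: IHv | apply: IHw].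
- by rewrite scalm_compr; apply: spanned_scal; apply: IH.
Qed.

Lemma spanned_lcup l v : @spanned l v -> spanned (lcup l ∘ v).
Proof.
move=> sv; have := spanned_cup sv (permuting_id (true :: false :: l)).
by rewrite comp1m.
Qed.

(* Operators that preserve spanned tensors when applied at any position; the
   letters in front are listed in reverse order. *)
Fixpoint under (p : seq bool) : forall l l', hom (word l) (word l') ->
    hom (word (catrev p l)) (word (catrev p l')) :=
  match p with
  | [::] => fun l l' g => g
  | b :: p' => fun l l' g => @under p' (b :: l) (b :: l') (idm (letter b) ⊠ g)
  end.

(** Quantifying over the letters [p] in front makes stability survive tensoring with letters on the
    left. *)
Definition stable l l' (g : hom (word l) (word l')) : Prop :=
  forall p v, @spanned (catrev p l) v -> spanned (under p g ∘ v).

Lemma underM p l l' l'' (g : hom (word l') (word l'')) (f : hom (word l) (word l')) :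
  under p (g ∘ f) = under p g ∘ under p f.
Proof. by elim: p l l' l'' g f => //= b p IH l l' l'' g f; rewrite tens1M; exact: (IH (b :: l) (b :: l') (b :: l'')). Qed.

Lemma underD p l l' (g f : hom (word l) (word l')) :
  under p (g + f) = under p g + under p f.
Proof. by elim: p l l' g f => //= b p IH l l' g f; rewrite tensmDr; exact: (IH (b :: l) (b :: l')). Qed.

Lemma underZ p l l' r (f : hom (word l) (word l')) :
  under p (scalm r f) = scalm r (under p f).
Proof. by elim: p l l' f => //= b p IH l l' f; rewrite scalm_tensr; exact: (IH (b :: l) (b :: l')). Qed.

Lemma under1 p l : under p (idm (word l)) = idm (word (catrev p l)).
Proof. by elim: p l => //= b p IH l; rewrite tensm1; exact: (IH (b :: l)). Qed.

Lemma permuting_under p l l' f : @permuting l l' f -> permuting (under p f).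
Proof. by elim: p l l' f => //= b p IH l l' f pf; apply/IH/permuting_cons. Qed.

Lemma stable1 l : stable (idm (word l)).
Proof. by move=> p v; rewrite under1 comp1m. Qed.

Lemma stableM l l' l'' (g : hom (word l') (word l'')) (f : hom (word l) (word l')) :
  stable g -> stable f -> stable (g ∘ f).
Proof. by move=> sg sf p v /sf /sg; rewrite compA -underM. Qed.

Lemma stable0 l l' : @stable l l' 0.
Proof.
move=> p v _; suff -> : under p (0 : hom (word l) (word l')) = 0.
  by rewrite comp0m; apply: spanned_zero.
by clear v; elim: p l l' => //= b p IH l l'; rewrite tensm0; exact: (IH (b :: l) (b :: l')).
Qed.

Lemma stableD l l' (g f : hom (word l) (word l')) :
  stable g -> stable f -> stable (g + f).
Proof. by move=> sg sf p v sv; rewrite underD compDl; apply: spanned_add; auto. Qed.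

Lemma stableZ l l' r (f : hom (word l) (word l')) : stable f -> stable (scalm r f).
Proof. by move=> sf p v sv; rewrite underZ scalm_compl; apply: spanned_scal; auto. Qed.

Lemma stable_cons b l l' (f : hom (word l) (word l')) :
  stable f -> @stable (b :: l) (b :: l') (idm (letter b) ⊠ f).
Proof. by move=> sf p; apply: (sf (b :: p)). Qed.

Lemma stable_permuting l l' f : @permuting l l' f -> stable f.
Proof. by move=> pf p v sv; apply/spanned_permuting/permuting_under/pf. Qed.

Lemma stable_lcup l : @stable l (true :: false :: l) (lcup l).
Proof.
(* Creating the pair behind the letters [p] amounts to creating it at the front and then permuting
   it into place. *)
move=> p v; suff [q [pq ->]] : exists q,
    @permuting (true :: false :: catrev p l) (catrev p (true :: false :: l)) q /\
    @under p l (true :: false :: l) (lcup l) = q ∘ lcup (catrev p l).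
  by rewrite -compA => /spanned_lcup sv; apply: spanned_permuting pq.
elim: p l {v} => [|b p IH] l /=.
  by exists (idm _); rewrite comp1m; split=> //; apply: permuting_id.
have [q [pq Eq]] := IH (b :: l).
have -> : idm (letter b) ⊠ lcup l =
    (lsw true b (false :: l) ∘ (idm X ⊠ lsw false b l)) ∘ lcup (b :: l).
  rewrite /= -(sw_cup coev (letter b)); crw (tens1K _ (swK _ _ _)).
  by crw (swK _ _ _).
rewrite (underM p (l' := true :: false :: b :: l)) Eq compA.
eexists; split; last by [].
apply: permuting_comp pq _; apply: permuting_under.
apply: (permuting_comp (l' := true :: b :: false :: l)); last exact: permuting_lsw.
by apply: (permuting_cons true); apply: permuting_lsw.
Qed.

Lemma stable_lcap l : @stable (false :: true :: l) l (lcap l).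
Proof.
(* Dually, the pair is first permuted to the front, where [spanned_lcap] applies. *)
move=> p v; suff [q [pq ->]] : exists q,
    @permuting (catrev p (false :: true :: l)) (false :: true :: catrev p l) q /\
    @under p (false :: true :: l) l (lcap l) = lcap (catrev p l) ∘ q.
  by move=> sv; apply: spanned_lcap.
elim: p l {v} => [|b p IH] l /=.
  by exists (idm _); rewrite compm1; split=> //; apply: permuting_id.
have [q [pq Eq]] := IH (b :: l).
have -> : idm (letter b) ⊠ lcap l = lcap (b :: l) ∘
    ((idm X' ⊠ lsw b true l) ∘ lsw b false (true :: l)).
  rewrite /= -(sw_cap ev (letter b)); crw (tens1K _ (swK _ _ _)).
  by crw (swK _ _ _).
rewrite (underM p (l' := false :: true :: b :: l)) Eq -compA.
eexists; split; last by [].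
apply: permuting_comp _ pq; apply: permuting_under.
apply: (permuting_comp (l' := false :: b :: true :: l)); first exact: permuting_lsw.
by apply: (permuting_cons false); apply: permuting_lsw.
Qed.

(** * Diagrammatic morphisms between parenthesized words *)

Inductive tree := Unit | Leaf of bool | Node of tree & tree.

Fixpoint tval e : A :=
  match e with Unit => 𝟏 | Leaf b => letter b | Node e1 e2 => tval e1 ⊗ tval e2 end.

Fixpoint flat e (u : seq bool) : seq bool :=
  match e with Unit => u | Leaf b => b :: u | Node e1 e2 => flat e1 (flat e2 u) end.

(** The accumulator [u] absorbs the letters on the right, so that concatenation of words and its
    associators never appear. *)
Fixpoint flatten e u : hom (tval e ⊗ word u) (word (flat e u)) :=
  match e with
  | Unit => lunit (word u)
  | Leaf b => idm (letter b ⊗ word u)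
  | Node e1 e2 => flatten e1 (flat e2 u) ∘ (idm (tval e1) ⊠ flatten e2 u)
      ∘ assoc (tval e1) (tval e2) (word u)
  end.

(** A semantic condition in place of an inductive family of diagrams: closure under composition and
    sums is direct, and evaluating it on one coevaluation already yields scalars. The context [u]
    lets the left factor of a tensor product act beside the right one. *)
Definition diagrammatic e e' (f : hom (tval e) (tval e')) : Prop :=
  forall u, exists g, stable g /\ flatten e' u ∘ (f ⊠ idm (word u)) = g ∘ flatten e u.

Lemma stable_flatten e l l' (g : hom (word l) (word l')) : stable g ->
  exists g', stable g' /\ flatten e l' ∘ (idm (tval e) ⊠ g) = g' ∘ flatten e l.
Proof.
elim: e l l' g => [|b|e1 IH1 e2 IH2] l l' g sg /=.
- by exists g; rewrite lunit_nat.
- exists (idm (letter b) ⊠ g); rewrite comp1m compm1; split=> //.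
  exact: stable_cons.
- have [g2 [sg2 E2]] := IH2 _ _ _ sg; have [g1 [sg1 E1]] := IH1 _ _ _ sg2.
  exists g1; split=> //; rewrite -(tensm1 (tval e1)); crw (assoc_nat _ _ _).
  crw (esym (tens1M (tval e1) (flatten e2 l') _)); rewrite E2 tens1M.
  by crw E1.
Qed.

Lemma diagrammatic1 e : diagrammatic (idm (tval e)).
Proof. by move=> u; exists (idm _); rewrite tensm1 comp1m compm1; split=> //; apply: stable1. Qed.

Lemma diagrammaticM e e' e'' (g : hom (tval e') (tval e'')) (f : hom (tval e) (tval e')) :
  diagrammatic g -> diagrammatic f -> diagrammatic (g ∘ f).
Proof.
move=> mg mf u; have [a [sa Ea]] := mg u; have [b [sb Eb]] := mf u.
exists (a ∘ b); split; first exact: stableM.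
by rewrite tensM1; crw Ea; rewrite -compA Eb compA.
Qed.

Lemma diagrammatic0 e e' : @diagrammatic e e' 0.
Proof. by move=> u; exists 0; rewrite tens0m compm0 comp0m; split=> //; apply: stable0. Qed.

Lemma diagrammaticD e e' (f g : hom (tval e) (tval e')) :
  diagrammatic f -> diagrammatic g -> diagrammatic (f + g).
Proof.
move=> mf mg u; have [a [sa Ea]] := mf u; have [b [sb Eb]] := mg u.
exists (a + b); split; first exact: stableD.
by rewrite tensmDl compDr compDl Ea Eb.
Qed.

Lemma diagrammaticZ e e' r (f : hom (tval e) (tval e')) :
  diagrammatic f -> diagrammatic (scalm r f).
Proof.
move=> mf u; have [a [sa Ea]] := mf u; exists (scalm r a); split; first exact: stableZ.
by rewrite scalm_tensl scalm_compr Ea scalm_compl.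
Qed.

Lemma diagrammaticN e e' (f : hom (tval e) (tval e')) :
  diagrammatic f -> diagrammatic (- f).
Proof.
move=> /(@diagrammaticZ _ _ (-1)); rewrite -[scalm _ _]/((-1) *: (f : lhom _ _)).
by rewrite scaleN1r.
Qed.

Lemma diagrammatic_sum (I : finType) (D : pred I) e e' (f : I -> hom (tval e) (tval e')) :
  (forall i, D i -> diagrammatic (f i)) -> diagrammatic (\sum_(i | D i) f i).
Proof.
by move=> mf; apply: big_ind => //; [apply: diagrammatic0 | apply: diagrammaticD].
Qed.

Lemma diagrammatic_tens e1 e1' e2 e2' (f : hom (tval e1) (tval e1')) (g : hom (tval e2) (tval e2')) :
  diagrammatic f -> diagrammatic g -> @diagrammatic (Node e1 e2) (Node e1' e2') (f ⊠ g).
Proof.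
move=> mf mg u; have [b [sb Eb]] := mg u; have [a [sa Ea]] := mf (flat e2' u).
have [b' [sb' Eb']] := stable_flatten e1 sb.
exists (a ∘ b'); split; first exact: stableM.
rewrite /=; crw (assoc_nat _ _ _); crw (esym (tensmM _ _ _ _)); rewrite Eb.
rewrite -tens_lr tens1M; crw Ea; rewrite -!(compA a); congr (_ ∘ _).
by crw Eb'.
Qed.

Lemma flatten_assoc e1 e2 e3 u :
  flatten (Node e1 (Node e2 e3)) u ∘ (assoc (tval e1) (tval e2) (tval e3) ⊠ idm (word u)) =
  flatten (Node (Node e1 e2) e3) u.
Proof.
rewrite /= !tens1M; crw (esym (tens_pentagon _ _ _ _)).
by rewrite -(tensm1 (tval e1)); crw (esym (assoc_nat _ _ _)).
Qed.

Lemma flatten_lunit e u :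
  flatten e u ∘ (lunit (tval e) ⊠ idm (word u)) = flatten (Node Unit e) u.
Proof. by rewrite /= lunit_nat; crw (lunit_tens _ _). Qed.

Lemma flatten_runit e u :
  flatten e u ∘ (runit (tval e) ⊠ idm (word u)) = flatten (Node e Unit) u.
Proof. by rewrite /=; crw (tens_triangle _ _). Qed.

Lemma diagrammatic_assoc e1 e2 e3 : @diagrammatic (Node (Node e1 e2) e3)
  (Node e1 (Node e2 e3)) (assoc (tval e1) (tval e2) (tval e3)).
Proof.
by move=> u; exists (idm _); rewrite flatten_assoc comp1m; split=> //; apply: stable1.
Qed.

Lemma diagrammatic_assocV e1 e2 e3 : @diagrammatic (Node e1 (Node e2 e3))
  (Node (Node e1 e2) e3) (assocV (tval e1) (tval e2) (tval e3)).
Proof.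
move=> u; exists (idm _); split; first exact: stable1.
by rewrite -flatten_assoc comp1m; crw (tensK1 _ (assocVK _ _ _)).
Qed.

Lemma diagrammatic_lunit e : @diagrammatic (Node Unit e) e (lunit (tval e)).
Proof.
by move=> u; exists (idm _); rewrite flatten_lunit comp1m; split=> //; apply: stable1.
Qed.

Lemma diagrammatic_lunitV e : @diagrammatic e (Node Unit e) (lunitV (tval e)).
Proof.
move=> u; exists (idm _); split; first exact: stable1.
by rewrite -flatten_lunit comp1m; crw (tensK1 _ (lunitVK _)).
Qed.

Lemma diagrammatic_runit e : @diagrammatic (Node e Unit) e (runit (tval e)).
Proof.
by move=> u; exists (idm _); rewrite flatten_runit comp1m; split=> //; apply: stable1.
Qed.

Lemma diagrammatic_runitV e : @diagrammatic e (Node e Unit) (runitV (tval e)).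
Proof.
move=> u; exists (idm _); split; first exact: stable1.
by rewrite -flatten_runit comp1m; crw (tensK1 _ (runitVK _)).
Qed.

(** The hexagon, in the form [sw_tensr], moves a letter past a tree one subtree at a time. *)
Lemma stable_sw_letter b e u :
  exists g : hom (word (b :: flat e u)) (word (flat e (b :: u))), stable g /\
  flatten e (b :: u) ∘ sw (letter b) (tval e) (word u) = g ∘ (idm (letter b) ⊠ flatten e u).
Proof.
elim: e u => [|c|e1 IH1 e2 IH2] u /=.
- exists (idm (word (b :: u))); split; first exact: stable1.
  apply: (cancel_pre (tens1K _ (lunitK _))); crw (sw_unit _ _).
  by rewrite lunitVK; crw (tens1K _ (lunitVK _)).
- exists (lsw b c u); split; first exact/stable_permuting/permuting_lsw.
  by rewrite comp1m tensm1 compm1.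
- have [g2 [sg2 E2]] := IH2 u; have [g2' [sg2' E2']] := stable_flatten e1 sg2.
  have [g1 [sg1 E1]] := IH1 (flat e2 u).
  exists (g2' ∘ g1); split; first exact: stableM.
  apply: (cancel_pre (tens1K _ (assocK _ _ _))); rewrite !tens1M.
  crw (tens1K _ (assocVK _ _ _)).
  crw (esym (sw_tensr _ _ _ _)).
  crw (esym (tens1M (tval e1) _ _)); rewrite E2 tens1M; crw E2'.
  crw (esym (sw_nat (idm (letter b)) (idm (tval e1)) (flatten e2 u))).
  by rewrite -(compA g2') E1 !compA.
Qed.

(** Induction on the moved tree, split by [sw_tensl] down to single letters. *)
Lemma stable_sw e e' u : exists g, stable g /\
  flatten e' (flat e u) ∘ (idm (tval e') ⊠ flatten e u) ∘ sw (tval e) (tval e') (word u) =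
  g ∘ flatten e (flat e' u) ∘ (idm (tval e) ⊠ flatten e' u).
Proof.
elim: e u => [|b|e1 IH1 e2 IH2] u /=.
- exists (idm _); split; first exact: stable1.
  rewrite comp1m lunit_nat -compA; congr (_ ∘ _).
  apply: (cancel_pre (lunitK _)); rewrite lunitVK; crw (sw_unitl _ _).
  by rewrite -tens1M lunitVK tensm1.
- have [g [sg E]] := stable_sw_letter b e' u; exists g; split=> //.
  by rewrite tensm1 !compm1.
- have [g1 [sg1 E1]] := IH1 (flat e2 u); have [g2 [sg2 E2]] := IH2 u.
  have [g2' [sg2' E2']] := stable_flatten e1 sg2.
  exists (g1 ∘ g2'); split; first exact: stableM.
  apply: (cancel_pre (assocK _ _ _)); rewrite !tens1M; crw (esym (sw_tensl _ _ _ _)).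
  rewrite -[in RHS](tensm1 (tval e1)); crw (assoc_nat _ _ _); crw (assocVK _ _ _).
  crw (esym (sw_nat (idm (tval e1)) (idm (tval e')) (flatten e2 u))).
  rewrite E1.
  crw (esym (tens1M (tval e1) _ (sw _ _ _))).
  crw (esym (tens1M (tval e1) (flatten e' _) _)); rewrite E2 -compA !tens1M.
  by crw E2'.
Qed.

Lemma diagrammatic_symm e e' :
  @diagrammatic (Node e e') (Node e' e) (symm (tval e) (tval e')).
Proof.
move=> u; have [g [sg E]] := stable_sw e e' u; exists g; split=> //=.
by rewrite !compA -E swE; crw (assocK _ _ _).
Qed.

Fixpoint dtree e :=
  match e with
  | Unit => Unit
  | Leaf b => Leaf (~~ b)
  | Node e1 e2 => Node (dtree e2) (dtree e1)
  end.

Fixpoint tev e : hom (tval (dtree e) ⊗ tval e) 𝟏 :=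
  match e with
  | Unit => lunit 𝟏
  | Leaf true => ev
  | Leaf false => ev ∘ symm X X'
  | Node e1 e2 => ev_tens (tev e1) (tev e2)
  end.

Fixpoint tcoev e : hom 𝟏 (tval e ⊗ tval (dtree e)) :=
  match e with
  | Unit => lunitV 𝟏
  | Leaf true => coev
  | Leaf false => symm X X' ∘ coev
  | Node e1 e2 => coev_tens (tcoev e1) (tcoev e2)
  end.

Lemma dual_pair_tree e : dual_pair (tev e) (tcoev e).
Proof.
elim: e => [|[]|e1 IH1 e2 IH2] //=; first exact: dual_pair_unit.
  exact: dual_pair_symm.
exact: dual_pair_tens.
Qed.

Lemma diagrammatic_ev : @diagrammatic (Node (Leaf false) (Leaf true)) Unit ev.
Proof.
move=> u; exists (lcap u); split; first exact: stable_lcap.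
by rewrite /= capE delE tensm1 !comp1m; crw (assocK _ _ _).
Qed.

Lemma diagrammatic_coev : @diagrammatic Unit (Node (Leaf true) (Leaf false)) coev.
Proof.
move=> u; exists (lcup u); split; first exact: stable_lcup.
by rewrite /= cupE insE tensm1 !comp1m; crw (lunitK _).
Qed.

Lemma diagrammatic_cap e e' t (f : hom (tval e' ⊗ tval e) 𝟏) :
  @diagrammatic (Node e' e) Unit f ->
  @diagrammatic (Node e' (Node e t)) t (cap f (tval t)).
Proof.
move=> df; rewrite capE delE.
apply: (diagrammaticM (e' := Node (Node e' e) t)); last exact: diagrammatic_assocV.
apply: (diagrammaticM (e' := Node Unit t)); first exact: diagrammatic_lunit.
by apply: (diagrammatic_tens (e1' := Unit)) df _; apply: diagrammatic1.
Qed.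

Lemma diagrammatic_cup e e' t (f : hom 𝟏 (tval e ⊗ tval e')) :
  @diagrammatic Unit (Node e e') f ->
  @diagrammatic t (Node e (Node e' t)) (cup f (tval t)).
Proof.
move=> df; rewrite cupE insE.
apply: (diagrammaticM (e' := Node (Node e e') t)); first exact: diagrammatic_assoc.
apply: (diagrammaticM (e' := Node Unit t)); last exact: diagrammatic_lunitV.
by apply: (diagrammatic_tens (e1 := Unit)) df _; apply: diagrammatic1.
Qed.

Lemma diagrammatic_tev e : @diagrammatic (Node (dtree e) e) Unit (tev e).
Proof.
elim: e => [|[]|e1 IH1 e2 IH2] /=.
- exact: (diagrammatic_lunit Unit).
- exact: diagrammatic_ev.
- apply: (diagrammaticM (e' := Node (Leaf false) (Leaf true))); first exact: diagrammatic_ev.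
  exact: (diagrammatic_symm (Leaf true) (Leaf false)).
- apply: (diagrammaticM (e' := Node (dtree e2) (Node (dtree e1) (Node e1 e2)))).
    apply: (diagrammaticM (e' := Node (dtree e2) e2)); first by [].
    apply: (diagrammatic_tens (diagrammatic1 (dtree e2))).
    exact: diagrammatic_cap.
  exact: (diagrammatic_assoc _ _ (Node e1 e2)).
Qed.

Lemma diagrammatic_tcoev e : @diagrammatic Unit (Node e (dtree e)) (tcoev e).
Proof.
elim: e => [|[]|e1 IH1 e2 IH2] /=.
- exact: (diagrammatic_lunitV Unit).
- exact: diagrammatic_coev.
- apply: (diagrammaticM (e' := Node (Leaf true) (Leaf false))); last exact: diagrammatic_coev.
  exact: (diagrammatic_symm (Leaf true) (Leaf false)).
- apply: (diagrammaticM (e' := Node e1 (dtree e1))); last by [].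
  apply: (diagrammaticM (e' := Node e1 (Node e2 (Node (dtree e2) (dtree e1))))).
    exact: (diagrammatic_assocV _ _ (Node (dtree e2) (dtree e1))).
  apply: (diagrammatic_tens (diagrammatic1 e1)).
  exact: diagrammatic_cup.
Qed.

Lemma diagrammatic_transp e1 e2 (f : hom (tval e1) (tval e2)) :
  diagrammatic f -> @diagrammatic (dtree e2) (dtree e1) (transp (tcoev e1) (tev e2) f).
Proof.
move=> df; rewrite /transp /mate.
apply: (diagrammaticM (e' := Node (dtree e2) Unit)); last exact: diagrammatic_runitV.
apply: (diagrammaticM (e' := Node (dtree e2) (Node e2 (dtree e1)))).
  apply: (diagrammaticM (e' := Node (Node (dtree e2) e2) (dtree e1))).
    apply: (diagrammaticM (e' := Node Unit (dtree e1))); first exact: diagrammatic_lunit.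
    apply: (diagrammatic_tens (e1' := Unit)); last exact: diagrammatic1.
    exact: diagrammatic_tev.
  exact: diagrammatic_assocV.
apply: (diagrammatic_tens (e2 := Unit) (e2' := Node e2 (dtree e1))); first exact: diagrammatic1.
apply: (diagrammaticM (e' := Node e1 (dtree e1))); last exact: diagrammatic_tcoev.
by apply: diagrammatic_tens => //; apply: diagrammatic1.
Qed.

(** Only the two words of interest get a description. On [[:: true; false]] a permutation cannot
    exchange the distinct letters, so it is the identity, and what precedes the coevaluation is a
    scalar. *)
Lemma spanned_inv l v : @spanned l v ->
  match l return hom 𝟏 (word l) -> Prop with
  | [::] => fun v => exists r, v = scalm r (idm 𝟏)
  | [:: true; false] => fun v => exists r, v = scalm r (lcup [::])
  | _ => fun _ => True
  end v.
Proof.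
elim=> {l v} [|l l' v q _ IH pq|l|l v w _ IHv _ IHw|r l v _ IH].
- by exists 1; rewrite scalm1.
- case: l' q pq => [|[] [|[] [|? ?]]] q pq //; first by have := permuting_inv pq.
  case: (permuting_inv pq) => [[e [a [pa ->]]]|[m [x [y [px py _]]]]]; last first.
    by case: (permuting_inv py) => [[]//|[? [? [? [_ /permuting_inv]]]]].
  case: (permuting_inv pa) => [[e' [a' [/permuting_inv]]]|[? [? [? [_ /permuting_inv]]]]] //.
  clear pq pa; case: l v IH q a a' => //= v [r ->] _ a a' -> ->.
  exists r; rewrite (eq_irrelevance e erefl) (eq_irrelevance e' erefl) /= !tensm1 comp1m scalm_compr.
  by rewrite compm1.
- by case: l => [|[] [|[] [|? ?]]] //; exists 0; rewrite scal0m.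
- case: l v w IHv IHw => [|[] [|[] [|? ?]]] v w // [r ->] [s ->];
  by exists (r + s); rewrite scalmDl.
- case: l v IH => [|[] [|[] [|? ?]]] v // [s ->]; by exists (r * s); rewrite scalmA.
Qed.

(** Bending [f] gives a spanned tensor on [X ⊗ X'], hence a multiple of [coev]; unbending by the
    triangle identity recovers [f]. *)
Lemma diagrammatic_letter (f : hom X X) :
  @diagrammatic (Leaf true) (Leaf true) f -> exists r, f = scalm r (idm X).
Proof.
(* The context [[:: false]] is the second leg of the coevaluation to which [f] is applied. *)
move=> /(_ [:: false]) [g [sg]]; rewrite /= comp1m compm1 => Eg.
have /= := sg [::] _ (spanned_lcup spanned_nil); rewrite compm1 -Eg => /spanned_inv [r Er].
exists r; have E : (f ⊠ idm X') ∘ coev = (scalm r (idm X) ⊠ idm X') ∘ coev.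
  apply: cup_inj; rewrite !cup_tensl tensm1 Er scalm_tensl scalm_compl.
  by rewrite !tensm1 comp1m.
have aux (h : hom X X) : mater ((h ⊠ idm X') ∘ coev) ev = h.
  rewrite /mater tensM1; crw (assoc_nat _ _ _); rewrite tensm1 -!compA (compA (idm X ⊠ ev)).
  rewrite tens_swap !compA runit_nat -!compA.
  by have := zigzag d; rewrite /mater -!compA => ->; rewrite compm1.
by rewrite -(aux f) E aux.
Qed.
End Words.

(** * The subcategory generated by an object *)

(** Membership is a proposition; [asbool] makes it a boolean predicate, so that the subgroup becomes
    a [zmodType], as [hom] requires. *)
Record zsubgroup (V : zmodType) := ZSubgroup {
  zmem :> V -> Prop;
  zmem0 : zmem 0;
  zmemB : forall x y, zmem x -> zmem y -> zmem (x - y) }.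

Section ZSub.
Variables (V : zmodType) (S : zsubgroup V).
Definition zpred : {pred V} := fun x => `[< S x >].
Lemma zpred_closed : zmod_closed zpred.
Proof.
split; first exact/asboolP/zmem0.
by move=> x y /asboolP Sx /asboolP Sy; apply/asboolP/zmemB.
Qed.
HB.instance Definition _ := GRing.isZmodClosed.Build V zpred zpred_closed.

Record zsub := ZSub { zval : V; zvalP : zpred zval }.
HB.instance Definition _ := [isSub for zval].
HB.instance Definition _ := [Choice of zsub by <:].
HB.instance Definition _ := [SubChoice_isSubZmodule of zsub by <:].

Definition zmk x (Sx : S x)  : zsub := ZSub (asboolT Sx).

Lemma zval_mem (x : zsub) : S (zval x).
Proof. exact/asboolP/zvalP. Qed.

Lemma zval_inj : injective zval.
Proof. exact: val_inj. Qed.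
End ZSub.

Section Diagrammatic.
Variables (K : comPzRingType) (T : rigid_linear_category K) (X : T).

Local Notation tval := (tval X (dual X)).
Local Notation diag := (@diagrammatic K T X (dual X) (coev X) _ _).

Lemma dual_pairT (Y : T) : dual_pair (ev Y) (coev Y).
Proof. by split; [apply: (rigid_zigzag (rl_rigid T)) | apply: (rigid_zagzig (rl_rigid T))]. Qed.

(* An object of [T] presented as a retract of a finite sum of tensor words in [X]
   and its dual, with a diagrammatic projector. *)
Record retract := Retract {
  rcar : T;
  ridx : finType;
  rtree : ridx -> tree;
  rin : forall j, hom rcar (tval (rtree j));
  rout : forall j, hom (tval (rtree j)) rcar;
  rsum : \sum_j (rout j ∘ rin j) = idm rcar;
  rdiag : forall j k, diag (rin k ∘ rout j) }.

Arguments rin : clear implicits.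
Arguments rout : clear implicits.

(** All matrix entries are diagrammatic; the decomposition [rsum] of identities turns composition
    into a matrix product. *)
Definition rmor (Y Z : retract) (f : hom (rcar Y) (rcar Z)) : Prop :=
  forall j k, diag (rin Z k ∘ f ∘ rout Y j).

Lemma rmor0 Y Z : @rmor Y Z 0.
Proof. by move=> j k; rewrite compm0 comp0m; apply: diagrammatic0. Qed.

Lemma rmorB Y Z f g : @rmor Y Z f -> @rmor Y Z g -> @rmor Y Z (f - g).
Proof.
move=> rf rg j k; rewrite compDr compDl compmN compNm.
by apply: diagrammaticD => //; apply: diagrammaticN.
Qed.

Definition rsub Y Z : zsubgroup (hom (rcar Y) (rcar Z)) := ZSubgroup (@rmor0 Y Z) (@rmorB Y Z).

Definition rhom Y Z : zmodType := zsub (rsub Y Z).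

Lemma rmor1 Y : @rmor Y Y (idm _).
Proof. by move=> j k; rewrite compm1; apply: rdiag. Qed.

Lemma rmorM Y Z W g f : @rmor Z W g -> @rmor Y Z f -> @rmor Y W (g ∘ f).
Proof.
move=> rg rf j k; rewrite -[g]compm1 -rsum comp_sumr !comp_suml comp_sumr comp_suml.
apply: diagrammatic_sum => l _; rewrite !compA -2!(compA (rin _ _ ∘ g ∘ _)).
exact: diagrammaticM.
Qed.

Definition rid Y : rhom Y Y := zmk (S := rsub Y Y) (@rmor1 Y).
Definition rcomp Y Z W (g : rhom Z W) (f : rhom Y Z) : rhom Y W :=
  zmk (S := rsub Y W) (rmorM (zval_mem g) (zval_mem f)).

Definition retract_preadditive : preadditive.
Proof.
refine (@Preadditive retract rhom rid rcomp _ _ _ _ _); move=> *; apply: zval_inj.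
- exact: compA.
- exact: comp1m.
- exact: compm1.
- exact: compDl.
- exact: compDr.
Defined.

Local Notation C := retract_preadditive.

Lemma retract_additive : additive_category C.
Proof.
have [zero bip] := tc_additive T; split.
  have [Z zZ] := zero.
  (* A zero object is a retract of the empty sum, with index type [void]. *)
  have idZ : \sum_(j : void) (0 : hom (tval Unit) Z) ∘ (0 : hom Z (tval Unit)) = idm Z.
    by case: (zZ Z) => /(_ (idm Z)) -> _; apply: big1 => -[].
  have diagZ (j k : void) : diag ((0 : hom Z (tval Unit)) ∘ (0 : hom (tval Unit) Z)).
    by case: j.
  exists (@Retract Z void (fun=> Unit) (fun=> 0) (fun=> 0) idZ diagZ) => Y.
  by have [z1 z2] := zZ (rcar Y); split=> f; apply: zval_inj; [apply: z1 | apply: z2].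
move=> Y Z; have [S [i1 [i2 [p1 [p2 [e11 e22 e21 e12 eS]]]]]] := bip (rcar Y) (rcar Z).
pose w (j : ridx Y + ridx Z) := match j with inl j => rtree j | inr j => rtree j end.
pose rI (j : ridx Y + ridx Z) : hom S (tval (w j)) :=
  match j with inl j => rin Y j ∘ p1 | inr j => rin Z j ∘ p2 end.
pose rO (j : ridx Y + ridx Z) : hom (tval (w j)) S :=
  match j with inl j => i1 ∘ rout Y j | inr j => i2 ∘ rout Z j end.
have sumS : \sum_j (rO j ∘ rI j) = idm S.
  rewrite big_sumType /= -eS; congr (_ + _).
    rewrite -[i1 in RHS]compm1 -rsum comp_sumr comp_suml.
    by apply: eq_bigr => j _; rewrite !compA.
  rewrite -[i2 in RHS]compm1 -rsum comp_sumr comp_suml.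
  by apply: eq_bigr => j _; rewrite !compA.
have diagS j k : diag (rI k ∘ rO j).
  case: j k => [j|j] [k|k] /=.
  - by crw e11; apply: rdiag.
  - by crw e21; rewrite compm0 comp0m; apply: diagrammatic0.
  - by crw e12; rewrite compm0 comp0m; apply: diagrammatic0.
  - by crw e22; apply: rdiag.
exists (Retract sumS diagS).
have m1 : rmor (Y := Y) (Z := Retract sumS diagS) i1.
  move=> j [k|k] /=; first by crw e11; apply: rdiag.
  by crw e21; rewrite compm0 comp0m; apply: diagrammatic0.
have m2 : rmor (Y := Z) (Z := Retract sumS diagS) i2.
  move=> j [k|k] /=; last by crw e22; apply: rdiag.
  by crw e12; rewrite compm0 comp0m; apply: diagrammatic0.
have n1 : rmor (Y := Retract sumS diagS) (Z := Y) p1.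
  move=> [k|k] j /=; first by crw e11; apply: rdiag.
  by crw e12; rewrite compm0 comp0m; apply: diagrammatic0.
have n2 : rmor (Y := Retract sumS diagS) (Z := Z) p2.
  move=> [k|k] j /=; last by crw e22; apply: rdiag.
  by crw e21; rewrite compm0 comp0m; apply: diagrammatic0.
exists (zmk (S := rsub _ _) m1), (zmk (S := rsub _ _) m2).
exists (zmk (S := rsub _ _) n1), (zmk (S := rsub _ _) n2).
by split; apply: zval_inj.
Qed.

Lemma retract_pseudo_abelian : pseudo_abelian C.
Proof.
move=> Y e ee; have [S [p [i [pi ip]]]] := tc_pseudo_abelian (congr1 (@zval _ _) ee).
have sumS : \sum_j ((p ∘ rout Y j) ∘ (rin Y j ∘ i)) = idm S.
  rewrite -pi -[p in RHS]compm1 -rsum comp_sumr comp_suml.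
  by apply: eq_bigr => j _; rewrite !compA.
(* The image is a retract of the same words, and its projector is the matrix of [e], whose entries
   are diagrammatic by assumption. *)
have diagS j k : diag ((rin Y k ∘ i) ∘ (p ∘ rout Y j)).
  by rewrite !compA -(compA _ i) ip; apply: (zval_mem e).
exists (Retract sumS diagS).
have mp : rmor (Y := Y) (Z := Retract sumS diagS) p.
  by move=> j k /=; rewrite -(compA _ i) ip; apply: (zval_mem e).
have mi : rmor (Y := Retract sumS diagS) (Z := Y) i.
  by move=> j k /=; rewrite !compA -(compA _ i) ip; apply: (zval_mem e).
exists (zmk (S := rsub _ _) mp), (zmk (S := rsub _ _) mi).
by split; apply: zval_inj.
Qed.

(** * The tensor structure on retracts *)

Lemma rtens_sum (Y Z : retract) :
  \sum_(j : ridx Y * ridx Z) ((rout Y j.1 ⊠ rout Z j.2) ∘ (rin Y j.1 ⊠ rin Z j.2)) =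
  idm (rcar Y ⊗ rcar Z).
Proof.
rewrite -tensm1 -!rsum tens_suml.
under [RHS]eq_bigr do rewrite tens_sumr.
by rewrite pair_bigA; apply: eq_bigr => -[j k] _; rewrite -tensmM.
Qed.

Lemma rtens_diag (Y Z : retract) (j k : ridx Y * ridx Z) :
  @diagrammatic K T X (dual X) (coev X) (Node (rtree j.1) (rtree j.2))
    (Node (rtree k.1) (rtree k.2))
    ((rin Y k.1 ⊠ rin Z k.2) ∘ (rout Y j.1 ⊠ rout Z j.2)).
Proof. by rewrite -tensmM; apply: diagrammatic_tens; apply: rdiag. Qed.

Definition rtens (Y Z : retract) : retract :=
  @Retract (rcar Y ⊗ rcar Z) _ (fun j => Node (rtree j.1) (rtree j.2))
    (fun j => rin Y j.1 ⊠ rin Z j.2) (fun j => rout Y j.1 ⊠ rout Z j.2)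
    (@rtens_sum Y Z) (@rtens_diag Y Z).

Lemma rword_sum e : \sum_(j : unit) (idm (tval e) ∘ idm (tval e)) = idm (tval e).
Proof. by rewrite big_const card_unit /= addr0 comp1m. Qed.

Lemma rword_diag e (j k : unit) : diag (idm (tval e) ∘ idm (tval e)).
Proof. by rewrite comp1m; apply: diagrammatic1. Qed.

Definition rword e : retract :=
  @Retract (tval e) unit (fun=> e) (fun=> idm _) (fun=> idm _) (@rword_sum e) (@rword_diag e).

Lemma rmor_tens Y Y' Z Z' f g : @rmor Y Y' f -> @rmor Z Z' g ->
  @rmor (rtens Y Z) (rtens Y' Z') (f ⊠ g).
Proof.
move=> rf rg j k; rewrite /= -!tensmM; exact: diagrammatic_tens.
Qed.

Definition rtensm Y Y' Z Z' (f : rhom Y Y') (g : rhom Z Z') : rhom (rtens Y Z) (rtens Y' Z') :=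
  zmk (S := rsub _ _) (rmor_tens (zval_mem f) (zval_mem g)).

Lemma rmor_assoc Y Z W : @rmor (rtens (rtens Y Z) W) (rtens Y (rtens Z W))
  (assoc (rcar Y) (rcar Z) (rcar W)).
Proof.
move=> j k; rewrite /= -assoc_nat -compA -!tensmM.
apply: (diagrammaticM (e' := Node (Node _ _) _)); first exact: diagrammatic_assoc.
by do 2?[apply: diagrammatic_tens]; apply: rdiag.
Qed.

Lemma rmor_assocV Y Z W : @rmor (rtens Y (rtens Z W)) (rtens (rtens Y Z) W)
  (assocV (rcar Y) (rcar Z) (rcar W)).
Proof.
move=> j k; rewrite /= -assocV_nat -compA -!tensmM.
apply: (diagrammaticM (e' := Node _ (Node _ _))); first exact: diagrammatic_assocV.
apply: diagrammatic_tens; first exact: rdiag.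
by apply: diagrammatic_tens; apply: rdiag.
Qed.

Lemma rmor_lunit Y : @rmor (rtens (rword Unit) Y) Y (lunit (rcar Y)).
Proof.
move=> j k; rewrite /= -lunit_nat -compA -tensmM.
apply: (diagrammaticM (e' := Node Unit _)); first exact: diagrammatic_lunit.
apply: (diagrammatic_tens (e1 := Unit) (e1' := Unit)); last exact: rdiag.
by rewrite comp1m; apply: (diagrammatic1 _ Unit).
Qed.

Lemma rmor_lunitV Y : @rmor Y (rtens (rword Unit) Y) (lunitV (rcar Y)).
Proof.
move=> j k; rewrite /= -lunitV_nat -compA.
apply: diagrammaticM; first exact: diagrammatic_lunitV; exact: rdiag.
Qed.

Lemma rmor_runit Y : @rmor (rtens Y (rword Unit)) Y (runit (rcar Y)).
Proof.
move=> j k; rewrite /= -runit_nat -compA -tensmM.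
apply: (diagrammaticM (e' := Node _ Unit)); first exact: diagrammatic_runit.
apply: (diagrammatic_tens (e2 := Unit) (e2' := Unit)); first exact: rdiag.
by rewrite comp1m; apply: (diagrammatic1 _ Unit).
Qed.

Lemma rmor_runitV Y : @rmor Y (rtens Y (rword Unit)) (runitV (rcar Y)).
Proof.
move=> j k; rewrite /= -runitV_nat -compA.
apply: diagrammaticM; first exact: diagrammatic_runitV; exact: rdiag.
Qed.

Lemma rmor_symm Y Z : @rmor (rtens Y Z) (rtens Z Y) (symm (rcar Y) (rcar Z)).
Proof.
move=> j k; rewrite /= -symm_nat -compA -tensmM.
apply: (diagrammaticM (e' := Node _ _)); first exact: diagrammatic_symm.
by apply: diagrammatic_tens; apply: rdiag.
Qed.

Definition retract_tensor : tensor_category.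
Proof.
refine (@TensorCategory C retract_additive retract_pseudo_abelian rtens rtensm
  _ _ _ _ (rword Unit)
  (fun Y Z W => zmk (S := rsub _ _) (@rmor_assoc Y Z W))
  (fun Y Z W => zmk (S := rsub _ _) (@rmor_assocV Y Z W)) _ _ _
  (fun Y => zmk (S := rsub _ _) (@rmor_lunit Y))
  (fun Y => zmk (S := rsub _ _) (@rmor_lunitV Y)) _ _ _
  (fun Y => zmk (S := rsub _ _) (@rmor_runit Y))
  (fun Y => zmk (S := rsub _ _) (@rmor_runitV Y)) _ _ _
  (fun Y Z => zmk (S := rsub _ _) (@rmor_symm Y Z)) _ _ _ _ _);
  move=> *; apply: zval_inj.
- exact: tensm1.
- exact: tensmM.
- exact: tensmDl.
- exact: tensmDr.
- exact: assocK.
- exact: assocVK.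
- exact: assoc_nat.
- exact: lunitK.
- exact: lunitVK.
- exact: lunit_nat.
- exact: runitK.
- exact: runitVK.
- exact: runit_nat.
- exact: symm_nat.
- exact: symmK.
- exact: tens_pentagon.
- exact: tens_triangle.
- exact: tens_hexagon.
Defined.

Lemma rmor_scalar (r : K) : @rmor (rword Unit) (rword Unit) (lt_alg T r).
Proof.
move=> j k; rewrite /= comp1m compm1 -scalm_unit.
exact/diagrammaticZ/(diagrammatic1 _ Unit).
Qed.

Definition rscalar (r : K) : endo (𝟏 : retract_tensor) :=
  zmk (S := rsub _ _) (rmor_scalar r).

Lemma rscalar_zmod : zmod_morphism rscalar.
Proof. by move=> r s; apply: zval_inj; exact: (rmorphB (lt_alg T)). Qed.

Lemma rscalar_monoid : monoid_morphism rscalar.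
Proof. by split=> [|r s]; apply: zval_inj; [exact: (rmorph1 (lt_alg T)) | exact: (rmorphM (lt_alg T))]. Qed.

HB.instance Definition _ := GRing.isZmodMorphism.Build K (endo (𝟏 : retract_tensor))
  rscalar rscalar_zmod.
HB.instance Definition _ := GRing.isMonoidMorphism.Build K (endo (𝟏 : retract_tensor))
  rscalar rscalar_monoid.

Definition retract_linear : linear_tensor_category K :=
  @LinearTensorCategory K retract_tensor (rscalar : {rmorphism K -> endo (𝟏 : retract_tensor)}).

Local Notation te := (tev (ev X)).
Local Notation tc := (tcoev (coev X)).

Lemma dual_treeT e : dual_pair (te e) (tc e).
Proof. exact/dual_pair_tree/dual_pairT. Qed.

(** * Duals of retracts *)

Definition rdual_in (Y : retract) j : hom (dual (rcar Y)) (tval (dtree (rtree j))) :=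
  transp (tc (rtree j)) (ev (rcar Y)) (rout Y j).
Definition rdual_out (Y : retract) j : hom (tval (dtree (rtree j))) (dual (rcar Y)) :=
  transp (coev (rcar Y)) (te (rtree j)) (rin Y j).

Lemma rdual_sum Y : \sum_j (rdual_out j ∘ rdual_in j) = idm (dual (rcar Y)).
Proof.
rewrite -(transp1 (dual_pairT (rcar Y))) -rsum transp_sum; apply: eq_bigr => j _.
by rewrite (transpM _ (dual_pairT _) (dual_treeT _)).
Qed.

Variable z : K.
Hypothesis dim_X : euler_char X = lt_alg T z.

(** Duals bring in evaluations, hence closed loops, and this is where the Euler characteristic [z]
    enters. *)
Lemma rdual_diag (Y : retract) (j k : ridx Y) : diag (rdual_in k ∘ rdual_out j).
Proof.
rewrite -(transpM _ (dual_treeT _) (dual_pairT _)).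
by apply: (diagrammatic_transp (dual_pairT X) dim_X); apply: rdiag.
Qed.

Definition rdualo (Y : retract) : retract :=
  @Retract (dual (rcar Y)) (ridx Y) (fun j => dtree (rtree j)) (@rdual_in Y) (@rdual_out Y)
    (@rdual_sum Y) (@rdual_diag Y).

Lemma rmor_ev Y : @rmor (rtens (rdualo Y) Y) (rword Unit) (ev (rcar Y)).
Proof.
move=> [j1 j2] k; rewrite /= comp1m /rdual_out -tens_lr.
crw (ev_transp _ (dual_pairT _) _); rewrite -compA -tens1M.
apply: (diagrammaticM (e' := Node _ (@rtree Y j1)) (e'' := Unit)).
  exact: (diagrammatic_tev (dual_pairT X) dim_X).
by apply: diagrammatic_tens; [apply: diagrammatic1 | apply: rdiag].
Qed.

Lemma rmor_coev Y : @rmor (rword Unit) (rtens Y (rdualo Y)) (coev (rcar Y)).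
Proof.
move=> j [k1 k2]; rewrite /= compm1 /rdual_in -tens_lr.
rewrite -compA (transp_coev _ (dual_pairT _)); rewrite compA -tensM1.
apply: (diagrammaticM (e := Unit) (e' := Node (@rtree Y k2) _)); last exact: diagrammatic_tcoev.
by apply: diagrammatic_tens; [apply: rdiag | apply: diagrammatic1].
Qed.

Definition retract_rigidity : rigidity retract_tensor.
Proof.
refine (@Rigidity retract_tensor rdualo
  (fun Y => zmk (S := rsub _ _) (@rmor_ev Y)) (fun Y => zmk (S := rsub _ _) (@rmor_coev Y)) _ _);
  move=> Y; apply: zval_inj.
- exact: (rigid_zigzag (rl_rigid T)).
- exact: (rigid_zagzig (rl_rigid T)).
Defined.

Definition retract_category : rigid_linear_category K :=
  RigidLinearCategory (rl_cat := retract_linear) retract_rigidity.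

Lemma is_iso1 (A : preadditive) (Y : A) : is_iso (idm Y).
Proof. by exists (idm Y); rewrite comp1m. Qed.

(** Its carrier is [X] by conversion, so forgetting returns [X] on the nose. *)
Definition rgen : retract_category := rword (Leaf true).

Lemma rgen_euler : euler_char rgen = lt_alg retract_category z.
Proof.
apply: zval_inj; exact: dim_X.
Qed.

Lemma rgen_endo (f : hom rgen rgen) : exists r, zval f = scalm r (idm X).
Proof.
have := zval_mem f => /(_ tt tt); rewrite /= comp1m compm1.
exact: (diagrammatic_letter (dual_pairT X)).
Qed.
End Diagrammatic.

(** * The representation category of the infinite symmetric group *)

(** Names of the sets that serve as objects: sums will be biproducts and products tensor products,
    with [CZero] and [COne] as their neutral objects. *)
Inductive code := CZero | COne | CNat | CSum of code & code | CProd of code & code.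

Fixpoint pt c : Type :=
  match c with
  | CZero => void | COne => unit | CNat => nat
  | CSum c d => (pt c + pt d)%type | CProd c d => (pt c * pt d)%type
  end.

(** Transpositions generate the finitary permutations, so invariance is only ever stated for
    them. *)
Definition swapn (i j k : nat) : nat := if k == i then j else if k == j then i else k.

Fixpoint act (i j : nat) c : pt c -> pt c :=
  match c with
  | CZero => id | COne => id | CNat => swapn i j
  | CSum c d => fun x => match x with inl y => inl (act i j y) | inr y => inr (act i j y) end
  | CProd c d => fun x => (act i j x.1, act i j x.2)
  end.

(** A bound on the support: permutations of the numbers from [height x] on fix [x], whence the
    successor at [CNat]. *)
Fixpoint height c : pt c -> nat :=
  match c with
  | CZero => fun=> 0%N | COne => fun=> 0%N | CNat => fun n => n.+1
  | CSum c d => fun x => match x with inl y => height y | inr y => height y end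
  | CProd c d => fun x => maxn (height x.1) (height x.2)
  end.

Lemma swapnK i j : involutive (swapn i j).
Proof.
move=> k; rewrite /swapn; case: (eqVneq k i) => [->|ki].
  by case: (eqVneq j i) => [->|_]; rewrite ?eqxx.
by case: (eqVneq k j) => [->|kj]; rewrite ?eqxx // (negbTE ki) (negbTE kj).
Qed.

Lemma actK i j c : involutive (@act i j c).
Proof.
elim: c => [||| c IHc d IHd | c IHc d IHd] //=; first exact: swapnK.
  by case=> x; rewrite ?IHc ?IHd.
by case=> x y; rewrite IHc IHd.
Qed.

Lemma act_fix i j c (x : pt c) : (height x <= i)%N -> (height x <= j)%N -> act i j x = x.
Proof.
elim: c x => [||| c IHc d IHd | c IHc d IHd] //=.
- move=> k ki kj; rewrite /swapn.
  by rewrite (ltn_eqF ki) (ltn_eqF kj).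
- by case=> x hi hj; rewrite ?IHc ?IHd.
- by case=> x y /=; rewrite !geq_max => /andP[xi yi] /andP[xj yj]; rewrite IHc ?IHd.
Qed.

(** * Integration of smooth functions *)

Section Integral.
Variables (K : comNzRingType) (z : K).

Definition invariant_from s c (f : pt c -> K) : Prop :=
  forall i j, (s <= i)%N -> (s <= j)%N -> forall x, f (act i j x) = f x.

(** Invariance under permutations that fix finitely many numbers. On [nat] this means eventually
    constant, and it is inherited when one argument of two is fixed or integrated out. *)
Definition smooth c (f : pt c -> K) : Prop := exists s, invariant_from s f.

Definition invariant2_from s c d (f : pt c -> pt d -> K) : Prop :=
  forall i j, (s <= i)%N -> (s <= j)%N -> forall x y, f (act i j x) (act i j y) = f x y.

Definition smooth2 c d (f : pt c -> pt d -> K) : Prop := exists s, invariant2_from s f.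

(* The integral for the finitely additive measure on the natural numbers that
   gives mass 1 to each point and mass [z] to the whole; it is defined on
   eventually constant functions. *)
Definition intN (f : nat -> K) : K :=
  if pselect (exists s, forall k, (s <= k)%N -> f k = f s) is left e then
    let s := sval (cid e) in \sum_(k < s) f k + (z - s%:R) * f s
  else 0.

Fixpoint integral c : (pt c -> K) -> K :=
  match c with
  | CZero => fun=> 0
  | COne => fun f => f tt
  | CNat => intN
  | CSum c d => fun f => integral (fun x => f (inl x)) + integral (fun x => f (inr x))
  | CProd c d => fun f => integral (fun x => integral (fun y => f (x, y)))
  end.

Lemma intNE s (f : nat -> K) : (forall k, (s <= k)%N -> f k = f s) ->
  intN f = \sum_(k < s) f k + (z - s%:R) * f s.
Proof.
(* Raising the threshold by 1 moves one tail value into the sum and lowers the mass of the tail by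
   1. *)
have step t (ft : forall k, (t <= k)%N -> f k = f t) n :
    \sum_(k < t) f k + (z - t%:R) * f t = \sum_(k < t + n) f k + (z - (t + n)%:R) * f (t + n)%N.
  elim: n => [|n ->]; first by rewrite addn0.
  rewrite addnS big_ord_recr /= -addrA; congr (_ + _).
  rewrite (ft (t + n).+1) ?(ft (t + n)%N) ?leq_addr //; last by rewrite ltnW // ltnS leq_addr.
  by rewrite -natr1 opprD [in RHS]addrA [in RHS]mulrBl mul1r [RHS]addrC subrK.
move=> fs; rewrite /intN; case: pselect => [e|]; last by case; exists s.
case: (cid e) => t ft /=; case: (leqP s t) => [st|/ltnW ts].
  by rewrite (step s fs (t - s)%N) subnKC.
by rewrite (step t ft (s - t)%N) subnKC.
Qed.

Lemma eq_int c (f g : pt c -> K) : f =1 g -> integral f = integral g.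
Proof. by move=> /funext ->. Qed.

Lemma invariantW s t c (f : pt c -> K) : (s <= t)%N -> invariant_from s f -> invariant_from t f.
Proof. by move=> st fs i j ti tj; apply: fs; apply: leq_trans st _. Qed.

Lemma invariantN s (f : pt CNat -> K) : invariant_from s f ->
  forall k, (s <= k)%N -> f k = f s.
Proof. by move=> fs k sk; rewrite -(fs s k _ _ s) //= /swapn eqxx. Qed.

Lemma smooth_inl c d (f : pt (CSum c d) -> K) : smooth f -> smooth (fun x => f (inl x)).
Proof. by move=> [s fs]; exists s => i j si sj x; rewrite -(fs i j si sj (inl x)). Qed.

Lemma smooth_inr c d (f : pt (CSum c d) -> K) : smooth f -> smooth (fun x => f (inr x)).
Proof. by move=> [s fs]; exists s => i j si sj x; rewrite -(fs i j si sj (inr x)). Qed.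

Lemma smooth2_fixl c d (f : pt c -> pt d -> K) x : smooth2 f -> smooth (f x).
Proof.
move=> [s fs]; exists (maxn s (height x)) => i j.
rewrite !geq_max => /andP[si xi] /andP[sj xj] y.
by rewrite -[in RHS](fs i j) // (act_fix xi xj).
Qed.

Lemma smooth2_fixr c d (f : pt c -> pt d -> K) y : smooth2 f -> smooth (fun x => f x y).
Proof.
move=> [s fs]; exists (maxn s (height y)) => i j.
rewrite !geq_max => /andP[si xi] /andP[sj xj] x.
by rewrite -[in RHS](fs i j) // (act_fix xi xj).
Qed.

Lemma smooth2_prod c d (f : pt (CProd c d) -> K) : smooth f -> smooth2 (fun x y => f (x, y)).
Proof. by move=> [s fs]; exists s => i j si sj x y; rewrite -(fs i j si sj (x, y)). Qed.

Lemma intN_swap i j (f : pt CNat -> K) : smooth f -> intN (fun k => f (swapn i j k)) = intN f.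
Proof.
(* Past [t] the transposition acts trivially and [f] is constant; below [t] it permutes the
   summands. *)
move=> [s fs]; pose t := (maxn s (maxn i j)).+1.
have st : (s <= t)%N by rewrite ltnW // ltnS leq_maxl.
have lit : (i < t)%N by rewrite ltnS !leq_max leqnn orbT.
have ljt : (j < t)%N by rewrite ltnS !leq_max leqnn !orbT.
have ft := invariantN (invariantW st fs).
have swt k : (t <= k)%N -> swapn i j k = k.
  by move=> tk; rewrite /swapn !gtn_eqF ?(leq_trans _ tk).
rewrite (intNE (s := t)); last by move=> k tk; rewrite !swt // ft.
rewrite (intNE ft) swt //; congr (_ + _).
have lsw (k : 'I_t) : (swapn i j k < t)%N by rewrite /swapn; do 2?[case: ifP].
rewrite [RHS](reindex_inj (h := fun k => Ordinal (lsw k))) //.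
by move=> k l [] /(congr1 (swapn i j)); rewrite !swapnK => /val_inj.
Qed.

(** Invariance of the integral over [d] is a premise because [int_act] proves it by induction and
    calls this lemma on smaller codes. *)
Lemma invariant_int s c d (f : pt c -> pt d -> K) :
  (forall i j (g : pt d -> K), smooth g -> integral (fun x => g (act i j x)) = integral g) ->
  invariant2_from s f -> invariant_from s (fun x => integral (f x)).
Proof.
move=> int_act fs i j si sj x.
rewrite -(int_act i j); last by apply: smooth2_fixl; exists s.
by apply: eq_int => y; apply: fs.
Qed.

Lemma int_act i j c (f : pt c -> K) : smooth f -> integral (fun x => f (act i j x)) = integral f.
Proof.
elim: c i j f => [||| c IHc d IHd | c IHc d IHd] i j f fs //=; first exact: intN_swap.
  by rewrite (IHc i j _ (smooth_inl fs)) (IHd i j _ (smooth_inr fs)).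
have [s fs2] := smooth2_prod fs.
rewrite -(IHc i j (fun x => integral (fun y => f (x, y)))); last first.
  by exists s; apply: invariant_int.
apply: eq_int => x; rewrite -(IHd i j (fun y => f (act i j x, y))) //.
by apply: (smooth2_fixl (f := fun x y => f (x, y))); exists s.
Qed.

Lemma smooth_int c d (f : pt c -> pt d -> K) : smooth2 f -> smooth (fun x => integral (f x)).
Proof. by move=> [s fs]; exists s; apply: invariant_int => // i j g; apply: int_act. Qed.

Lemma smooth2C c d (f : pt c -> pt d -> K) : smooth2 f -> smooth2 (fun y x => f x y).
Proof. by move=> [s fs]; exists s => i j si sj y x; apply: fs. Qed.

Lemma smoothM c (f g : pt c -> K) : smooth f -> smooth g -> smooth (fun x => f x * g x).
Proof.
move=> [s fs] [t gt]; exists (maxn s t) => i j.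
by rewrite !geq_max => /andP[si ti] /andP[sj tj] x; rewrite fs ?gt.
Qed.

Lemma smooth_cst c a : smooth (fun _ : pt c => a).
Proof. by exists 0%N. Qed.

Lemma intD c (f g : pt c -> K) : smooth f -> smooth g ->
  integral (fun x => f x + g x) = integral f + integral g.
Proof.
elim: c f g => [||| c IHc d IHd | c IHc d IHd] f g sf sg //=.
- by rewrite addr0.
- have [[s fs] [t gt]] := (sf, sg).
  have fm := invariantN (invariantW (leq_maxl s t) fs).
  have gm := invariantN (invariantW (leq_maxr s t) gt).
  rewrite (intNE fm) (intNE gm) (intNE (s := maxn s t)); last by move=> k mk; rewrite fm ?gm.
  by rewrite big_split /= mulrDr addrACA.
- rewrite (IHc _ _ (smooth_inl sf) (smooth_inl sg)) (IHd _ _ (smooth_inr sf) (smooth_inr sg)).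
  by rewrite addrACA.
- rewrite -IHc; first last.
  + exact/smooth_int/smooth2_prod.
  + exact/smooth_int/smooth2_prod.
  apply: eq_int => x; rewrite IHd //; exact: (smooth2_fixl _ (smooth2_prod _)).
Qed.

Lemma intZ c a (f : pt c -> K) : smooth f -> integral (fun x => a * f x) = a * integral f.
Proof.
elim: c f => [||| c IHc d IHd | c IHc d IHd] f sf //=.
- by rewrite mulr0.
- have [s fs] := sf; have fm := invariantN fs.
  rewrite (intNE fm) (intNE (s := s)); last by move=> k mk; rewrite fm.
  by rewrite mulrDr mulr_sumr [(z - _) * (a * _)]mulrCA.
- by rewrite (IHc _ (smooth_inl sf)) (IHd _ (smooth_inr sf)) mulrDr.
- rewrite -IHc; last exact/smooth_int/smooth2_prod.
  apply: eq_int => x; rewrite IHd //; exact: (smooth2_fixl _ (smooth2_prod _)).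
Qed.

Definition dl c (x y : pt c) : K := `[< x = y >]%:R.

Lemma dlC c (x y : pt c) : dl x y = dl y x.
Proof. by rewrite /dl; congr (_%:R); congr nat_of_bool; apply: asbool_equiv_eq; split. Qed.

Lemma dl_inj c d (h : pt c -> pt d) x y : injective h -> dl (h x) (h y) = dl x y.
Proof.
move=> hi; rewrite /dl; congr (_%:R); congr nat_of_bool.
by apply: asbool_equiv_eq; split=> [/hi|->].
Qed.

Lemma dlxx c (x : pt c) : dl x x = 1.
Proof. by rewrite /dl asboolT. Qed.

Lemma dl_neq c (x y : pt c) : x <> y -> dl x y = 0.
Proof. by move=> ne; rewrite /dl asboolF. Qed.

Lemma dl_pair c d (x x' : pt c) (y y' : pt d) :
  dl (c := CProd c d) (x, y) (x', y') = dl x x' * dl y y'.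
Proof.
rewrite /dl -natrM mulnb -asbool_and; congr (_%:R); congr nat_of_bool.
by apply: asbool_equiv_eq; split=> [[]|[-> ->]].
Qed.

Lemma int0 c : integral (fun _ : pt c => 0) = 0.
Proof.
rewrite -[RHS](mul0r (integral (fun _ : pt c => 0))) -intZ; last exact: smooth_cst.
by apply: eq_int => x; rewrite mul0r.
Qed.

Lemma dl_inl c d (x y : pt c) : dl (c := CSum c d) (inl x) (inl y) = dl x y.
Proof. by apply: (dl_inj (h := inl : pt c -> pt (CSum c d))) => ? ? []. Qed.

Lemma dl_inr c d (x y : pt d) : dl (c := CSum c d) (inr x) (inr y) = dl x y.
Proof. by apply: (dl_inj (h := inr : pt d -> pt (CSum c d))) => ? ? []. Qed.

(** Each point has mass 1. This is how integrals over variables tied by a delta are eliminated in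
    the sequel. *)
Lemma int_dl c (x : pt c) (f : pt c -> K) : integral (fun y => dl x y * f y) = f x.
Proof.
elim: c x f => [||| c IHc d IHd | c IHc d IHd] //=.
- by move=> [] f; rewrite dlxx mul1r.
- move=> n f; have dn k : (n < k)%N -> dl (c := CNat) n k * f k = 0.
    by move=> nk; rewrite dl_neq ?mul0r // => nk'; rewrite nk' ltnn in nk.
  rewrite (intNE (s := n.+1)); last by move=> k nk; rewrite !dn.
  rewrite dn // mulr0 addr0 big_ord_recr /= dlxx mul1r big1 ?add0r // => k _.
  by rewrite dl_neq ?mul0r // => nk; have := ltn_ord k; rewrite -nk ltnn.
- case=> x f.
    transitivity (integral (fun y => dl x y * f (inl y)) + integral (fun _ : pt d => 0)).
      by congr (_ + _); apply: eq_int => y; rewrite ?dl_inl // dl_neq ?mul0r.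
    by rewrite int0 addr0 IHc.
  transitivity (integral (fun _ : pt c => 0) + integral (fun y => dl x y * f (inr y))).
    by congr (_ + _); apply: eq_int => y; rewrite ?dl_inr // dl_neq ?mul0r.
  by rewrite int0 add0r IHd.
- case=> x y f; transitivity (integral (fun x' => dl x x' * f (x', y))); last exact: IHc.
  apply: eq_int => x'; rewrite -(IHd y (fun y' => dl x x' * f (x', y'))).
  by apply: eq_int => y'; rewrite dl_pair mulrA [dl x x' * _]mulrC.
Qed.

Lemma int_dlr c (x : pt c) (f : pt c -> K) : integral (fun y => f y * dl y x) = f x.
Proof. by rewrite -[RHS](int_dl x); apply: eq_int => y; rewrite mulrC dlC. Qed.

Lemma smooth2_int c d e (f : pt c -> pt d -> pt e -> K) s :
  (forall i j, (s <= i)%N -> (s <= j)%N -> forall x y w,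
     f (act i j x) (act i j y) (act i j w) = f x y w) ->
  smooth2 (fun x y => integral (f x y)).
Proof.
move=> fs; exists s => i j si sj x y; rewrite -(int_act i j).
  by apply: eq_int => w; apply: fs.
exists (maxn s (maxn (height (act i j x)) (height (act i j y)))) => i' j'.
rewrite !geq_max => /and3P[si' xi' yi'] /and3P[sj' xj' yj'] w.
by rewrite -[in RHS](fs i' j') // (act_fix xi' xj') (act_fix yi' yj').
Qed.

(** A smooth kernel consists of a finite square, constant tails of finitely many rows and columns,
    and past [s] one diagonal and one off-diagonal value. The resulting expression is symmetric
    because [(s, s.+1)] and [(s.+1, s)] lie in one orbit. *)
Lemma Fubini_nat (f : pt CNat -> pt CNat -> K) : smooth2 f ->
  intN (fun k => intN (f k)) = intN (fun l => intN (fun k => f k l)).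
Proof.
(* The row through [s] is constant only from [s.+1] on, since [(s, s)] lies on the diagonal; hence
   the extra term. *)
have half (g : nat -> nat -> K) s : @invariant2_from s CNat CNat g ->
    intN (fun k => intN (g k)) =
    \sum_(k < s) \sum_(l < s) g k l + (z - s%:R) * \sum_(k < s) g k s +
    (z - s%:R) * (\sum_(l < s) g s l + (g s s + (z - s.+1%:R) * g s s.+1)).
  move=> gs; have fixk (k l m : nat) : (k < l)%N -> (k < m)%N -> swapn l m k = k.
    by move=> kl km; rewrite /swapn !ltn_eqF.
  have gconst k : (k < s)%N -> forall l, (s <= l)%N -> g k l = g k s.
    move=> ks l sl; rewrite -(gs s l _ _ k s) //= fixk //; last exact: leq_trans sl.
    by rewrite /swapn eqxx.
  have gcs l : (s.+1 <= l)%N -> g s l = g s s.+1.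
    move=> sl; rewrite -(gs s.+1 l _ _ s s.+1) //=; last exact: ltnW.
    by rewrite fixk // /swapn eqxx.
  have gint : @invariant_from s CNat (fun k => intN (g k)).
    exact: (@invariant_int s CNat CNat g (fun i j => @int_act i j CNat)).
  rewrite (intNE (invariantN gint)) (intNE (s := s.+1) (f := g s)) // big_ord_recr /=.
  rewrite (eq_bigr _ (fun k _ => intNE (gconst _ (ltn_ord k)))).
  by rewrite big_split /= -mulr_sumr !addrA.
move=> [s fs]; rewrite (half _ s fs) (half (fun l k => f k l) s); last first.
  by move=> i j si sj x y; apply: fs.
rewrite exchange_big -!addrA; congr (_ + _); rewrite !mulrDr addrCA; congr (_ + (_ + (_ + _))).
by rewrite -(fs s s.+1 _ _ s s.+1) //= /swapn !eqxx gtn_eqF.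
Qed.

(** Induction on the first code; at [CNat] a second induction on the other code reduces to pairs of
    numbers. *)
Lemma Fubini c d (f : pt c -> pt d -> K) : smooth2 f ->
  integral (fun x => integral (f x)) = integral (fun y => integral (fun x => f x y)).
Proof.
elim: c d f => [||| c IHc c' IHc' | c IHc c' IHc'] d f sf //=.
- by rewrite int0.
- elim: d f sf => [||| d IHd d' IHd' | d IHd d' IHd'] f sf //=.
  + exact: (int0 CNat).
  + exact: Fubini_nat.
  + have [s fs] := sf.
    have s1 : @smooth2 CNat d (fun k x => f k (inl x)).
      by exists s => i j si sj k x; apply: (fs i j si sj k (inl x)).
    have s2 : @smooth2 CNat d' (fun k x => f k (inr x)).
      by exists s => i j si sj k x; apply: (fs i j si sj k (inr x)).
    rewrite -(IHd _ s1) -(IHd' _ s2) -(@intD CNat) //; exact: smooth_int.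
  + have [s fs] := sf.
    rewrite (IHd (fun k x => integral (fun y => f k (x, y)))); last first.
      by apply: (smooth2_int (f := fun k x y => f k (x, y)) (s := s)) => i j si sj k x y;
         apply: (fs i j si sj k (x, y)).
    apply: eq_int => x; apply: IHd'.
    exists (maxn s (height x)) => i j; rewrite !geq_max => /andP[si xi] /andP[sj xj] k y.
    by rewrite -(fs i j si sj k (x, y)) /= (act_fix xi xj).
- have [s fs] := sf.
  have s1 : @smooth2 c d (fun x => f (inl x)).
    by exists s => i j si sj x y; apply: (fs i j si sj (inl x) y).
  have s2 : @smooth2 c' d (fun x => f (inr x)).
    by exists s => i j si sj x y; apply: (fs i j si sj (inr x) y).
  by rewrite (IHc _ _ s1) (IHc' _ _ s2) -intD //; apply/smooth_int/smooth2C.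
- have [s fs] := sf.
  transitivity (integral (fun x => integral (fun w => integral (fun y => f (x, y) w)))).
    apply: eq_int => x; apply: IHc'.
    exists (maxn s (height x)) => i j; rewrite !geq_max => /andP[si xi] /andP[sj xj] k y.
    by rewrite -(fs i j si sj (x, k) y) /= (act_fix xi xj).
  apply: IHc; apply: (smooth2_int (f := fun x w y => f (x, y) w) (s := s)).
  by move=> i j si sj x w y; apply: (fs i j si sj (x, y) w).
Qed.

(** * The category of equivariant kernels *)

Definition equivariant c d (f : pt c -> pt d -> K) : Prop :=
  forall i j x y, f (act i j x) (act i j y) = f x y.

Lemma equivariant0 c d : @equivariant c d 0.
Proof. by []. Qed.

Lemma equivariantB c d f g : @equivariant c d f -> @equivariant c d g -> equivariant (f - g).
Proof. by move=> ef eg i j x y; exact: (congr2 (fun a b => a - b) (ef i j x y) (eg i j x y)). Qed.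

Definition kernels c d : zsubgroup (pt c -> pt d -> K) :=
  ZSubgroup (@equivariant0 c d) (@equivariantB c d).

Definition khom c d : zmodType := zsub (kernels c d).

Definition kfun c d (f : khom c d) : pt c -> pt d -> K := zval f.

Lemma khomP c d (f g : khom c d) : (forall x y, kfun f x y = kfun g x y) -> f = g.
Proof. by move=> fg; apply: zval_inj; apply/funext => x; apply/funext => y; apply: fg. Qed.

Lemma kfunP c d (f : khom c d) : equivariant (kfun f).
Proof. exact: (@zval_mem _ (kernels c d) f). Qed.

Lemma smooth_kfun c d (f : khom c d) x : smooth (kfun f x).
Proof. by apply: smooth2_fixl; exists 0%N => i j _ _; apply: kfunP. Qed.

Lemma smooth_kfunr c d (f : khom c d) y : smooth (fun x => kfun f x y).
Proof. by apply: smooth2_fixr; exists 0%N => i j _ _; apply: kfunP. Qed.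

Lemma equivariant_dl c : equivariant (@dl c).
Proof. by move=> i j x y; apply/dl_inj/can_inj/actK. Qed.

Definition kid c : khom c c := zmk (S := kernels c c) (@equivariant_dl c).

Lemma equivariant_comp c d e (g : khom d e) (f : khom c d) :
  equivariant (fun x w => integral (fun y => kfun f x y * kfun g y w)).
Proof.
move=> i j x w; rewrite -(int_act i j).
  by apply: eq_int => y; rewrite !kfunP.
by apply: smoothM; [apply: smooth_kfun | apply: smooth_kfunr].
Qed.

Definition kcomp c d e (g : khom d e) (f : khom c d) : khom c e :=
  zmk (S := kernels c e) (equivariant_comp g f).

Lemma kcompE c d e (g : khom d e) (f : khom c d) x w :
  kfun (kcomp g f) x w = integral (fun y => kfun f x y * kfun g y w).
Proof. by []. Qed.

Lemma kfunD c d (f g : khom c d) x y : kfun (f + g) x y = kfun f x y + kfun g x y.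
Proof. by []. Qed.

Lemma kfun_sum (I : finType) c d (f : I -> khom c d) x y :
  kfun (\sum_i f i) x y = \sum_i kfun (f i) x y.
Proof. exact: (big_morph (fun g : khom c d => kfun g x y)). Qed.

Lemma smooth_comp c d e (g : khom d e) (f : khom c d) x w :
  smooth (fun y => kfun f x y * kfun g y w).
Proof. by apply: smoothM; [apply: smooth_kfun | apply: smooth_kfunr]. Qed.

(** Fubini for the two intermediate variables: with the end points fixed the integrand is still
    smooth. *)
Lemma kcompA c d e e' (h : khom e e') (g : khom d e) (f : khom c d) :
  kcomp h (kcomp g f) = kcomp (kcomp h g) f.
Proof.
apply: khomP => x v.
transitivity (integral (fun w => integral (fun y => kfun f x y * (kfun g y w * kfun h w v)))).
  apply: eq_int => w; rewrite kcompE mulrC -intZ; last exact: smooth_comp.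
  by apply: eq_int => y; rewrite mulrC mulrA.
rewrite Fubini.
  by apply: eq_int => y; rewrite kcompE -intZ //; apply: smooth_comp.
exists (maxn (height x) (height v)) => i j.
rewrite !geq_max => /andP[xi vi] /andP[xj vj] w y.
rewrite (kfunP g i j) -[in RHS](kfunP f i j) -[in RHS](kfunP h i j).
by rewrite (act_fix xi xj) (act_fix vi vj).
Qed.

Lemma kcompDl c d e (g h : khom d e) (f : khom c d) :
  kcomp (g + h) f = kcomp g f + kcomp h f.
Proof.
apply: khomP => x w; rewrite kfunD !kcompE -intD; try exact: smooth_comp.
by apply: eq_int => y; rewrite kfunD mulrDr.
Qed.

Lemma kcompDr c d e (h : khom d e) (f g : khom c d) :
  kcomp h (f + g) = kcomp h f + kcomp h g.
Proof.
apply: khomP => x w; rewrite kfunD !kcompE -intD; try exact: smooth_comp.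
by apply: eq_int => y; rewrite kfunD mulrDl.
Qed.

Lemma kcomp1m c d (f : khom c d) : kcomp (kid d) f = f.
Proof. by apply: khomP => x y; apply: int_dlr. Qed.

Lemma kcompm1 c d (f : khom c d) : kcomp f (kid c) = f.
Proof. by apply: khomP => x y; apply: int_dl. Qed.

Definition kernel_category : preadditive :=
  Preadditive kcompA kcomp1m kcompm1 kcompDl kcompDr.

Lemma equivariant_tens c c' d d' (f : khom c c') (g : khom d d') :
  @equivariant (CProd c d) (CProd c' d') (fun x y => kfun f x.1 y.1 * kfun g x.2 y.2).
Proof. by move=> i j x y; rewrite /= !kfunP. Qed.

Definition ktens c c' d d' (f : khom c c') (g : khom d d') : khom (CProd c d) (CProd c' d') :=
  zmk (S := kernels _ _) (equivariant_tens f g).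

Lemma ktensE c c' d d' (f : khom c c') (g : khom d d') x y :
  kfun (ktens f g) x y = kfun f x.1 y.1 * kfun g x.2 y.2.
Proof. by []. Qed.

Lemma ktens1 c d : ktens (kid c) (kid d) = kid (CProd c d).
Proof. by apply: khomP => -[x y] [x' y']; rewrite ktensE /= [RHS]dl_pair. Qed.

Lemma ktensM c c' c'' d d' d'' (f' : khom c' c'') (f : khom c c')
    (g' : khom d' d'') (g : khom d d') :
  ktens (kcomp f' f) (kcomp g' g) = kcomp (ktens f' g') (ktens f g).
Proof.
apply: khomP => -[x y] [u v]; rewrite ktensE !kcompE /=.
rewrite mulrC -intZ; last exact: smooth_comp.
apply: eq_int => w; rewrite mulrC -intZ; last exact: smooth_comp.
by apply: eq_int => t; rewrite /= mulrACA.
Qed.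

Lemma ktensDl c c' d d' (f f' : khom c c') (g : khom d d') :
  ktens (f + f') g = ktens f g + ktens f' g.
Proof. by apply: khomP => x y; rewrite kfunD !ktensE kfunD mulrDl. Qed.

Lemma ktensDr c c' d d' (f : khom c c') (g g' : khom d d') :
  ktens f (g + g') = ktens f g + ktens f g'.
Proof. by apply: khomP => x y; rewrite kfunD !ktensE kfunD mulrDr. Qed.

Section Graph.
Variables (c d : code) (h : pt c -> pt d).
Hypothesis eh : forall i j x, h (act i j x) = act i j (h x).

Lemma equivariant_graph : equivariant (fun x y => dl (h x) y).
Proof. by move=> i j x y; rewrite eh equivariant_dl. Qed.

Definition graph : khom c d := zmk (S := kernels _ _) equivariant_graph.

Lemma graphE x y : kfun graph x y = dl (h x) y.
Proof. by []. Qed.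

(** Composition with a graph is substitution, with no integral left. Associators, unitors and
    symmetries are all graphs, so their axioms reduce to equalities of points. *)
Lemma comp_graph e (f : khom d e) x y : kfun (kcomp f graph) x y = kfun f (h x) y.
Proof. exact: int_dl. Qed.

Lemma graph_comp e (f : khom e c) (h' : pt d -> pt c) x y : cancel h h' -> cancel h' h ->
  kfun (kcomp graph f) x y = kfun f x (h' y).
Proof.
move=> hK h'K; rewrite -[RHS]int_dlr kcompE; apply: eq_int => u; congr (_ * _).
by rewrite graphE -{1}(h'K y) dl_inj //; apply: can_inj hK.
Qed.
End Graph.
End Integral.

(** * The Karoubi envelope *)

(* A linear tensor category, except that idempotents need not split, in which
   every object is its own dual. *)
Record selfdual_category (K : comPzRingType) := SelfdualCategory {
  sd_cat :> preadditive;
  sd_additive : additive_category sd_cat;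
  sten : sd_cat -> sd_cat -> sd_cat;
  stenm : forall X X' Y Y' : sd_cat, hom X X' -> hom Y Y' -> hom (sten X Y) (sten X' Y');
  stenm1 : forall X Y, stenm (idm X) (idm Y) = idm (sten X Y);
  stenmM : forall X X' X'' Y Y' Y'' (f' : hom X' X'') (f : hom X X')
      (g' : hom Y' Y'') (g : hom Y Y'),
    stenm (f' ∘ f) (g' ∘ g) = stenm f' g' ∘ stenm f g;
  stenmDl : forall X X' Y Y' (f f' : hom X X') (g : hom Y Y'),
    stenm (f + f') g = stenm f g + stenm f' g;
  stenmDr : forall X X' Y Y' (f : hom X X') (g g' : hom Y Y'),
    stenm f (g + g') = stenm f g + stenm f g';
  sunit : sd_cat;
  sassoc : forall X Y Z, hom (sten (sten X Y) Z) (sten X (sten Y Z));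
  sassocV : forall X Y Z, hom (sten X (sten Y Z)) (sten (sten X Y) Z);
  sassocK : forall X Y Z, sassocV X Y Z ∘ sassoc X Y Z = idm _;
  sassocVK : forall X Y Z, sassoc X Y Z ∘ sassocV X Y Z = idm _;
  sassoc_nat : forall X X' Y Y' Z Z' (f : hom X X') (g : hom Y Y') (h : hom Z Z'),
    sassoc X' Y' Z' ∘ stenm (stenm f g) h = stenm f (stenm g h) ∘ sassoc X Y Z;
  slunit : forall X, hom (sten sunit X) X;
  slunitV : forall X, hom X (sten sunit X);
  slunitK : forall X, slunitV X ∘ slunit X = idm _;
  slunitVK : forall X, slunit X ∘ slunitV X = idm _;
  slunit_nat : forall X Y (f : hom X Y), slunit Y ∘ stenm (idm sunit) f = f ∘ slunit X;
  srunit : forall X, hom (sten X sunit) X;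
  srunitV : forall X, hom X (sten X sunit);
  srunitK : forall X, srunitV X ∘ srunit X = idm _;
  srunitVK : forall X, srunit X ∘ srunitV X = idm _;
  srunit_nat : forall X Y (f : hom X Y), srunit Y ∘ stenm f (idm sunit) = f ∘ srunit X;
  ssymm : forall X Y, hom (sten X Y) (sten Y X);
  ssymm_nat : forall X X' Y Y' (f : hom X X') (g : hom Y Y'),
    ssymm X' Y' ∘ stenm f g = stenm g f ∘ ssymm X Y;
  ssymmK : forall X Y, ssymm Y X ∘ ssymm X Y = idm _;
  spentagon : forall X Y Z W,
    sassoc X Y (sten Z W) ∘ sassoc (sten X Y) Z W
      = stenm (idm X) (sassoc Y Z W) ∘ sassoc X (sten Y Z) W ∘ stenm (sassoc X Y Z) (idm W);
  striangle : forall X Y,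
    stenm (idm X) (slunit Y) ∘ sassoc X sunit Y = stenm (srunit X) (idm Y);
  shexagon : forall X Y Z,
    sassoc Y Z X ∘ ssymm X (sten Y Z) ∘ sassoc X Y Z
      = stenm (idm Y) (ssymm X Z) ∘ sassoc Y X Z ∘ stenm (ssymm X Y) (idm Z);
  sev : forall X, hom (sten X X) sunit;
  scoev : forall X, hom sunit (sten X X);
  szigzag : forall X, srunit X ∘ stenm (idm X) (sev X) ∘ sassoc X X X
      ∘ stenm (scoev X) (idm X) ∘ slunitV X = idm X;
  szagzig : forall X, slunit X ∘ stenm (sev X) (idm X) ∘ sassocV X X X
      ∘ stenm (idm X) (scoev X) ∘ srunitV X = idm X;
  str : forall X Y, hom X Y -> hom Y X;
  strM : forall X Y Z (g : hom Y Z) (f : hom X Y), str (g ∘ f) = str f ∘ str g;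
  sev_str : forall X Y (f : hom X Y),
    sev X ∘ stenm (str f) (idm X) = sev Y ∘ stenm (idm Y) f;
  scoev_str : forall X Y (f : hom X Y),
    stenm (idm Y) (str f) ∘ scoev Y = stenm f (idm X) ∘ scoev X;
  sscal : {rmorphism K -> endo sunit} }.

Section Karoubi.
Variables (K : comPzRingType) (P : selfdual_category K).
Local Notation "X ⊗ Y" := (@sten K P X Y) : tcat_scope.
Local Notation "f ⊠ g" := (@stenm K P _ _ _ _ f g) : tcat_scope.
Local Notation sunit := (sunit P).

Record karoubi := Karoubi {
  kcar : P;
  kide : hom kcar kcar;
  kidem : kide ∘ kide = kide }.

Definition kmor (X Y : karoubi) (f : hom (kcar X) (kcar Y)) : Prop :=
  kide Y ∘ f = f /\ f ∘ kide X = f.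

Lemma kmor0 X Y : @kmor X Y 0.
Proof. by rewrite /kmor compm0 comp0m. Qed.

Lemma kmorB X Y f g : @kmor X Y f -> @kmor X Y g -> @kmor X Y (f - g).
Proof.
by move=> [fl fr] [gl gr]; rewrite /kmor compDr compDl compmN compNm fl fr gl gr.
Qed.

Definition karhom X Y : zmodType := zsub (ZSubgroup (@kmor0 X Y) (@kmorB X Y)).

Definition km X Y f (kf : @kmor X Y f) : karhom X Y :=
  zmk (S := ZSubgroup (@kmor0 X Y) (@kmorB X Y)) kf.

Lemma kmorP X Y (f : karhom X Y) : kmor (zval f).
Proof. exact: (@zval_mem _ (ZSubgroup (@kmor0 X Y) (@kmorB X Y)) f). Qed.

Lemma kmorl X Y (f : karhom X Y) : kide Y ∘ zval f = zval f.
Proof. by case: (kmorP f). Qed.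

Lemma kmorr X Y (f : karhom X Y) : zval f ∘ kide X = zval f.
Proof. by case: (kmorP f). Qed.

Lemma kmor1 X : @kmor X X (kide X).
Proof. by split; apply: kidem. Qed.

Lemma kmorM X Y Z (g : karhom Y Z) (f : karhom X Y) : kmor (zval g ∘ zval f).
Proof. by split; rewrite ?compA ?kmorl // -compA kmorr. Qed.

Definition karoubi_preadditive : preadditive.
Proof.
refine (@Preadditive karoubi karhom (fun X => km (kmor1 X)) (fun X Y Z g f => km (kmorM g f))
  _ _ _ _ _); move=> *; apply: zval_inj.
- exact: compA.
- exact: kmorl.
- exact: kmorr.
- exact: compDl.
- exact: compDr.
Defined.

Lemma kmor_id X Y f : @kmor (Karoubi (comp1m (idm X))) (Karoubi (comp1m (idm Y))) f.
Proof. by split; rewrite /= ?comp1m ?compm1. Qed.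

Lemma karoubi_additive : additive_category karoubi_preadditive.
Proof.
have [[Z zZ] bip] := sd_additive P; split.
  exists (Karoubi (comp1m (idm Z))) => Y; have [z1 z2] := zZ (kcar Y).
  by split=> f; apply: zval_inj; [apply: z1 | apply: z2].
move=> X Y; have [S [i1 [i2 [p1 [p2 [e11 e22 e21 e12 eS]]]]]] := bip (kcar X) (kcar Y).
pose e := i1 ∘ kide X ∘ p1 + i2 ∘ kide Y ∘ p2.
have ei1 : e ∘ i1 = i1 ∘ kide X.
  by rewrite compDl -!(compA _ _ i1) e11 e21 compm0 addr0 compm1.
have ei2 : e ∘ i2 = i2 ∘ kide Y.
  by rewrite compDl -!(compA _ _ i2) e12 e22 compm0 add0r compm1.
have p1e : p1 ∘ e = kide X ∘ p1.
  by rewrite compDr !compA e11 e12 !comp0m addr0 comp1m.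
have p2e : p2 ∘ e = kide Y ∘ p2.
  by rewrite compDr !compA e21 e22 !comp0m add0r comp1m.
have ee : e ∘ e = e.
  rewrite {2}/e compDr !compA ei1 ei2 -(compA i1) -(compA i2) !kidem //.
exists (Karoubi ee).
have m1 : @kmor X (Karoubi ee) (i1 ∘ kide X).
  by split; rewrite /= ?compA ?ei1 // -compA kidem.
have m2 : @kmor Y (Karoubi ee) (i2 ∘ kide Y).
  by split; rewrite /= ?compA ?ei2 // -compA kidem.
have n1 : @kmor (Karoubi ee) X (kide X ∘ p1).
  by split; rewrite /= -?compA ?p1e // compA kidem.
have n2 : @kmor (Karoubi ee) Y (kide Y ∘ p2).
  by split; rewrite /= -?compA ?p2e // compA kidem.
exists (km m1), (km m2), (km n1), (km n2); split; apply: zval_inj => /=.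
- by crw e11; rewrite kidem.
- by crw e22; rewrite kidem.
- by crw e21; rewrite compm0 comp0m.
- by crw e12; rewrite compm0 comp0m.
- by crw (kidem X); crw (kidem Y).
Qed.

Lemma karoubi_pseudo_abelian : pseudo_abelian karoubi_preadditive.
Proof.
move=> X e ee; have ee' : zval e ∘ zval e = zval e := congr1 (@zval _ _) ee.
exists (Karoubi ee').
have mp : @kmor X (Karoubi ee') (zval e) := conj ee' (@kmorr X X e).
have mi : @kmor (Karoubi ee') X (zval e) := conj (@kmorl X X e) ee'.
by exists (km mp), (km mi); split; apply: zval_inj.
Qed.

(** A structure map that commutes with the idempotents restricts to the summands they cut out. *)
Lemma kmor_nat (X Y : karoubi) (s : hom (kcar X) (kcar Y)) :
  kide Y ∘ s = s ∘ kide X -> kmor (s ∘ kide X).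
Proof. by move=> ns; split; rewrite ?compA ?ns // -!compA !kidem. Qed.

Lemma sten_idem (X Y : karoubi) : (kide X ⊠ kide Y) ∘ (kide X ⊠ kide Y) = kide X ⊠ kide Y.
Proof. by rewrite -stenmM !kidem. Qed.

Definition karten (X Y : karoubi) : karoubi := Karoubi (sten_idem X Y).

Lemma kmor_ten X X' Y Y' (f : karhom X X') (g : karhom Y Y') :
  @kmor (karten X Y) (karten X' Y') (zval f ⊠ zval g).
Proof. by split; rewrite /= -stenmM ?kmorl ?kmorr. Qed.

Definition karunit := Karoubi (comp1m (idm sunit)).

Lemma kar_assoc_nat X Y Z : kide (karten X (karten Y Z)) ∘ sassoc (kcar X) (kcar Y) (kcar Z) =
  sassoc (kcar X) (kcar Y) (kcar Z) ∘ kide (karten (karten X Y) Z).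
Proof. by rewrite /= sassoc_nat. Qed.

Lemma kar_assocV_nat X Y Z : kide (karten (karten X Y) Z) ∘ sassocV (kcar X) (kcar Y) (kcar Z) =
  sassocV (kcar X) (kcar Y) (kcar Z) ∘ kide (karten X (karten Y Z)).
Proof.
apply: (cancel_post (sassocK _ _ _)); crw (sassocVK _ _ _).
rewrite -[LHS](compA _ _ (sassocV _ _ _)) /=.
by rewrite compA sassoc_nat; crw (sassocVK _ _ _).
Qed.

Lemma kar_lunit_nat X : kide X ∘ slunit (kcar X) = slunit (kcar X) ∘ kide (karten karunit X).
Proof. by rewrite /= slunit_nat. Qed.

Lemma kar_lunitV_nat X : kide (karten karunit X) ∘ slunitV (kcar X) = slunitV (kcar X) ∘ kide X.
Proof.
apply: (cancel_post (slunitK _)); rewrite /=; crw (slunitVK _).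
by rewrite slunit_nat; crw (slunitVK _).
Qed.

Lemma kar_runit_nat X : kide X ∘ srunit (kcar X) = srunit (kcar X) ∘ kide (karten X karunit).
Proof. by rewrite /= srunit_nat. Qed.

Lemma kar_runitV_nat X : kide (karten X karunit) ∘ srunitV (kcar X) = srunitV (kcar X) ∘ kide X.
Proof.
apply: (cancel_post (srunitK _)); rewrite /=; crw (srunitVK _).
by rewrite srunit_nat; crw (srunitVK _).
Qed.

Lemma kar_symm_nat X Y : kide (karten Y X) ∘ ssymm (kcar X) (kcar Y) =
  ssymm (kcar X) (kcar Y) ∘ kide (karten X Y).
Proof. by rewrite /= ssymm_nat. Qed.

Lemma sten_splitl (X Y Z W V : P) (s : hom Y Z) (e : hom X Y) (f : hom W V) :
  (s ∘ e) ⊠ f = (s ⊠ idm V) ∘ (e ⊠ f).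
Proof. by rewrite -stenmM comp1m. Qed.

Lemma sten_splitr (X Y Z W V : P) (s : hom Y Z) (e : hom X Y) (f : hom W V) :
  f ⊠ (s ∘ e) = (idm V ⊠ s) ∘ (f ⊠ e).
Proof. by rewrite -stenmM comp1m. Qed.

(** Restriction to summands respects composition, so identities between structure maps descend from
    [P]. *)
Lemma kar_comp (X Y Z : karoubi) (t : hom (kcar Y) (kcar Z)) (s : hom (kcar X) (kcar Y)) :
  kide Y ∘ s = s ∘ kide X -> (t ∘ kide Y) ∘ (s ∘ kide X) = (t ∘ s) ∘ kide X.
Proof. by move=> ns; rewrite -!compA (compA _ s) ns -!compA kidem. Qed.

Definition kar_assoc X Y Z : karhom (karten (karten X Y) Z) (karten X (karten Y Z)) :=
  km (@kmor_nat (karten (karten X Y) Z) (karten X (karten Y Z)) _ (@kar_assoc_nat X Y Z)).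
Definition kar_assocV X Y Z : karhom (karten X (karten Y Z)) (karten (karten X Y) Z) :=
  km (@kmor_nat (karten X (karten Y Z)) (karten (karten X Y) Z) _ (@kar_assocV_nat X Y Z)).
Definition kar_lunit X : karhom (karten karunit X) X :=
  km (@kmor_nat (karten karunit X) X _ (@kar_lunit_nat X)).
Definition kar_lunitV X : karhom X (karten karunit X) :=
  km (@kmor_nat X (karten karunit X) _ (@kar_lunitV_nat X)).
Definition kar_runit X : karhom (karten X karunit) X :=
  km (@kmor_nat (karten X karunit) X _ (@kar_runit_nat X)).
Definition kar_runitV X : karhom X (karten X karunit) :=
  km (@kmor_nat X (karten X karunit) _ (@kar_runitV_nat X)).
Definition kar_symm X Y : karhom (karten X Y) (karten Y X) :=
  km (@kmor_nat (karten X Y) (karten Y X) _ (@kar_symm_nat X Y)).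

Lemma karoubi_pentagon (X Y Z W : karoubi_preadditive) :
  (kar_assoc X Y (karten Z W) : @hom karoubi_preadditive _ _) ∘ kar_assoc (karten X Y) Z W =
  (km (kmor_ten (idm X) (kar_assoc Y Z W)) : @hom karoubi_preadditive _ _)
    ∘ kar_assoc X (karten Y Z) W ∘ km (kmor_ten (kar_assoc X Y Z) (idm W)).
Proof.
apply: zval_inj.
apply: etrans (@kar_comp (karten (karten (karten X Y) Z) W) (karten (karten X Y) (karten Z W))
  _ _ _ (kar_assoc_nat (karten X Y) Z W)) _.
rewrite spentagon /= sten_splitl sten_splitr; crw (esym (sassoc_nat _ _ _)).
rewrite -!compA -!stenmM comp1m !kidem; do 2!congr (_ ∘ _); congr (_ ⊠ _).
do 2![crw (esym (sassoc_nat _ _ _))].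
by rewrite -!compA -!stenmM !kidem.
Qed.

Lemma karoubi_hexagon (X Y Z : karoubi_preadditive) :
  (kar_assoc Y Z X : @hom karoubi_preadditive _ _) ∘ kar_symm X (karten Y Z) ∘ kar_assoc X Y Z =
  (km (kmor_ten (idm Y) (kar_symm X Z)) : @hom karoubi_preadditive _ _)
    ∘ kar_assoc Y X Z ∘ km (kmor_ten (kar_symm X Y) (idm Z)).
Proof.
apply: zval_inj; rewrite /= !sten_splitl !sten_splitr.
have E : (kide Y ⊠ kide X ⊠ kide Z) ∘ (ssymm (kcar X) (kcar Y) ⊠ idm (kcar Z)) =
    (ssymm (kcar X) (kcar Y) ⊠ idm (kcar Z)) ∘ (kide X ⊠ kide Y ⊠ kide Z).
  by rewrite -!stenmM -ssymm_nat compm1 comp1m.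
crw (esym (ssymm_nat _ _)); do 3![crw (esym (sassoc_nat _ _ _))].
do 2![crw E]; rewrite shexagon.
by rewrite -!compA; do 3!congr (_ ∘ _); rewrite -!stenmM !kidem.
Qed.

(* Some proofs are kept opaque here and in [kernel_selfdual] because unfolding
   these categories would otherwise make conversion very slow. *)
Definition karoubi_tensor : tensor_category.
Proof.
refine (@TensorCategory karoubi_preadditive karoubi_additive karoubi_pseudo_abelian karten
  (fun X X' Y Y' f g => km (kmor_ten f g)) _ _ _ _ karunit
  kar_assoc kar_assocV _ _ _ kar_lunit kar_lunitV _ _ _ kar_runit kar_runitV _ _ _
  kar_symm _ _ _ _ _).
- abstract (by move=> X Y; apply: zval_inj).
- abstract (by move=> *; apply: zval_inj; apply: stenmM).
- abstract (by move=> *; apply: zval_inj; apply: stenmDl).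
- abstract (by move=> *; apply: zval_inj; apply: stenmDr).
- abstract (move=> X Y Z; apply: zval_inj;
    apply: etrans (@kar_comp (karten (karten X Y) Z) (karten X (karten Y Z)) _ _ _
    (kar_assoc_nat X Y Z)) _;
    by rewrite sassocK comp1m).
- abstract (move=> X Y Z; apply: zval_inj;
    apply: etrans (@kar_comp (karten X (karten Y Z)) (karten (karten X Y) Z) _ _ _
    (kar_assocV_nat X Y Z)) _;
    by rewrite sassocVK comp1m).
- abstract (move=> X X' Y Y' Z Z' f g h; apply: zval_inj; rewrite /= -compA -!stenmM !kmorl;
    by rewrite compA -sassoc_nat -compA -!stenmM !kmorr).
- abstract (move=> X; apply: zval_inj;
    apply: etrans (@kar_comp (karten karunit X) X _ _ _ (kar_lunit_nat X)) _;
    by rewrite slunitK comp1m).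
- abstract (move=> X; apply: zval_inj;
    apply: etrans (@kar_comp X (karten karunit X) _ _ _ (kar_lunitV_nat X)) _;
    by rewrite slunitVK comp1m).
- abstract (move=> X Y f; apply: zval_inj; rewrite /= -compA -!stenmM kmorl comp1m slunit_nat;
    by rewrite compA -slunit_nat -compA -stenmM comp1m kmorr slunit_nat).
- abstract (move=> X; apply: zval_inj;
    apply: etrans (@kar_comp (karten X karunit) X _ _ _ (kar_runit_nat X)) _;
    by rewrite srunitK comp1m).
- abstract (move=> X; apply: zval_inj;
    apply: etrans (@kar_comp X (karten X karunit) _ _ _ (kar_runitV_nat X)) _;
    by rewrite srunitVK comp1m).
- abstract (move=> X Y f; apply: zval_inj; rewrite /= -compA -!stenmM kmorl comp1m srunit_nat;
    by rewrite compA -srunit_nat -compA -stenmM comp1m kmorr srunit_nat).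
- abstract (move=> X X' Y Y' f g; apply: zval_inj; rewrite /= -compA -!stenmM !kmorl;
    by rewrite compA -ssymm_nat -compA -!stenmM !kmorr).
- abstract (move=> X Y; apply: zval_inj;
    apply: etrans (@kar_comp (karten X Y) (karten Y X) _ _ _ (kar_symm_nat X Y)) _;
    by rewrite ssymmK comp1m).
- exact: karoubi_pentagon.
- abstract (move=> X Y; apply: zval_inj; rewrite /= sten_splitl sten_splitr;
    crw (esym (sassoc_nat _ _ _)); crw (striangle _ _);
    by rewrite -compA -!stenmM !kidem comp1m).
- exact: karoubi_hexagon.
Defined.

Lemma kidem_str (X : karoubi) : str (kide X) ∘ str (kide X) = str (kide X).
Proof. by rewrite -strM kidem. Qed.

(** An object of [P] is its own dual, but a summand is dual to the one cut out by the transposed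
    idempotent. *)
Definition kardual (X : karoubi) : karoubi := Karoubi (kidem_str X).

Lemma sev_kide (X : karoubi) :
  sev (kcar X) ∘ (str (kide X) ⊠ kide X) = sev (kcar X) ∘ (idm _ ⊠ kide X).
Proof.
have -> : str (kide X) ⊠ kide X = (str (kide X) ⊠ idm _) ∘ (idm _ ⊠ kide X).
  by rewrite -stenmM compm1 comp1m.
by rewrite compA sev_str -compA -stenmM kidem compm1.
Qed.

Lemma scoev_kide (X : karoubi) :
  (kide X ⊠ str (kide X)) ∘ scoev (kcar X) = (kide X ⊠ idm _) ∘ scoev (kcar X).
Proof.
have -> : kide X ⊠ str (kide X) = (kide X ⊠ idm _) ∘ (idm _ ⊠ str (kide X)).
  by rewrite -stenmM compm1 comp1m.
by rewrite -compA scoev_str compA -stenmM kidem compm1.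
Qed.

Lemma kmor_ev (X : karoubi) : @kmor (karten (kardual X) X) karunit
  (sev (kcar X) ∘ (idm _ ⊠ kide X)).
Proof.
split; rewrite /= ?comp1m //.
by rewrite -sev_kide -compA (sten_idem (kardual X) X).
Qed.

Lemma kmor_coev (X : karoubi) : @kmor karunit (karten X (kardual X))
  ((kide X ⊠ idm _) ∘ scoev (kcar X)).
Proof.
split; rewrite /= ?compm1 //.
by rewrite -scoev_kide compA (sten_idem X (kardual X)).
Qed.

(** The triangle identity of [kcar X] with idempotents inserted: naturality collects them at the
    ends, where they merge into one [kide X]. The statement has the unfolded form produced by the
    structure maps of the envelope. *)
Lemma karoubi_zigzag (X : karoubi) :
  srunit (kcar X) ∘ (kide X ⊠ idm _) ∘ (kide X ⊠ (sev (kcar X) ∘ (idm _ ⊠ kide X)))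
    ∘ (sassoc _ _ _ ∘ (kide X ⊠ str (kide X) ⊠ kide X))
    ∘ (((kide X ⊠ idm _) ∘ scoev (kcar X)) ⊠ kide X) ∘ (slunitV (kcar X) ∘ kide X) = kide X.
Proof.
have lV : (idm sunit ⊠ kide X) ∘ slunitV (kcar X) = slunitV (kcar X) ∘ kide X.
  exact: (kar_lunitV_nat X).
rewrite -!(compA _ _ (_ ⊠ kide X)) -stenmM kidem.
have -> : (kide X ⊠ str (kide X)) ∘ ((kide X ⊠ idm (kcar X)) ∘ scoev (kcar X)) =
    (kide X ⊠ idm _) ∘ scoev (kcar X).
  by rewrite -scoev_kide compA (sten_idem X (kardual X)).
have -> : ((kide X ⊠ idm (kcar X)) ∘ scoev (kcar X)) ⊠ kide X =
    (kide X ⊠ idm _ ⊠ kide X) ∘ (scoev (kcar X) ⊠ idm _) by rewrite -stenmM compm1.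
crw (sassoc_nat _ _ _).
have E : (kide X ⊠ idm sunit) ∘ (kide X ⊠ (sev (kcar X) ∘ (idm _ ⊠ kide X)))
    ∘ (kide X ⊠ (idm _ ⊠ kide X)) = (kide X ⊠ idm sunit) ∘ (idm _ ⊠ sev (kcar X))
    ∘ (idm _ ⊠ (idm _ ⊠ kide X)).
  by rewrite -!stenmM !kidem !compm1 !comp1m -compA -stenmM kidem comp1m.
crw E; rewrite srunit_nat; crw (esym (sassoc_nat _ _ _)).
have E' : (idm (kcar X) ⊠ idm (kcar X) ⊠ kide X) ∘ (scoev (kcar X) ⊠ idm _) =
    (scoev (kcar X) ⊠ idm _) ∘ (idm _ ⊠ kide X).
  by rewrite -!stenmM stenm1 !compm1 !comp1m.
have Z := congr1 (fun f => kide X ∘ f ∘ kide X ∘ kide X) (szigzag (kcar X)).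
by crw E'; crw lV; rewrite compm1 !kidem !compA in Z.
Qed.

Lemma sassocV_nat X X' Y Y' Z Z' (f : hom X X') (g : hom Y Y') (h : hom Z Z') :
  sassocV X' Y' Z' ∘ (f ⊠ (g ⊠ h)) = (f ⊠ g ⊠ h) ∘ sassocV X Y Z.
Proof.
apply: (cancel_pre (sassocVK X Y Z)); apply: (cancel_post (sassocK X' Y' Z')).
by crw (sassocVK X' Y' Z'); crw (sassocK X Y Z); rewrite sassoc_nat.
Qed.

Lemma karoubi_zagzig (X : karoubi) :
  slunit (kcar X) ∘ (idm _ ⊠ str (kide X)) ∘ ((sev (kcar X) ∘ (idm _ ⊠ kide X)) ⊠ str (kide X))
    ∘ (sassocV _ _ _ ∘ (str (kide X) ⊠ (kide X ⊠ str (kide X))))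
    ∘ (str (kide X) ⊠ ((kide X ⊠ idm _) ∘ scoev (kcar X))) ∘ (srunitV (kcar X) ∘ str (kide X)) =
  str (kide X).
Proof.
set s := str (kide X); have ss : s ∘ s = s by apply: kidem_str.
have rV : (s ⊠ idm sunit) ∘ srunitV (kcar X) = srunitV (kcar X) ∘ s.
  exact: (kar_runitV_nat (kardual X)).
rewrite -!(compA _ _ (s ⊠ _)) -stenmM ss.
have -> : (kide X ⊠ s) ∘ ((kide X ⊠ idm (kcar X)) ∘ scoev (kcar X)) =
    (idm _ ⊠ s) ∘ scoev (kcar X).
  by rewrite -scoev_kide compA (sten_idem X (kardual X)) scoev_kide -scoev_str.
have -> : s ⊠ ((idm (kcar X) ⊠ s) ∘ scoev (kcar X)) =
    (s ⊠ (idm _ ⊠ s)) ∘ (idm _ ⊠ scoev (kcar X)) by rewrite -stenmM compm1.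
crw (sassocV_nat _ _ _); rewrite -sev_str -/s.
have E : (idm sunit ⊠ s) ∘ ((sev (kcar X) ∘ (s ⊠ idm _)) ⊠ s) ∘ (s ⊠ idm _ ⊠ s) =
    (idm sunit ⊠ s) ∘ (sev (kcar X) ⊠ idm _) ∘ (s ⊠ idm _ ⊠ idm _).
  by rewrite -!stenmM !ss !compm1 !comp1m -compA -stenmM ss compm1.
crw E; rewrite slunit_nat; crw (esym (sassocV_nat _ _ _)).
have E' : (s ⊠ (idm (kcar X) ⊠ idm (kcar X))) ∘ (idm _ ⊠ scoev (kcar X)) =
    (idm _ ⊠ scoev (kcar X)) ∘ (s ⊠ idm _).
  by rewrite -!stenmM stenm1 !compm1 !comp1m.
have Z := congr1 (fun f => s ∘ f ∘ s ∘ s) (szagzig (kcar X)).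
by crw E'; crw rV; rewrite compm1 !ss !compA in Z.
Qed.

Definition karoubi_rigidity : rigidity karoubi_tensor.
Proof.
refine (@Rigidity karoubi_tensor kardual (fun X => km (kmor_ev X)) (fun X => km (kmor_coev X))
  _ _) => X; apply: zval_inj; [exact: (karoubi_zigzag X) | exact: (karoubi_zagzig X)].
Defined.

Definition kar_scalar (r : K) : endo (𝟏 : karoubi_tensor) := km (kmor_id (sscal P r)).

Lemma kar_scalar_zmod : zmod_morphism kar_scalar.
Proof. by move=> r s; apply: zval_inj; exact: (rmorphB (sscal P)). Qed.

Lemma kar_scalar_monoid : monoid_morphism kar_scalar.
Proof. by split=> [|r s]; apply: zval_inj; [exact: (rmorph1 (sscal P)) | exact: (rmorphM (sscal P))]. Qed.

HB.instance Definition _ := GRing.isZmodMorphism.Build K (endo (𝟏 : karoubi_tensor))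
  kar_scalar kar_scalar_zmod.
HB.instance Definition _ := GRing.isMonoidMorphism.Build K (endo (𝟏 : karoubi_tensor))
  kar_scalar kar_scalar_monoid.

Definition karoubi_linear : linear_tensor_category K :=
  @LinearTensorCategory K karoubi_tensor (kar_scalar : {rmorphism K -> endo (𝟏 : karoubi_tensor)}).

Definition karoubi_category : rigid_linear_category K :=
  RigidLinearCategory (rl_cat := karoubi_linear) karoubi_rigidity.

Definition kob X : karoubi_category := Karoubi (comp1m (idm X)).

Lemma kar_zval_sum (I : finType) (X Y : karoubi_category) (f : I -> hom X Y) :
  zval (\sum_i f i) = \sum_i zval (f i).
Proof. exact: (big_morph (fun g : hom X Y => zval g)). Qed.

Lemma kob_euler X : zval (euler_char (kob X)) = sev X ∘ ssymm X X ∘ scoev X.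
Proof.
rewrite /= !stenm1 !compm1 comp1m -!compA; congr (_ ∘ _); congr (_ ∘ _).
by have := scoev_kide (kob X); rewrite /= stenm1 comp1m.
Qed.
End Karoubi.

(** * The interpolated category as a rigid tensor category *)

Section Model.
Variables (K : comNzRingType) (z : K).
Local Notation kcat := (kernel_category z).
Local Notation khom := (khom K).

Lemma khomE c d (f g : khom c d) : (forall x y, kfun f x y = kfun g x y) -> f = g :> @hom kcat c d.
Proof. exact: khomP. Qed.

Lemma int_prod c d (f : pt (CProd c d) -> K) :
  integral z f = integral z (fun x => integral z (fun y => f (x, y))).
Proof. by []. Qed.

Lemma kernel_additive : additive_category kcat.
Proof.
split.
  by exists CZero => c; split=> f; apply: khomE; [case | move=> x; case].
move=> c d; exists (CSum c d).
have e1 i j (x : pt c) : (inl (act i j x) : pt (CSum c d)) = act i j (inl x : pt (CSum c d)) by [].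
have e2 i j (x : pt d) : (inr (act i j x) : pt (CSum c d)) = act i j (inr x : pt (CSum c d)) by [].
have ep1 : equivariant (fun (s : pt (CSum c d)) (x : pt c) =>
    if s is inl x' then dl K x' x else 0).
  by move=> i j [x'|//] x /=; rewrite equivariant_dl.
have ep2 : equivariant (fun (s : pt (CSum c d)) (x : pt d) =>
    if s is inr x' then dl K x' x else 0).
  by move=> i j [//|x'] x /=; rewrite equivariant_dl.
exists (graph K e1), (graph K e2), (zmk (S := kernels K _ _) ep1), (zmk (S := kernels K _ _) ep2).
split; apply: khomE.
- by move=> x y; rewrite comp_graph.
- by move=> x y; rewrite comp_graph.
- by move=> x y; rewrite comp_graph.
- by move=> x y; rewrite comp_graph.
- have z0 e (F : pt e -> K) : integral z (fun y => 0 * F y) = 0.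
    by rewrite -[RHS](int0 z e); apply: eq_int => y; rewrite mul0r.
  by move=> [x|x] [y|y]; rewrite kfunD !kcompE /= !z0 int_dl ?addr0 ?add0r.
Qed.

Definition pA c d e (x : pt (CProd (CProd c d) e)) : pt (CProd c (CProd d e)) :=
  (x.1.1, (x.1.2, x.2)).
Definition pAV c d e (x : pt (CProd c (CProd d e))) : pt (CProd (CProd c d) e) :=
  ((x.1, x.2.1), x.2.2).
Definition pL c (x : pt (CProd COne c)) : pt c := x.2.
Definition pLV c (x : pt c) : pt (CProd COne c) := (tt, x).
Definition pR c (x : pt (CProd c COne)) : pt c := x.1.
Definition pRV c (x : pt c) : pt (CProd c COne) := (x, tt).
Definition pS c d (x : pt (CProd c d)) : pt (CProd d c) := (x.2, x.1).

Lemma pAK c d e : cancel (@pA c d e) (@pAV c d e). Proof. by case=> -[]. Qed.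
Lemma pAVK c d e : cancel (@pAV c d e) (@pA c d e). Proof. by case=> x []. Qed.
Lemma pLK c : cancel (@pL c) (@pLV c). Proof. by case=> -[]. Qed.
Lemma pLVK c : cancel (@pLV c) (@pL c). Proof. by []. Qed.
Lemma pRK c : cancel (@pR c) (@pRV c). Proof. by case=> x []. Qed.
Lemma pRVK c : cancel (@pRV c) (@pR c). Proof. by []. Qed.
Lemma pSK c d : cancel (@pS c d) (@pS d c). Proof. by case. Qed.

Lemma pA_act c d e i j x : @pA c d e (act i j x) = act i j (pA x). Proof. by []. Qed.
Lemma pAV_act c d e i j x : @pAV c d e (act i j x) = act i j (pAV x). Proof. by []. Qed.
Lemma pL_act c i j x : @pL c (act i j x) = act i j (pL x). Proof. by []. Qed.
Lemma pLV_act c i j x : @pLV c (act i j x) = act i j (pLV x). Proof. by []. Qed.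
Lemma pR_act c i j x : @pR c (act i j x) = act i j (pR x). Proof. by []. Qed.
Lemma pRV_act c i j x : @pRV c (act i j x) = act i j (pRV x). Proof. by []. Qed.
Lemma pS_act c d i j x : @pS c d (act i j x) = act i j (pS x). Proof. by []. Qed.

Lemma equivariant_ev c :
  @equivariant K (CProd c c) COne (fun x _ => dl K x.1 x.2).
Proof. by move=> i j x y; apply: equivariant_dl. Qed.

Lemma equivariant_coev c :
  @equivariant K COne (CProd c c) (fun _ x => dl K x.1 x.2).
Proof. by move=> i j x y; apply: equivariant_dl. Qed.

(** The indicator of the diagonal pairs a set with itself. *)
Definition kev c : khom (CProd c c) COne := zmk (S := kernels K _ _) (@equivariant_ev c).
Definition kcoev c : khom COne (CProd c c) := zmk (S := kernels K _ _) (@equivariant_coev c).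

Lemma equivariant_tr c d (f : khom c d) : equivariant (fun y x => kfun f x y).
Proof. by move=> i j x y; apply: kfunP. Qed.

Definition ktr c d (f : khom c d) : khom d c := zmk (S := kernels K _ _) (equivariant_tr f).

Lemma equivariant_scal (r : K) : @equivariant K COne COne (fun _ _ => r).
Proof. by []. Qed.

Definition kscal r : endo (COne : kcat) := zmk (S := kernels K COne COne) (equivariant_scal r).

Lemma kscal_zmod : zmod_morphism kscal.
Proof. by move=> r s; apply: khomE. Qed.

Lemma kscal_monoid : monoid_morphism kscal.
Proof.
split=> [|r s]; apply: khomE => -[] []; last by rewrite [LHS]mulrC.
by rewrite [RHS]dlxx.
Qed.

HB.instance Definition _ := GRing.isZmodMorphism.Build K (endo (COne : kcat)) kscal kscal_zmod.
HB.instance Definition _ := GRing.isMonoidMorphism.Build K (endo (COne : kcat)) kscal kscal_monoid.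

Local Notation gA c d e := (graph K (@pA_act c d e) : @hom kcat _ _).
Local Notation gAV c d e := (graph K (@pAV_act c d e) : @hom kcat _ _).
Local Notation gL c := (graph K (@pL_act c) : @hom kcat (CProd COne c) c).
Local Notation gLV c := (graph K (@pLV_act c) : @hom kcat c (CProd COne c)).
Local Notation gR c := (graph K (@pR_act c) : @hom kcat (CProd c COne) c).
Local Notation gRV c := (graph K (@pRV_act c) : @hom kcat c (CProd c COne)).
Local Notation gS c d := (graph K (@pS_act c d) : @hom kcat (CProd c d) (CProd d c)).

Lemma graph_tensl c d e (h : pt c -> pt d) eh x y :
  kfun (ktens (@graph K c d h eh) (idm (e : kcat))) x y = dl K (c := CProd d e) (h x.1, x.2) y.
Proof. by case: x y => [x u] [y v]; rewrite [RHS]dl_pair. Qed.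

Lemma graph_tensr c d e (h : pt c -> pt d) eh x y :
  kfun (ktens (idm (e : kcat)) (@graph K c d h eh)) x y = dl K (c := CProd e d) (x.1, h x.2) y.
Proof. by case: x y => [x u] [y v]; rewrite [RHS]dl_pair. Qed.

Lemma comp_graph_tensl c d e w (h : pt c -> pt d) eh (f : khom (CProd d e) w) x y :
  kfun ((f : @hom kcat _ _) ∘ ktens (@graph K c d h eh) (idm (e : kcat))) x y = kfun f (h x.1, x.2) y.
Proof.
have eh' i j (x' : pt (CProd c e)) : ((h (act i j x').1, (act i j x').2) : pt (CProd d e)) =
    act i j ((h x'.1, x'.2) : pt (CProd d e)) by rewrite /= eh.
have -> : ktens (graph K eh) (idm (e : kcat)) = graph K eh' :> @hom kcat _ _.
  by apply: khomE => u v; rewrite graph_tensl.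
by rewrite comp_graph.
Qed.

(** The three intermediate variables are tied by deltas and integrated out one by one, leaving the
    delta of the identity. *)
Lemma kzigzag (c : kcat) : gR c ∘ ktens (idm c) (kev c) ∘ gA c c c ∘ ktens (kcoev c) (idm c) ∘ gLV c
  = idm c.
Proof.
apply: khomE => x w; rewrite comp_graph kcompE !int_prod.
transitivity (integral z (fun y => integral z (fun y' => integral z (fun x' =>
   dl K x x' * (dl K y y' * (dl K y w * dl K y' x')))))).
  apply: eq_int => y; apply: eq_int => y'; apply: eq_int => x'.
  rewrite ktensE comp_graph.
  by rewrite (graph_comp _ _ _ _ _ (@pRK _) (@pRVK _)) -mulrA [RHS]mulrCA.
transitivity (integral z (fun y => integral z (fun y' => dl K y y' * (dl K y w * dl K y' x)))).
  by apply: eq_int => y; apply: eq_int => y'; rewrite int_dl.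
transitivity (integral z (fun y => dl K x y * dl K y w)); last by rewrite int_dl.
by apply: eq_int => y; rewrite int_dl mulrC dlC.
Qed.

Lemma kzagzig (c : kcat) : gL c ∘ ktens (kev c) (idm c) ∘ gAV c c c ∘ ktens (idm c) (kcoev c) ∘ gRV c
  = idm c.
Proof.
apply: khomE => x w; rewrite comp_graph kcompE !int_prod.
transitivity (integral z (fun x' => integral z (fun y => integral z (fun y' =>
   dl K y y' * (dl K x x' * (dl K x' y * dl K y' w)))))).
  apply: eq_int => x'; rewrite int_prod; apply: eq_int => y; apply: eq_int => y'.
  rewrite ktensE comp_graph.
  by rewrite (graph_comp _ _ _ _ _ (@pLK _) (@pLVK _)) -mulrA [RHS]mulrCA.
transitivity (integral z (fun x' => dl K x x' * dl K x' w)); last by rewrite int_dl.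
apply: eq_int => x'.
transitivity (integral z (fun y => dl K x' y * (dl K x x' * dl K y w))); last by rewrite int_dl.
by apply: eq_int => y; rewrite int_dl mulrCA.
Qed.

Lemma kev_tr (c d : kcat) (f : hom c d) :
  (kev c : @hom kcat _ _) ∘ ktens (ktr f) (idm c) = (kev d : @hom kcat _ _) ∘ ktens (idm d) f.
Proof.
apply: khomE => -[y x] w.
transitivity (kfun f x y); rewrite kcompE int_prod.
  transitivity (integral z (fun u => integral z (fun v => dl K x v * (kfun f u y * dl K u v)))).
    by apply: eq_int => u; apply: eq_int => v; rewrite [RHS]mulrCA mulrA.
  transitivity (integral z (fun u => dl K x u * kfun f u y)); last by rewrite int_dl.
  by apply: eq_int => u; rewrite int_dl mulrC dlC.
transitivity (integral z (fun u => dl K y u * kfun f x u)); first by rewrite int_dl.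
apply: eq_int => u; rewrite -(int_dl z u (fun v => dl K y u * kfun f x v)).
by apply: eq_int => v; rewrite [LHS]mulrC.
Qed.

Lemma kcoev_tr (c d : kcat) (f : hom c d) :
  (ktens (idm d) (ktr f) : @hom kcat _ _) ∘ kcoev d = (ktens f (idm c) : @hom kcat _ _) ∘ kcoev c.
Proof.
apply: khomE => w [u x].
transitivity (kfun f x u); rewrite kcompE int_prod.
  transitivity (integral z (fun p => kfun f x p * dl K p u)); last by rewrite int_dlr.
  apply: eq_int => p; rewrite -(int_dl z p (fun q => kfun f x q * dl K p u)).
  by apply: eq_int => q; rewrite [kfun f x q * _]mulrC.
transitivity (integral z (fun p => kfun f p u * dl K p x)); first by rewrite int_dlr.
apply: eq_int => p; rewrite -(int_dl z p (fun q => kfun f p u * dl K q x)).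
by apply: eq_int => q.
Qed.

Definition kernel_selfdual : selfdual_category K.
Proof.
refine (@SelfdualCategory K kcat kernel_additive CProd (fun c c' d d' f g => ktens f g)
  (@ktens1 K) (@ktensM K z) (@ktensDl K) (@ktensDr K) COne
  (fun c d e => gA c d e) (fun c d e => gAV c d e) _ _ _
  (fun c => gL c) (fun c => gLV c) _ _ _ (fun c => gR c) (fun c => gRV c) _ _ _
  (fun c d => gS c d) _ _ _ _ _ kev kcoev _ _ ktr _ _ _
  (kscal : {rmorphism K -> endo (COne : kcat)})).
- abstract (by move=> c d e; apply: khomE => x y; rewrite comp_graph graphE pAK).
- abstract (by move=> c d e; apply: khomE => x y; rewrite comp_graph graphE pAVK).
- abstract (move=> c c' d d' e e' f g h; apply: khomE => x y;
    rewrite comp_graph (graph_comp _ _ _ _ _ (@pAK _ _ _) (@pAVK _ _ _));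
    by rewrite !ktensE mulrA).
- abstract (by move=> c; apply: khomE => x y; rewrite comp_graph graphE pLK).
- abstract (by move=> c; apply: khomE => x y; rewrite comp_graph graphE pLVK).
- abstract (move=> c d f; apply: khomE => x y;
    rewrite comp_graph (graph_comp _ _ _ _ _ (@pLK _) (@pLVK _));
    by rewrite ktensE; case: x => [[] x]; rewrite [kfun _ _ _]dlxx mul1r).
- abstract (by move=> c; apply: khomE => x y; rewrite comp_graph graphE pRK).
- abstract (by move=> c; apply: khomE => x y; rewrite comp_graph graphE pRVK).
- abstract (move=> c d f; apply: khomE => x y;
    rewrite comp_graph (graph_comp _ _ _ _ _ (@pRK _) (@pRVK _));
    by rewrite ktensE; case: x => [x []]; rewrite [X in _ * X]dlxx mulr1).
- abstract (move=> c c' d d' f g; apply: khomE => x y;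
    rewrite comp_graph (graph_comp _ _ _ _ _ (@pSK _ _) (@pSK _ _));
    by rewrite !ktensE mulrC).
- abstract (by move=> c d; apply: khomE => x y; rewrite comp_graph graphE pSK).
- abstract (move=> c d e e'; apply: khomE => x y; rewrite comp_graph comp_graph_tensl comp_graph;
    by rewrite graph_tensr).
- abstract (by move=> c d; apply: khomE => x y; rewrite comp_graph graph_tensr graph_tensl).
- abstract (move=> c d e; apply: khomE => x y; rewrite comp_graph comp_graph comp_graph_tensl comp_graph;
    by rewrite graph_tensr).
- exact: kzigzag.
- exact: kzagzig.
- abstract (by move=> c d e g f; apply: khomE => x y; apply: eq_int => u; rewrite mulrC).
- exact: kev_tr.
- exact: kcoev_tr.
Defined.

Definition model : rigid_linear_category K := karoubi_category kernel_selfdual.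
Definition model_gen : model := kob (P := kernel_selfdual) (CNat : kernel_selfdual).

Lemma model_gen_euler : euler_char model_gen = lt_alg model z.
Proof.
apply: zval_inj; rewrite kob_euler; apply: khomE => -[] [].
(* The loop integrates 1 over the diagonal, so its value is the mass of [nat], computed below with
   threshold 0. *)
rewrite kcompE int_prod; transitivity (integral z (fun _ : pt CNat => 1 : K)).
  apply: eq_int => x; rewrite -[RHS](dlxx K x) -(int_dl z x (fun y => dl K y x)).
  by apply: eq_int => y; rewrite comp_graph.
by rewrite /= (intNE _ (s := 0)) // big_ord0 add0r subr0 mulr1.
Qed.

(** * Permutations of tensor powers of the generator *)

Definition mval (X Y : model) (f : hom X Y) : pt (kcar X) -> pt (kcar Y) -> K :=
  kfun (zval f : khom (kcar X) (kcar Y)).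

(** For identities, [is_graph (idm X) id] says that the idempotent of [X] is trivial, as it is for
    tensor powers of the generator. *)
Definition is_graph (X Y : model) (f : hom X Y) (h : pt (kcar X) -> pt (kcar Y)) : Prop :=
  forall x y, mval f x y = dl K (h x) y.

Lemma is_graph_comp (X Y Z : model) (g : hom Y Z) (f : hom X Y) h k :
  is_graph f h -> is_graph g k -> is_graph (g ∘ f) (fun x => k (h x)).
Proof.
move=> fh gk x w; rewrite -gk -(int_dl z (h x) (fun y => mval g y w)); apply: eq_int => y.
by rewrite -fh.
Qed.

Lemma is_graph_tens (X X' Y Y' : model) (f : hom X X') (g : hom Y Y') h k :
  is_graph f h -> is_graph g k -> is_graph (f ⊠ g) (fun x => (h x.1, k x.2)).
Proof.
by move=> fh gk [x x'] [y y']; rewrite [RHS]dl_pair -[dl K _ y]fh -[dl K _ y']gk.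
Qed.

Lemma is_graph_id_tens (X Y : model) : is_graph (idm X) id -> is_graph (idm Y) id ->
  is_graph (idm (X ⊗ Y)) id.
Proof. by rewrite -tensm1 => fX fY -[x y] w; rewrite (is_graph_tens fX fY). Qed.

Lemma is_graph_nat (X Y : model) (f : hom X Y) (h : pt (kcar X) -> pt (kcar Y)) eh :
  zval f = kcomp z (@graph K _ _ h eh) (kide X : khom (kcar X) (kcar X)) ->
  is_graph (idm X) id -> is_graph f h.
Proof.
move=> fE fX x w; rewrite -(int_dl z x (fun y => dl K (h y) w)) /mval fE.
by apply: eq_int => y; rewrite -[dl K x y]fX.
Qed.

Lemma is_graph_swap12 (X Y : model) : is_graph (idm X) id -> is_graph (idm Y) id ->
  @is_graph _ _ (swap12 X Y) (fun x => (x.2.1, (x.1, x.2.2))).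
Proof.
move=> fX fY; pose idt := is_graph_id_tens.
have gA : is_graph (assoc X X Y) (@pA _ _ _).
  apply: (@is_graph_nat _ _ (assoc X X Y) _ (@pA_act _ _ _)); first by [].
  exact: (idt _ _ (idt _ _ fX fX) fY).
have gV : is_graph (assocV X X Y) (@pAV _ _ _).
  apply: (@is_graph_nat _ _ (assocV X X Y) _ (@pAV_act _ _ _)); first by [].
  exact: (idt _ _ fX (idt _ _ fX fY)).
have gS : is_graph (symm X X) (@pS _ _).
  apply: (@is_graph_nat _ _ (symm X X) _ (@pS_act _ _)); first by [].
  exact: (idt _ _ fX fX).
exact: is_graph_comp gV (is_graph_comp (is_graph_tens gS fY) gA).
Qed.

Local Notation gen := model_gen.

Lemma is_graph_gen : is_graph (idm gen) id. Proof. by []. Qed.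

Lemma model_neq0 : idm gen <> 0.
Proof.
move=> /(congr1 (fun f : hom gen gen => mval f (0%N : pt CNat) (0%N : pt CNat))).
by rewrite is_graph_gen dlxx; apply/eqP/oner_neq0.
Qed.

Lemma is_graph_tpow n : is_graph (idm (tpow gen n)) id.
Proof.
elim: n => [|n IH]; first by [].
exact: is_graph_id_tens is_graph_gen IH.
Qed.

Local Notation tpt n := (pt (kcar (tpow gen n))).

(** The recursions of [move_first] and [perm_act], on tuples in place of morphisms. *)
Fixpoint pmove n j : tpt n.+1 -> tpt n.+1 :=
  match n, j with
  | m.+1, j'.+1 => fun x => (x.2.1, @pmove m j' (x.1, x.2.2))
  | _, _ => id
  end.

Fixpoint pperm n : 'S_n -> tpt n -> tpt n :=
  match n with
  | 0 => fun _ => id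
  | m.+1 => fun s x => @pmove m (s ord0) (x.1, pperm (unlift_perm s) x.2)
  end.

Lemma is_graph_move n j : is_graph (move_first gen n j) (@pmove n j).
Proof.
elim: n j => [|n IH] [|j]; try exact: is_graph_tpow.
exact: (is_graph_comp (is_graph_swap12 is_graph_gen (@is_graph_tpow n))
  (is_graph_tens is_graph_gen (IH j))).
Qed.

Lemma is_graph_perm n (s : 'S_n) : is_graph (perm_act gen s) (pperm s).
Proof.
elim: n s => [|n IH] s; first exact: (@is_graph_tpow 0).
exact: (is_graph_comp (is_graph_tens is_graph_gen (IH (unlift_perm s)))
  (@is_graph_move n (s ord0))).
Qed.

(** Total in the index, with default value 0 past the end. *)
Fixpoint coordinate n : tpt n -> nat -> nat :=
  match n with
  | 0 => fun _ _ => 0%N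
  | m.+1 => fun x i => if i is i'.+1 then coordinate x.2 i' else x.1
  end.

Lemma coordinate_move0 n j (x : tpt n.+1) : (j <= n)%N -> coordinate (pmove j x) j = x.1.
Proof.
elim: n j x => [|n IH] [|j] // x jn.
exact: (IH j (x.1, x.2.2)).
Qed.

Lemma coordinate_move n j i (x : tpt n.+1) : (j <= n)%N ->
  coordinate (pmove j x) (bump j i) = coordinate x.2 i.
Proof.
elim: n j i x => [|n IH] [|j] // [|i] x jn //=; rewrite ?bumpS //.
exact: (IH j i (x.1, x.2.2)).
Qed.

(** Follows the decomposition of [s] into [unlift_perm s] and a move of the first entry; [bump]
    accounts for the place that this entry takes. *)
Lemma coordinate_perm n (s : 'S_n) (x : tpt n) i :
  coordinate (pperm s x) (s i) = coordinate x i.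
Proof.
elim: n s x i => [|n IH] s x i; first by case: i.
case: (unliftP ord0 i) => [k ->|->]; last first.
  exact: (@coordinate_move0 n (s ord0) (x.1, pperm (unlift_perm s) x.2) (ltn_ord (s ord0))).
have es : s (lift ord0 k) = lift (s ord0) (unlift_perm s k).
  by rewrite -{1}(unlift_permK s) lift_perm_lift.
rewrite es; apply: etrans (IH (unlift_perm s) x.2 k).
exact: (coordinate_move (unlift_perm s k) (x.1, pperm (unlift_perm s) x.2) (ltn_ord (s ord0))).
Qed.

Lemma tpt_ext n (x y : tpt n) : (forall i : 'I_n, coordinate x i = coordinate y i) -> x = y.
Proof.
elim: n x y => [|n IH]; first by case; case.
move=> [a x] [b y] exy; congr (_, _); first exact: (exy ord0).
by apply: IH => i; apply: (exy (lift ord0 i)).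
Qed.

Fixpoint distinct_point m n : tpt n :=
  match n with 0 => tt | n'.+1 => (m, distinct_point m.+1 n') end.

Lemma coordinate_distinct m n i : (i < n)%N -> coordinate (distinct_point m n) i = (m + i)%N.
Proof.
elim: n m i => // n IH m [|i] li /=; first by rewrite addn0.
by rewrite IH // addSnnS.
Qed.

(** Distinct entries give a trivial stabilizer, so one diagonal entry of a kernel singles out the
    identity among all permutations. *)
Lemma pperm_distinct n (s : 'S_n) :
  dl K (pperm s (distinct_point 0 n)) (distinct_point 0 n) = (s == 1%g)%:R.
Proof.
have fixE : pperm s (distinct_point 0 n) = distinct_point 0 n <-> s = 1%g.
  split=> [e|->].
    apply/permP => i; apply: val_inj; rewrite perm1 /=.
    have := coordinate_perm s (distinct_point 0 n) i.
    by rewrite e !coordinate_distinct.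
  apply: tpt_ext => i.
  by have := coordinate_perm 1%g (distinct_point 0 n) i; rewrite perm1.
case: eqP => [s1|ns]; first by rewrite (fixE.2 s1) dlxx.
by rewrite dl_neq // => /fixE.
Qed.

Lemma mval_sum (I : finType) (X Y : model) (f : I -> hom X Y) x y :
  mval (\sum_i f i) x y = \sum_i mval (f i) x y.
Proof. by rewrite /mval kar_zval_sum kfun_sum. Qed.

Lemma mval_compr (X Y Z : model) (f : hom Y Z) (g : hom X Y) h x w :
  is_graph g h -> mval (f ∘ g) x w = mval f (h x) w.
Proof.
move=> gh; rewrite -(int_dl z (h x) (fun y => mval f y w)); apply: eq_int => y.
by rewrite -gh.
Qed.

Lemma mval_compl (X Y Z : model) (g : hom Y Z) (f : hom X Y) h h' x w :
  cancel h h' -> cancel h' h -> is_graph g h -> mval (g ∘ f) x w = mval f x (h' w).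
Proof.
move=> hK h'K gh; rewrite -(int_dlr z (h' w) (fun y => mval f x y)); apply: eq_int => y.
by rewrite -(dl_inj K y (h' w) (can_inj hK)) h'K -gh.
Qed.

Lemma mval_scalm (X Y : model) r (f : hom X Y) x y : is_graph (idm X) id -> is_graph (idm Y) id ->
  mval (scalm r f) x y = r * mval f x y.
Proof.
move=> fX fY; have f1 : is_graph (idm (𝟏 : model)) id by [].
have gL : is_graph (lunit Y) (@pL _).
  apply: (@is_graph_nat _ _ (lunit Y) _ (@pL_act _)); first by [].
  exact: (is_graph_id_tens f1 fY).
have gV : is_graph (lunitV X) (@pLV _).
  by apply: (@is_graph_nat _ _ (lunitV X) _ (@pLV_act _)).
rewrite /scalm (mval_compr _ _ _ gV).
exact: (@mval_compl (𝟏 ⊗ X) (𝟏 ⊗ Y) Y (lunit Y) _ _ _ _ y (@pLK (kcar Y)) (@pLVK (kcar Y)) gL).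
Qed.
End Model.

Section SchurModel.
Variables (K : numFieldType) (z : K).
Local Notation gen := (model_gen z).

(* The coefficient of the identity permutation can be read off at a point with
   distinct coordinates. *)
Lemma schur_idem_model la x : x = distinct_point z 0 (sumn la) ->
  mval (schur_idem la gen) x x =
  ratr ((specht_dim la)%:R / ((sumn la)`!)%:R) * ratr (specht_char (1 : 'S_(sumn la))%g).
Proof.
move=> ->; rewrite mval_scalm; try exact: is_graph_tpow.
congr (_ * _); rewrite mval_sum (bigD1 1%g) //= big1 ?addr0.
  rewrite mval_scalm; try exact: is_graph_tpow.
  by rewrite is_graph_perm pperm_distinct eqxx mulr1.
move=> s /negbTE s1; rewrite mval_scalm; try exact: is_graph_tpow.
by rewrite is_graph_perm pperm_distinct s1 mulr0.
Qed.
End SchurModel.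

(** * The free category *)

Section Specht.
Variable la : seq nat.
Local Notation n := (sumn la).
Local Notation G := [set: 'S_n]%G.

(** A cell is determined by its row and column; [p] preserves rows, and also columns, being the
    inverse of [q]. *)
Lemma row_col_group (p q : 'S_n) :
  p \in row_group la -> q \in col_group la -> (p * q)%g = 1%g -> p = 1%g /\ q = 1%g.
Proof.
rewrite !inE => /forallP rp /forallP cq pq.
suff p1 : p = 1%g by move: pq; rewrite p1 mul1g.
apply/permP => i; apply: val_inj; rewrite perm1 /=.
have cp : reshape_offset la (p i) = reshape_offset la i.
  by rewrite -(eqP (cq (p i))) -permM pq perm1.
by rewrite -(reshape_indexK la (p i)) cp (eqP (rp i)) reshape_indexK.
Qed.

(** The coefficient of the identity is 1: by [row_col_group] only [p = q = 1] contributes to it. *)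
Lemma young_symmetrizer_neq0 : young_symmetrizer la != 0.
Proof.
apply/eqP => /matrixP /(_ 0 (gring_index G 1%g)); rewrite mxE summxE.
rewrite (bigD1 1%g) /=; last by rewrite inE; apply/forallP => i; rewrite perm1.
rewrite summxE (bigD1 1%g) /=; last by rewrite inE; apply/forallP => i; rewrite perm1.
have coef (p q : 'S_n) : p \in row_group la -> q \in col_group la -> (p != 1%g) || (q != 1%g) ->
    ((-1) ^+ (q : bool) *: delta_mx 0 (gring_index G (p * q)%g) : 'rV[rat]_#|G|)
      0 (gring_index G 1%g) = 0.
  move=> rp cq ne; rewrite !mxE eqxx /=; case: eqP => [e|]; last by rewrite mulr0.
  have pq : (p * q)%g = 1%g.
    by move/(congr1 (@enum_val _ _)): e; rewrite !gring_indexK ?inE.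
  by case: (row_col_group rp cq pq) ne => -> ->; rewrite eqxx.
rewrite !big1 ?addr0.
- by rewrite !mxE mulg1 !eqxx odd_perm1 expr0 mulr1; apply/eqP/oner_neq0.
- move=> p /andP[rp p1]; rewrite summxE big1 // => q cq.
  by apply: coef => //; rewrite p1.
- move=> q /andP[cq q1]; apply: coef; rewrite ?q1 ?orbT //.
  by rewrite inE; apply/forallP => i; rewrite perm1.
Qed.

Lemma specht_dim_gt0 : (0 < specht_dim la)%N.
Proof.
rewrite lt0n mxrank_eq0; apply: contra young_symmetrizer_neq0 => /eqP E.
have := cyclic_mx_id (regular_repr rat G) (young_symmetrizer la).
by rewrite -/(specht_mx la) E submx0.
Qed.

Lemma specht_char1 : specht_char (1 : 'S_n)%g = (specht_dim la)%:R.
Proof. by rewrite /specht_char repr_mx1 mxtrace1. Qed.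
End Specht.

(** * Schur idempotents under tensor functors *)

Lemma swap12E (A : tensor_category) (X Y : A) : swap12 X Y = sw X X Y.
Proof. by rewrite swE. Qed.

Section FunctorPowers.
Variables (K : comPzRingType) (A B : linear_tensor_category K) (F : linear_tensor_functor A B).
Variable X : A.

Lemma fhom0 (Y Z : A) : fhom F (0 : hom Y Z) = 0.
Proof. by apply: (@addrI _ (fhom F 0)); rewrite -fhomD !addr0. Qed.

Lemma fhom_sum (I : finType) (Y Z : A) (f : I -> hom Y Z) :
  fhom F (\sum_i f i) = \sum_i fhom F (f i).
Proof. by apply: (big_morph (fhom F)) => [? ?|]; [apply: fhomD | apply: fhom0]. Qed.

Fixpoint ftpow n : hom (tpow (F X) n) (F (tpow X n)) :=
  match n with
  | 0 => funit F
  | m.+1 => ftens F X (tpow X m) ∘ (idm (F X) ⊠ ftpow m)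
  end.

(** A left inverse is what cancels [ftpow] when the vanishing of an idempotent is carried along
    [F]. *)
Lemma ftpow_retraction n : exists g, g ∘ ftpow n = idm _.
Proof.
elim: n => [|n [g gK]] /=; first by have [g []] := funit_iso F; exists g.
have [h [hK _]] := ftens_iso F X (tpow X n).
exists ((idm _ ⊠ g) ∘ h); crw hK; exact: tens1K.
Qed.

Lemma ftens_natr (Y Z : A) (f : hom Y Z) :
  fhom F (idm X ⊠ f) ∘ ftens F X Y = ftens F X Z ∘ (idm _ ⊠ fhom F f).
Proof. by rewrite -ftens_nat fhom1. Qed.

(** Combines the compatibilities of [F] with associators and symmetry into one square, which then
    iterates along tensor powers. *)
Lemma fhom_sw (Y : A) :
  fhom F (sw X X Y) ∘ ftens F X (X ⊗ Y) ∘ (idm _ ⊠ ftens F X Y) =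
  ftens F X (X ⊗ Y) ∘ (idm _ ⊠ ftens F X Y) ∘ sw (F X) (F X) (F Y).
Proof.
rewrite !swE !fhomM.
apply: (cancel_pre (assocVK _ _ _)); crw (assocK _ _ _).
do 2![crw (esym (ftens_assoc F X X Y))].
crw (esym (fhomM F (assocV X X Y) (assoc X X Y))); rewrite assocK fhom1 compm1.
crw (esym (ftens_nat F (symm X X) (idm Y))).
rewrite -!(compA _ _ (ftens F X X ⊠ idm (F Y))) fhom1 -tensM1 ftens_symm tensM1.
by rewrite !compA.
Qed.

Lemma fhom_move_first n j :
  fhom F (move_first X n j) ∘ ftpow n.+1 = ftpow n.+1 ∘ move_first (F X) n j.
Proof.
elim: n j => [|n IH] [|j]; rewrite [move_first X _ _]/= [move_first (F X) _ _]/=;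
  try by rewrite fhom1 comp1m compm1.
rewrite !swap12E.
have -> : ftpow n.+2 = ftens F X (X ⊗ tpow X n) ∘ (idm _ ⊠ ftens F X (tpow X n)) ∘
    (idm _ ⊠ (idm _ ⊠ ftpow n)) by rewrite /= tens1M compA.
rewrite fhomM; crw (fhom_sw (tpow X n)).
have swn := sw_nat (idm (F X)) (idm (F X)) (ftpow n).
crw swn; crw (ftens_natr (move_first X n j)).
have -> : ftens F X (X ⊗ tpow X n) ∘ (idm _ ⊠ fhom F (move_first X n j)) ∘
   (idm _ ⊠ ftens F X (tpow X n)) ∘ (idm _ ⊠ (idm _ ⊠ ftpow n)) =
   ftens F X (X ⊗ tpow X n) ∘ (idm _ ⊠ (fhom F (move_first X n j) ∘ ftpow n.+1)).
  by rewrite /= !tens1M !compA.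
by rewrite IH /= !tens1M !compA.
Qed.

Lemma fhom_perm_act n (s : 'S_n) :
  fhom F (perm_act X s) ∘ ftpow n = ftpow n ∘ perm_act (F X) s.
Proof.
elim: n s => [|n IH] s; first by rewrite /= fhom1 comp1m compm1.
rewrite [perm_act X s]/= [perm_act (F X) s]/= fhomM [RHS]compA -fhom_move_first -!compA.
congr (_ ∘ _); rewrite /=; crw (ftens_natr (perm_act X (unlift_perm s))).
by rewrite -!(compA (ftens F X _)) -!tens1M IH.
Qed.
End FunctorPowers.

Lemma fhom_schur_idem (K : numFieldType) (A B : linear_tensor_category K)
    (F : linear_tensor_functor A B) (X : A) la :
  fhom F (schur_idem la X) ∘ ftpow F X (sumn la) = ftpow F X (sumn la) ∘ schur_idem la (F X).
Proof.
rewrite /schur_idem fhomZ scalm_compl scalm_compr fhom_sum comp_suml comp_sumr.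
congr (scalm _ _); apply: eq_bigr => s _.
by rewrite fhomZ scalm_compl scalm_compr fhom_perm_act.
Qed.

Lemma schur_idem_fhom0 (K : numFieldType) (A B : linear_tensor_category K)
    (F : linear_tensor_functor A B) (X : A) la :
  schur_idem la X = 0 -> schur_idem la (F X) = 0.
Proof.
move=> d0; have [g gK] := ftpow_retraction F X (sumn la).
by apply: (cancel_post gK); rewrite -fhom_schur_idem d0 fhom0 comp0m compm0.
Qed.

(** * The identity functor and the forgetful functor *)

Section IdentityFunctor.
Variables (K : comPzRingType) (T : linear_tensor_category K).

Definition id_functor : linear_tensor_functor T T.
Proof.
refine (@LinearTensorFunctor K T T id (fun Y Z f => f)
  _ _ _ _ (idm 𝟏) (fun Y Z => idm (Y ⊗ Z)) _ _ _ _ _ _ _) => //=;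
  try (by move=> *; apply: is_iso1).
- by move=> *; rewrite comp1m compm1.
- by move=> *; rewrite !tensm1 !comp1m !compm1.
- by move=> *; rewrite !tensm1 !compm1.
- by move=> *; rewrite !tensm1 !compm1.
- by move=> *; rewrite comp1m compm1.
Defined.
End IdentityFunctor.

Section ForgetRetract.
Variables (K : comPzRingType) (T : rigid_linear_category K) (X : T) (z : K).
Hypothesis dim_X : euler_char X = lt_alg T z.
Local Notation C := (retract_category dim_X).
Variables (A : linear_tensor_category K) (F : linear_tensor_functor A C).

Lemma zval_iso (Y Z : C) (f : hom Y Z) : is_iso f -> is_iso (zval f : hom (rcar Y) (rcar Z)).
Proof.
by move=> [g [gf fg]]; exists (zval g); split; [exact: (congr1 (@zval _ _) gf) | exact: (congr1 (@zval _ _) fg)].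
Qed.

(** On objects this is [rcar] of [F], so the equality of objects demanded by freeness is inherited
    from [F]. *)
Definition forget_after : linear_tensor_functor A T.
Proof.
refine (@LinearTensorFunctor K A T (fun Y => rcar (F Y)) (fun Y Z f => zval (fhom F f))
  _ _ _ _ (zval (funit F)) (fun Y Z => zval (ftens F Y Z)) _ _ _ _ _ _ _).
- by move=> Y; rewrite fhom1.
- by move=> Y Z W g f; rewrite fhomM.
- by move=> Y Z g f; rewrite fhomD.
- by move=> Y Z r f; rewrite fhomZ.
- exact: (zval_iso (funit_iso F)).
- by move=> Y Z; exact: (zval_iso (ftens_iso F Y Z)).
- by move=> Y Y' Z Z' f g; exact: (congr1 (@zval _ _) (ftens_nat F f g)).
- by move=> Y Z W; exact: (congr1 (@zval _ _) (ftens_assoc F Y Z W)).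
- by move=> Y; exact: (congr1 (@zval _ _) (ftens_lunit F Y)).
- by move=> Y; exact: (congr1 (@zval _ _) (ftens_runit F Y)).
- by move=> Y Z; exact: (congr1 (@zval _ _) (ftens_symm F Y Z)).
Defined.
End ForgetRetract.

(** * Consequences of freeness *)

Section Free.
Variables (K : numFieldType) (z : K) (T : rigid_linear_category K) (X : T).
Hypothesis T_free : is_free_on z X.

Lemma free_endo (f : hom X X) : exists r, f = scalm r (idm X).
Proof.
have [dim_X univ] := T_free.
have [[F FX] _] := univ _ _ (rgen_euler dim_X).
have [_ uniq] := univ _ _ dim_X.
have GX : forget_after F X = X by rewrite /= FX.
have [u [uiso unat _ _]] := uniq (forget_after F) (id_functor T) GX erefl.
have [r Er] : exists r, zval (fhom F f) = scalm r (idm (rcar (F X))).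
  (* Generalizing the morphism first allows rewriting with the equality of objects. *)
  move: (fhom F f); rewrite FX; exact: rgen_endo.
exists r; have [v [_ uv]] := uiso X.
(* The isomorphism [u X] conjugates [f] into a scalar, and scalars commute with it. *)
have := unat X X f; rewrite /= Er scalm_compr compm1 => Ef.
by apply: (cancel_pre uv); rewrite -Ef scalm_compl comp1m.
Qed.

Lemma free_model : exists F : linear_tensor_functor T (model z), F X = model_gen z.
Proof. by have [_ univ] := T_free; have [] := univ _ _ (model_gen_euler z). Qed.

Lemma free_neq0 : idm X <> 0.
Proof.
have [F FX] := free_model; move=> X0; apply: (@model_neq0 K z).
have : idm (F X) = 0 by rewrite -fhom1 X0 fhom0.
by rewrite FX.
Qed.

(** A zero image makes the idempotent vanish in [T], hence in the model, where its diagonal entry at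
    a tuple of distinct numbers is the square of [specht_dim la] over the factorial of [sumn la],
    nonzero in characteristic 0. *)
Lemma free_not_schur_finite : ~ schur_finite X.
Proof.
move=> [la [_ [S [[p [i [_ ip]]] zS]]]].
have [F FX] := free_model.
have d0 : schur_idem la X = 0.
  by have [_ p0] := zS (tpow X (sumn la)); rewrite -ip (p0 p) compm0.
have := schur_idem_fhom0 F d0; rewrite FX => {}d0.
have := schur_idem_model (z := z) (la := la) erefl.
rewrite d0 specht_char1 => /esym/eqP; rewrite -rmorphM fmorph_eq0.
by rewrite !mulf_eq0 invr_eq0 !pnatr_eq0 !gtn_eqF ?specht_dim_gt0 ?fact_gt0.
Qed.

(** [K] is a field, so a nonzero scalar killing [idm X] would force [idm X = 0], which the model
    excludes. *)
Lemma free_lt_alg_inj (r s : K) : lt_alg T r = lt_alg T s -> r = s.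
Proof.
move=> e; apply/eqP; rewrite -subr_eq0; apply/negPn/negP => rs; apply: free_neq0.
have e0 : scalm (r - s) (idm X) = 0.
  by rewrite /scalm rmorphB e subrr tens0m compm0 comp0m.
by rewrite -[idm X]scalm1 -(mulVf rs) -scalmA e0 scalm0.
Qed.

Lemma free_finite_dimensional : finite_dimensional (lhom X X).
Proof.
exists 1%N, (fun=> idm X) => v; have [r ->] := free_endo v.
by exists (fun=> r); rewrite big_ord1.
Qed.

(** By [free_endo] every endomorphism is a scalar, and nonzero scalars of a field are invertible. *)
Lemma free_ideal (I : endo X -> Prop) : left_ideal I -> (forall x, I x -> x = 0) \/ (forall x, I x).
Proof.
move=> [I0 ID IM]; have [[x [Ix x0]]|nI] := pselect (exists x, I x /\ x <> 0).
  right=> y; have [r Er] := free_endo x; have [s Es] := free_endo y.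
  have r0 : r != 0 by apply/eqP => r0; apply: x0; rewrite Er r0 scal0m.
  suff -> : y = (scalm (s / r) (idm X) : endo X) * x by apply: IM.
  by rewrite Es Er -[RHS]/(_ ∘ _) scalm_compl comp1m scalmA divfK.
by left=> x Ix; apply: contrapT => x0; apply: nI; exists x.
Qed.

Lemma free_semisimple : semisimple_ring (endo X).
Proof.
move=> I lI; have [I0 _ _] := lI; have [Iz|Ia] := free_ideal lI.
  exists (fun=> True); split=> [|x /Iz //|a]; first by split.
  by exists 0, a; rewrite add0r; split.
exists (fun x => x = 0); split=> [|//|a]; last by exists a, 0; rewrite addr0.
by split=> [//|x y -> ->|a x ->]; rewrite ?addr0 ?mulr0.
Qed.

Lemma free_simple : simple_ring (endo X).
Proof. by split; [exact: free_neq0 | move=> I [/free_ideal]]. Qed.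

(** A nonzero summand is everything: the idempotent [i ∘ p] is a nonzero scalar [r] with
    [r * r = r], so [i] and [p] are inverse isomorphisms, and the trace is cyclic. Simplicity of
    [endo Y] excludes the zero summand. *)
Lemma free_summand (Y : T) : is_direct_summand Y X -> simple_ring (endo Y) ->
  euler_char Y = euler_char X.
Proof.
move=> [Y' [i [_ [p [_ [pi _ _ _ _]]]]]] [Y1 _].
have [r Er] := free_endo (i ∘ p).
have r0 : r != 0.
  apply/eqP => r0; apply: Y1; have : idm Y = p ∘ (i ∘ p) ∘ i by rewrite compA pi comp1m pi.
  by rewrite Er r0 scal0m compm0 comp0m.
have ip : i ∘ p = idm X.
  have : (i ∘ p) ∘ (i ∘ p) = i ∘ p by rewrite compA -(compA i) pi compm1.
  rewrite Er scalm_compl comp1m => /(congr1 (scalm r^-1)).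
  by rewrite !scalmA mulrA !mulVf // mul1r scalm1 => ->.
have := trace_cyclic (dual_pairT X) (dual_pairT Y) p i.
by rewrite ip pi !tensm1 !compm1.
Qed.

Lemma free_integral_type : integral_type X <-> exists m : int, z = m%:~R.
Proof.
have [dim_X _] := T_free; split=> [[_ _ intX]|[m zm]].
  have [Z zZ] : exists Z : T, is_zero_object Z by case: (tc_additive T).
  (* [X] is a summand of itself with zero complement, so integrality of summands applies to [z]
     itself. *)
  have XX : is_direct_summand X X.
    exists Z; exists (idm X), 0, (idm X), 0.
    have idZ : idm Z = 0 by have [z1 _] := zZ Z; apply: z1.
    by split; rewrite ?idZ ?comp1m ?comp0m ?addr0.
  have [m Em] := intX X XX free_simple; exists m; apply: free_lt_alg_inj.
  by rewrite -dim_X Em rmorph_int.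
split; [exact: free_finite_dimensional | exact: free_semisimple|].
move=> Y YX sY; exists m; rewrite free_summand // dim_X zm; exact: rmorph_int.
Qed.
End Free.

Theorem proposition3p5 (R : realType) (z : R[i])
    (T : rigid_linear_category R[i]) (X : T) (T_free : is_free_on z X) :
  ~ schur_finite X /\ (integral_type X <-> exists m : int, z = m%:~R).
Proof.
by split; [exact: free_not_schur_finite T_free | exact: free_integral_type T_free].
Qed.
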